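(* Suppose $O=\mathbb{H}^3/\Gamma$ is a mixed-platonic orbifold, and that $\mathcal{P}$ is a $\Gamma$-invariant tiling of $\mathbb{H}^3$ by regular ideal octahedra and regular ideal tetrahedra. There is a unique $\Gamma$-invariant horoball packing $\mathcal{H}$ of $\mathbb{H}^3$ such that: (1) the set of centers of horoballs of $\mathcal{H}$ is the set of ideal vertices of tiles of $\mathcal{P}$; and (2) for each tile $P$ of $\mathcal{P}$ and each ideal vertex $p$ of $P$, the horoball $B_p$ of $\mathcal{H}$ centered at $p$ belongs to $\mathcal{H}_P$. Each such horoball $B_p$ intersects a tile $P$ of $\mathcal{P}$ if and only if $P$ has $p$ as an ideal vertex. If $\Gamma$ is represented in standard position (in the upper half-space model, with invariant tiling $\mathcal{P}$), then $\mathcal{H}$ contains the horoball $B_\infty=\{(z,t): z\in\mathbb{C},\ t\ge 1\}$ centered at $\infty$. Conversely, $\mathcal{P}$ is the unique tiling by ideal polyhedra with edge set equal to the collection of geodesics joining the centers of tangent horoballs of $\mathcal{H}$ and face set equal to the collection of convex hulls of such geodesics corresponding to triples of pairwise-tangent horoballs of $\mathcal{H}$.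
   Context: A connected, complete, finite-volume hyperbolic $3$-orbifold $\mathbb{H}^3/\Gamma$ is mixed-platonic if there is a $\Gamma$-invariant (face-to-face) tiling of $\mathbb{H}^3$ with $n_1\ge1$ $\Gamma$-orbits of regular ideal tetrahedra and $n_2\ge1$ $\Gamma$-orbits of regular ideal octahedra (and no other tiles). A collection of horoballs is a packing if any two distinct members have disjoint interiors. A horoball packing $\mathcal{H}$ is maximal if for any horoball packing $\mathcal{H}'$ such that each horoball of $\mathcal{H}$ is contained in one of $\mathcal{H}'$, $\mathcal{H}'=\mathcal{H}$ (for packings centered at the ideal vertices of a polyhedron $P$, this is understood among packings with those centers). It is $\Gamma$-invariant if $\gamma(B)\in\mathcal{H}$ for all $\gamma\in\Gamma$, $B\in\mathcal{H}$. For a regular ideal tetrahedron or octahedron $P$, $\mathcal{H}_P$ is the unique maximal horoball packing by horoballs centered at the ideal vertices of $P$ that is invariant under the full self-isometry group of $P$; in it, horoballs centered at the two endpoints of an edge of $P$ are tangent. A regular ideal tetrahedron is in standard position if its ideal vertices are $0,1,\infty,\frac12(1+i\sqrt3)$; a regular ideal octahedron is in standard position if its ideal vertices are $0,1,\infty,1+i,i,\frac12(1+i)$. $\Gamma$ is represented in standard position if it leaves invariant a tiling of $\mathbb{H}^3$ by regular ideal tetrahedra and octahedra that has a tile in standard position. *)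

(* Defs.v *)
From HB Require Import structures.
From mathcomp Require Import all_boot all_order all_algebra.
From mathcomp Require Import all_classical all_reals all_analysis.
From mathcomp Require Export complex.

Set Implicit Arguments.
Unset Strict Implicit.
Unset Printing Implicit Defensive.

Import Order.TTheory GRing.Theory Num.Theory.
Import numFieldNormedType.Exports.

Local Open Scope classical_set_scope.
Local Open Scope ring_scope.

(* [hcoord] is [((x, y), t)], the point at height [t > 0] over [x + i y]. *)
Record H3 (R : realType) := MkH3 {
  hcoord : R * R * R;
  _ : 0 < hcoord.2 }.

HB.instance Definition _ (R : realType) := [isSub for @hcoord R].
HB.instance Definition _ (R : realType) := [Choice of H3 R by <:].
HB.instance Definition _ (R : realType) :=
  Topological.copy (H3 R) (initial_topology (@hcoord R)).

Definition hz (R : realType) (p : H3 R) : R[i] := Complex (hcoord p).1.1 (hcoord p).1.2.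
Definition ht (R : realType) (p : H3 R) : R := (hcoord p).2.

(* [|z|] as an element of [R]; the norm of [R[i]] takes its values in [R[i]]. *)
Definition cabs (R : realType) (z : R[i]) : R := Normc.normc z.

Definition arcosh (R : realType) (x : R) : R := ln (x + Num.sqrt (x ^+ 2 - 1)).

Definition hdist (R : realType) (p q : H3 R) : R :=
  arcosh (1 + (cabs (hz p - hz q) ^+ 2 + (ht p - ht q) ^+ 2)
              / (2 * ht p * ht q)).

Definition is_isometry (R : realType) (g : H3 R -> H3 R) : Prop :=
  bijective g /\ forall p q, hdist (g p) (g q) = hdist p q.

Definition invariant_under (R : realType) (G : set (H3 R -> H3 R))
    (S : set (set (H3 R))) : Prop :=
  forall g A, G g -> S A -> S (g @` A).

(* The volume form is [dx dy dt / t^3]. *)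
Definition hvol (R : realType) (A : set (H3 R)) : \bar R :=
  (\int[((@lebesgue_measure R) \x (@lebesgue_measure R))
         \x (@lebesgue_measure R)]_(p in @hcoord R @` A) (p.2 ^- 3)%:E)%E.

(* The sphere at infinity [C] together with [oo]; [None] is [oo]. *)
Definition ideal (R : realType) : Type := option R[i].

(* The semicircle over the segment [[z, w]] is parametrised by the vertical
   projection [(1 - s) z + s w].  The value is empty when [p = q]. *)
Definition geodesic (R : realType) (p q : ideal R) : set (H3 R) :=
  match p, q with
  | None, None => set0
  | None, Some z | Some z, None => [set x | hz x = z]
  | Some z, Some w =>
      [set x | exists s : R,
         [/\ 0 < s < 1,
             hz x = (1 - s)%:C%C * z + s%:C%C * w
           & ht x ^+ 2 = s * (1 - s) * cabs (z - w) ^+ 2] ]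
  end.

Definition between (R : realType) (x z y : H3 R) : Prop :=
  hdist x z + hdist z y = hdist x y.

Definition hconvex (R : realType) (A : set (H3 R)) : Prop :=
  forall x y z, A x -> A y -> between x z y -> A z.

Definition convex_hull (R : realType) (A : set (H3 R)) : set (H3 R) :=
  \bigcap_(C in [set C | hconvex C /\ A `<=` C]) C.

Definition ideal_hull (R : realType) (V : set (ideal R)) : set (H3 R) :=
  convex_hull [set x | exists p q, [/\ V p, V q & geodesic p q x] ].

Definition ideal_polyhedron (R : realType) (P : set (H3 R)) : Prop :=
  P^° !=set0 /\ exists2 V, finite_set V & P = ideal_hull V.

(* On a polyhedron the set [V] below is determined by [P]. *)
Definition ideal_vertex (R : realType) (P : set (H3 R)) (p : ideal R) : Prop :=
  exists V, [/\ finite_set V, P = ideal_hull V & V p].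

(* Faces of all dimensions, [set0] and [P] included. *)
Definition face (R : realType) (P F : set (H3 R)) : Prop :=
  [/\ F `<=` P, hconvex F
    & forall x y z, P x -> P y -> between x z y -> z <> x -> z <> y ->
        F z -> F x /\ F y].

(* Maximal proper faces: when [P] has nonempty interior, its faces of
   dimension two. *)
Definition facet (R : realType) (P F : set (H3 R)) : Prop :=
  [/\ face P F, F <> P
    & forall F', face P F' -> F' <> P -> F `<=` F' -> F' = F].

Definition edge (R : realType) (P e : set (H3 R)) : Prop :=
  face P e /\ exists p q, p <> q /\ e = geodesic p q.

Definition horoball_at (R : realType) (p : ideal R) (B : set (H3 R)) : Prop :=
  exists2 h : R, 0 < h &
    match p with
    | None => B = [set x | h <= ht x]
    | Some z => B = [set x | cabs (hz x - z) ^+ 2 + ht x ^+ 2 <= h * ht x]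
    end.

Definition packing (R : realType) (K : set (set (H3 R))) : Prop :=
  (forall B, K B -> exists p, horoball_at p B) /\
  (forall B B', K B -> K B' -> B <> B' -> B^° `&` B'^° = set0).

Definition centers (R : realType) (K : set (set (H3 R))) : set (ideal R) :=
  [set p | exists2 B, K B & horoball_at p B].

Definition maximal_packing_at (R : realType) (V : set (ideal R))
    (K : set (set (H3 R))) : Prop :=
  [/\ packing K, centers K `<=` V
    & forall K', packing K' -> centers K' `<=` V ->
        (forall B, K B -> exists2 B', K' B' & B `<=` B') -> K' = K].

Definition symmetries (R : realType) (P : set (H3 R)) : set (H3 R -> H3 R) :=
  [set g | is_isometry g /\ g @` P = P].

Definition symmetric_maximal_packing (R : realType) (P : set (H3 R))
    (K : set (set (H3 R))) : Prop :=
  maximal_packing_at (ideal_vertex P) K /\ invariant_under (symmetries P) K.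

(* The packing H_P: for a regular ideal tetrahedron or octahedron [P], exactly
   one [K] satisfies [symmetric_maximal_packing P K]. *)
Definition HP (R : realType) (P : set (H3 R)) : set (set (H3 R)) :=
  \bigcup_(K in symmetric_maximal_packing P) K.

Definition tangent (R : realType) (B B' : set (H3 R)) : Prop :=
  exists x, B `&` B' = [set x].

(* The extension of an isometry to the sphere at infinity sends [p] to [q]. *)
Definition maps_ideal (R : realType) (g : H3 R -> H3 R) (p q : ideal R) : Prop :=
  forall B, horoball_at p B -> horoball_at q (g @` B).

Definition flag (R : realType) (P : set (H3 R)) (p : ideal R)
    (e F : set (H3 R)) : Prop :=
  [/\ ideal_vertex P p, edge P e, facet P F,
      (exists2 q, q <> p & e = geodesic p q) & e `<=` F].

Definition regular (R : realType) (P : set (H3 R)) : Prop :=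
  forall p e F p' e' F', flag P p e F -> flag P p' e' F' ->
    exists g, [/\ symmetries P g, maps_ideal g p p', g @` e = e'
                & g @` F = F'].

Definition ideal_tetrahedron (R : realType) (P : set (H3 R)) : Prop :=
  ideal_polyhedron P /\
  exists v : 'I_4 -> ideal R, injective v /\ P = ideal_hull (range v).

(* [v (i, true)] and [v (i, false)] are opposite vertices; a facet is obtained
   by choosing one vertex in each of the three opposite pairs. *)
Definition ideal_octahedron (R : realType) (P : set (H3 R)) : Prop :=
  ideal_polyhedron P /\
  exists v : 'I_3 * bool -> ideal R,
    [/\ injective v, P = ideal_hull (range v)
      & forall F, facet P F <->
          exists s : 'I_3 -> bool, F = ideal_hull (range (fun i => v (i, s i)))].

Definition regular_ideal_tetrahedron (R : realType) (P : set (H3 R)) : Prop :=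
  ideal_tetrahedron P /\ regular P.

Definition regular_ideal_octahedron (R : realType) (P : set (H3 R)) : Prop :=
  ideal_octahedron P /\ regular P.

Definition standard_position (R : realType) (P : set (H3 R)) : Prop :=
  (regular_ideal_tetrahedron P /\
   ideal_vertex P = [set None; Some (Complex 0 0); Some (Complex 1 0);
                     Some (Complex (1 / 2) (Num.sqrt 3 / 2))])
  \/
  (regular_ideal_octahedron P /\
   ideal_vertex P = [set None; Some (Complex 0 0); Some (Complex 1 0);
                     Some (Complex 1 1); Some (Complex 0 1);
                     Some (Complex (1 / 2) (1 / 2))]).

Definition tiling (R : realType) (T : set (set (H3 R))) : Prop :=
  [/\ forall P, T P -> ideal_polyhedron P,
      \bigcup_(P in T) P = setT,
      forall x : H3 R, exists2 U, nbhs x U &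
        finite_set [set P | T P /\ P `&` U !=set0],
      forall P Q, T P -> T Q -> P <> Q -> P^° `&` Q^° = set0
    & forall P Q, T P -> T Q -> face P (P `&` Q) /\ face Q (P `&` Q)].

Definition platonic_tiling (R : realType) (T : set (set (H3 R))) : Prop :=
  tiling T /\
  forall P, T P -> regular_ideal_tetrahedron P \/ regular_ideal_octahedron P.

Definition tiling_vertices (R : realType) (T : set (set (H3 R))) :
    set (ideal R) := [set p | exists2 P, T P & ideal_vertex P p].

Definition tiling_edges (R : realType) (T : set (set (H3 R))) :
    set (set (H3 R)) := [set e | exists2 P, T P & edge P e].

Definition tiling_facets (R : realType) (T : set (set (H3 R))) :
    set (set (H3 R)) := [set F | exists2 P, T P & facet P F].

(* Elements of [Isom(H^3)] may reverse orientation. *)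
Definition isometry_group (R : realType) (G : set (H3 R -> H3 R)) : Prop :=
  [/\ forall g, G g -> is_isometry g,
      G id,
      forall g h, G g -> G h -> G (g \o h)
    & forall g, G g -> exists h, [/\ G h, cancel g h & cancel h g] ].

Definition properly_discontinuous (R : realType) (G : set (H3 R -> H3 R)) :
    Prop :=
  forall K : set (H3 R), compact K ->
    finite_set [set g | G g /\ (g @` K) `&` K !=set0].

(* [vol (H^3 / G) < oo], computed on a measurable fundamental domain. *)
Definition finite_covolume (R : realType) (G : set (H3 R -> H3 R)) : Prop :=
  exists F : set (H3 R),
    [/\ measurable (@hcoord R @` F),
        \bigcup_(g in G) (g @` F) = setT,
        forall g, G g -> g <> id -> hvol ((g @` F) `&` F) = 0%E
      & (hvol F < +oo)%E].

Definition orbits (R : realType) (G : set (H3 R -> H3 R))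
    (S : set (set (H3 R))) : set (set (set (H3 R))) :=
  [set [set g @` P | g in G] | P in S].

Definition mixed_platonic (R : realType) (G : set (H3 R -> H3 R)) : Prop :=
  [/\ isometry_group G, properly_discontinuous G, finite_covolume G
    & exists T n1 n2,
      [/\ platonic_tiling T, invariant_under G T, (1 <= n1)%N /\ (1 <= n2)%N,
          (orbits G (T `&` @regular_ideal_tetrahedron R) #= `I_n1)%card
        & (orbits G (T `&` @regular_ideal_octahedron R) #= `I_n2)%card] ].

Definition adapted_packing (R : realType) (G : set (H3 R -> H3 R))
    (T K : set (set (H3 R))) : Prop :=
  [/\ packing K, invariant_under G K, centers K = tiling_vertices T
    & forall P p B, T P -> ideal_vertex P p -> K B -> horoball_at p B ->
        HP P B].

Definition tangency_geodesics (R : realType) (K : set (set (H3 R))) :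
    set (set (H3 R)) :=
  [set e | exists B B' p p',
     [/\ K B, K B', horoball_at p B & horoball_at p' B'] /\
     tangent B B' /\ e = geodesic p p'].

Definition tangency_triangles (R : realType) (K : set (set (H3 R))) :
    set (set (H3 R)) :=
  [set F | exists B B' B'' p p' p'',
     [/\ K B, K B' & K B''] /\
     [/\ horoball_at p B, horoball_at p' B' & horoball_at p'' B''] /\
     [/\ tangent B B', tangent B' B'' & tangent B B''] /\
     F = convex_hull (geodesic p p' `|` geodesic p' p'' `|` geodesic p p'')].

Definition tiling_of_packing (R : realType) (K T : set (set (H3 R))) : Prop :=
  [/\ tiling T, tiling_edges T = tangency_geodesics K
    & tiling_facets T = tangency_triangles K].

(* Main.v *)
(* In the Minkowski model an ideal point is a light ray, a horoball is a light
   vector [n] (the points [x] with [lf x n <= 1]), and two horoballs have disjoint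
   interiors iff [lf n m >= 1], and are tangent iff [lf n m = 1].  The ideal hull
   of finitely many points is a cone.  The symmetries of a regular tile make a
   suitable rescaling of its vertex vectors satisfy [lf (n i) (n j) = 1] along
   edges and 2 across the diagonals of an octahedron; the product of the
   [lf (n i) (n j)] over [j] determines the scale, so that [H_P] is canonical
   and isometries carry it along.

   Two tiles sharing a triangle assign it the same three pairwise tangent
   horoballs; walking round edges, and then along segments inside a horoball,
   shows that tiles with a common ideal vertex agree there, so the union of the
   [H_P] is a packing.  The centre vector [c] of a tile has [lf c n >= 1] for all
   horoballs of the packing; this Delaunay property puts every triple of pairwise
   tangent horoballs in one tile.  A tiling is determined by its facets, since
   their union is the complement of the interiors of the tiles. *)

Require Import Defs.
From HB Require Import structures.
From mathcomp Require Import all_boot all_order all_algebra.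
From mathcomp Require Import all_classical all_reals all_analysis.
From mathcomp Require Import ring lra.
Set Implicit Arguments.
Unset Strict Implicit.
Unset Printing Implicit Defensive.
Import Order.TTheory GRing.Theory Num.Theory.
Import numFieldNormedType.Exports.
Local Open Scope classical_set_scope.
Local Open Scope ring_scope.

(** * The Minkowski model *)

(* (a, x, y, d) stands for the Hermitian matrix [[a, x + iy], [x - iy, d]]; its
   determinant is the quadratic form, and [lf] is twice the polar form. *)
Notation vec R := (R * R * R * R)%type.

(** The definitions speak of distances, hulls and symmetry groups, and linear algebra replaces all
    three. A set of points is studied through the cone of timelike vectors over it: convexity is
    closure under addition, and a face is a subcone closed under taking summands. Two obstacles
    shape the argument. The six vertex vectors of an octahedron lie in a space of dimension four, so
    the weights of a point are not unique, and faces are tracked by the vertices used in any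
    expression of any of their points. And tangency along one edge fixes only the product of the
    scales at its two ends, whereas the three edges of a triangle fix all three scales; hence
    agreement is passed on across triangles only, and two tiles that share a mere edge are joined by
    a chain of tiles around it. Regularity enters twice: flag symmetries yield the relations between
    pairings that make a common normalisation of all edges possible, and vertex symmetries make the
    maximal symmetric packing of a tile unique. *)

HB.lock Definition lf (R : realType) (u v : vec R) : R :=
  u.1.1.1 * v.2 + u.2 * v.1.1.1 - 2 * u.1.1.2 * v.1.1.2 - 2 * u.1.2 * v.1.2.

Section Lorentz.
Context (R : realType).
Implicit Types (u v w : vec R) (x y : H3 R) (p q : ideal R).

Lemma lfC u v : lf u v = lf v u.
Proof. rewrite !lf.unlock; ring. Qed.

Lemma lfDl u v w : lf (u + v) w = lf u w + lf v w.
Proof. rewrite !lf.unlock /=; ring. Qed.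

Lemma lfZl (k : R) u v : lf (k *: u) v = k * lf u v.
Proof. rewrite !lf.unlock /= /GRing.scale /=; ring. Qed.

Lemma lfNl u v : lf (- u) v = - lf u v.
Proof. by rewrite -scaleN1r lfZl mulN1r. Qed.

Lemma lfBl u v w : lf (u - v) w = lf u w - lf v w.
Proof. by rewrite lfDl lfNl. Qed.

Lemma lf0l u : lf 0 u = 0.
Proof. by rewrite -(scale0r 0) lfZl mul0r. Qed.

Lemma lf_suml (I : Type) (r : seq I) (P : pred I) (F : I -> vec R) u :
  lf (\sum_(i <- r | P i) F i) u = \sum_(i <- r | P i) lf (F i) u.
Proof.
exact: (big_morph (fun v => lf v u) (fun a b => lfDl a b u) (lf0l u)).
Qed.

Lemma lfDr u v w : lf w (u + v) = lf w u + lf w v.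
Proof. by rewrite lfC lfDl !(lfC w). Qed.

Lemma lfZr (k : R) u v : lf v (k *: u) = k * lf v u.
Proof. by rewrite lfC lfZl lfC. Qed.

Lemma lfNr u v : lf v (- u) = - lf v u.
Proof. by rewrite lfC lfNl lfC. Qed.

Lemma lfBr u v w : lf w (u - v) = lf w u - lf w v.
Proof. by rewrite lfC lfBl !(lfC w). Qed.

Lemma lf0r u : lf u 0 = 0.
Proof. by rewrite lfC lf0l. Qed.

Lemma lf_sumr (I : Type) (r : seq I) (P : pred I) (F : I -> vec R) u :
  lf u (\sum_(i <- r | P i) F i) = \sum_(i <- r | P i) lf u (F i).
Proof. by rewrite lfC lf_suml; apply: eq_bigr => i _; rewrite lfC. Qed.

Lemma scale_vec (k a b c d : R) :
  k *: ((a, b, c, d) : vec R) = (k * a, k * b, k * c, k * d).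
Proof. by []. Qed.

Definition lfE := (lfDl, lfDr, lfBl, lfBr, lfZl, lfZr, lfNl, lfNr, lf0l, lf0r).

Lemma lf_nondegenerate u : (forall v, lf u v = 0) -> u = 0.
Proof.
case: u => [[[a x] y] d] h.
move: (h (1, 0, 0, 0)) (h (0, 1, 0, 0)) (h (0, 0, 1, 0)) (h (0, 0, 0, 1)).
rewrite !lf.unlock /= => h1 h2 h3 h4.
have -> : a = 0 by lra.
have -> : x = 0 by lra.
have -> : y = 0 by lra.
by have -> : d = 0 by lra.
Qed.

Definition timelike u := 0 < u.2 /\ 0 < lf u u.

(** Positive semidefinite matrices, 0 included. The sign of the first entry is demanded because,
    once the last entry is 0, the form only kills the off-diagonal entries and leaves the first one
    free. *)
Definition causal u := [/\ 0 <= u.2, 0 <= u.1.1.1 & 0 <= lf u u].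

Lemma timelikeI u : 0 <= u.2 -> 0 < lf u u -> timelike u.
Proof.
case: u => [[[a x] y] d]; rewrite /timelike ?lf.unlock /= => d0 q; split=> //.
rewrite lt_neqAle d0 andbT; apply/eqP => d00; subst d.
have := sqr_ge0 x; have := sqr_ge0 y; rewrite !expr2; lra.
Qed.

Lemma timelike_causal u : timelike u -> causal u.
Proof.
case: u => [[[a x] y] d]; rewrite /timelike /causal ?lf.unlock /= => -[d0 q].
split; try lra.
have h : 0 < a * d by have := sqr_ge0 x; have := sqr_ge0 y; rewrite !expr2; lra.
by rewrite ltW // -(pmulr_lgt0 _ d0).
Qed.

(** Multiplied by [d * e], the pairing is a sum of two squares and of nonnegative multiples of the
    two determinants. If [d] or [e] is 0, the determinant condition kills the off-diagonal entries
    and a product of diagonal entries remains. *)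
Lemma lf_causal u v : causal u -> causal v -> 0 <= lf u v.
Proof.
case: u => [[[a x] y] d]; case: v => [[[b z] w] e]; rewrite /causal ?lf.unlock /=.
move=> [d0 a0 qu] [e0 b0 qv].
have hx : x * x + y * y <= a * d by lra.
have hz : z * z + w * w <= b * e by lra.
have [d1|d1] := ltrP 0 d; last first.
  have d2 : d = 0 by lra. subst d.
  have x0 : x = 0.
    apply/eqP; rewrite -sqrf_eq0 expr2; have := sqr_ge0 x; have := sqr_ge0 y.
    by rewrite !expr2 eq_le => ? ?; apply/andP; split; lra.
  have y0 : y = 0.
    apply/eqP; rewrite -sqrf_eq0 expr2; have := sqr_ge0 x; have := sqr_ge0 y.
    by rewrite !expr2 eq_le => ? ?; apply/andP; split; lra.
  subst x y; have := mulr_ge0 a0 e0; lra.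
have [e1|e1] := ltrP 0 e; last first.
  have e2 : e = 0 by lra. subst e.
  have x0 : z = 0.
    apply/eqP; rewrite -sqrf_eq0 expr2; have := sqr_ge0 z; have := sqr_ge0 w.
    by rewrite !expr2 eq_le => ? ?; apply/andP; split; lra.
  have y0 : w = 0.
    apply/eqP; rewrite -sqrf_eq0 expr2; have := sqr_ge0 z; have := sqr_ge0 w.
    by rewrite !expr2 eq_le => ? ?; apply/andP; split; lra.
  subst z w; have := mulr_ge0 d0 b0; lra.
have de := mulr_gt0 d1 e1.
rewrite -(pmulr_rge0 _ de).
have -> : d * e * (a * e + d * b - 2 * x * z - 2 * y * w) =
  (e * x - d * z) ^+ 2 + (e * y - d * w) ^+ 2 +
  e ^+ 2 * (a * d - (x * x + y * y)) + d ^+ 2 * (b * e - (z * z + w * w)) by ring.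
have h1 := sqr_ge0 (e * x - d * z); have h2 := sqr_ge0 (e * y - d * w).
have h3 : 0 <= e ^+ 2 * (a * d - (x * x + y * y)).
  by rewrite mulr_ge0 ?sqr_ge0 // subr_ge0.
have h4 : 0 <= d ^+ 2 * (b * e - (z * z + w * w)).
  by rewrite mulr_ge0 ?sqr_ge0 // subr_ge0.
lra.
Qed.

Lemma lf_timelike_causal u v : timelike u -> causal v -> v <> 0 -> 0 < lf u v.
Proof.
case: u => [[[a x] y] d]; case: v => [[[b z] w] e]; rewrite /timelike /causal ?lf.unlock /=.
move=> [d1 qu] [e0 b0 qv] v0.
have hx : 0 < a * d - (x * x + y * y) by lra.
have hz : 0 <= b * e - (z * z + w * w) by lra.
have [e1|e1] := ltrP 0 e; last first.
  have e2 : e = 0 by lra. subst e.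
  have x0 : z = 0.
    apply/eqP; rewrite -sqrf_eq0 expr2; have := sqr_ge0 z; have := sqr_ge0 w.
    by rewrite !expr2 eq_le => ? ?; apply/andP; split; lra.
  have y0 : w = 0.
    apply/eqP; rewrite -sqrf_eq0 expr2; have := sqr_ge0 z; have := sqr_ge0 w.
    by rewrite !expr2 eq_le => ? ?; apply/andP; split; lra.
  subst z w.
  have b1 : 0 < b.
    by rewrite lt_neqAle b0 andbT; apply/eqP => b00; apply: v0; rewrite -b00.
  have := mulr_gt0 d1 b1; lra.
have de := mulr_gt0 d1 e1.
rewrite -(pmulr_rgt0 _ de).
have -> : d * e * (a * e + d * b - 2 * x * z - 2 * y * w) =
  (e * x - d * z) ^+ 2 + (e * y - d * w) ^+ 2 +
  e ^+ 2 * (a * d - (x * x + y * y)) + d ^+ 2 * (b * e - (z * z + w * w)) by ring.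
have h1 := sqr_ge0 (e * x - d * z); have h2 := sqr_ge0 (e * y - d * w).
have h3 : 0 < e ^+ 2 * (a * d - (x * x + y * y)).
  by rewrite mulr_gt0 // exprn_gt0.
have h4 : 0 <= d ^+ 2 * (b * e - (z * z + w * w)).
  by rewrite mulr_ge0 ?sqr_ge0.
lra.
Qed.

Lemma timelike_neq0 u : timelike u -> u <> 0.
Proof. by move=> [h _] u0; move: h; rewrite u0 ltxx. Qed.

Lemma lf_timelike u v : timelike u -> timelike v -> 0 < lf u v.
Proof.
by move=> hu hv; apply: lf_timelike_causal => //;
  [exact: timelike_causal|exact: timelike_neq0].
Qed.

Lemma causalD u v : causal u -> causal v -> causal (u + v).
Proof.
move=> hu hv; have := lf_causal hu hv.
case: hu hv => [u1 u2 u3] [v1 v2 v3] h; split=> /=; rewrite ?addr_ge0 //.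
rewrite !lfE (lfC v u); lra.
Qed.

Lemma causalZ (k : R) u : 0 <= k -> causal u -> causal (k *: u).
Proof.
move=> k0 [u1 u2 u3]; split; [exact: mulr_ge0|exact: mulr_ge0|].
by rewrite !lfE !mulr_ge0.
Qed.

Lemma causal0 : causal 0.
Proof. by split=> //; rewrite lf0l. Qed.

Lemma causal_sum (I : Type) (r : seq I) (P : pred I) (F : I -> vec R) :
  (forall i, P i -> causal (F i)) -> causal (\sum_(i <- r | P i) F i).
Proof.
by move=> h; elim/big_ind: _ => //; [exact: causal0 | exact: causalD].
Qed.

Lemma causal_timelike u : causal u -> 0 < lf u u -> timelike u.
Proof. by move=> [h _ _]; exact: timelikeI. Qed.

Lemma timelikeDcausal u v : timelike u -> causal v -> timelike (u + v).
Proof.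
move=> hu hv; have := lf_causal (timelike_causal hu) hv.
move: (hu) (hv) => [u1 u2] [v1 v2 v3] h; split=> /=; first by rewrite ltr_wpDr.
rewrite !lfE (lfC v u); lra.
Qed.

Lemma timelikeD u v : timelike u -> timelike v -> timelike (u + v).
Proof. by move=> hu hv; apply: timelikeDcausal => //; exact: timelike_causal. Qed.

Lemma timelikeZ (k : R) u : 0 < k -> timelike u -> timelike (k *: u).
Proof.
by move=> k0 [u1 u2]; split; [exact: mulr_gt0|rewrite !lfE !mulr_gt0].
Qed.

(** The signature is (1, 3): after multiplication by [d ^+ 2], orthogonality to [u] turns the form
    into minus twice a sum of squares and of [e ^+ 2] times the determinant of [u]. *)
Lemma timelike_orth u w : timelike u -> lf w u = 0 -> lf w w <= 0.
Proof.
case: u => [[[a x] y] d]; case: w => [[[b z] v] e]; rewrite /timelike ?lf.unlock /=.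
move=> [d1 qu] h.
have d2 : 0 < d ^+ 2 by rewrite exprn_gt0.
have hx : 0 < a * d - (x * x + y * y) by lra.
rewrite -(pmulr_rle0 _ d2).
have -> : d ^+ 2 * (b * e + e * b - 2 * z * z - 2 * v * v) =
 2 * d * e * (b * d + e * a - 2 * z * x - 2 * v * y)
 - 2 * ((d * z - e * x) ^+ 2 + (d * v - e * y) ^+ 2
   + e ^+ 2 * (a * d - (x * x + y * y))) by ring.
rewrite h mulr0.
have h1 := sqr_ge0 (d * z - e * x); have h2 := sqr_ge0 (d * v - e * y).
have h3 : 0 <= e ^+ 2 * (a * d - (x * x + y * y)).
  by rewrite mulr_ge0 ?sqr_ge0 // ltW.
lra.
Qed.

(** The standard way to identify two vectors below: their difference is null and orthogonal to a
    timelike vector. *)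
Lemma timelike_orth_eq0 u w :
  timelike u -> lf w u = 0 -> lf w w = 0 -> w = 0.
Proof.
case: u => [[[a x] y] d]; case: w => [[[b z] v] e]; rewrite /timelike ?lf.unlock /=.
move=> [d1 qu] h h'.
have hx : 0 < a * d - (x * x + y * y) by lra.
have E : d ^+ 2 * (b * e + e * b - 2 * z * z - 2 * v * v) =
 2 * d * e * (b * d + e * a - 2 * z * x - 2 * v * y)
 - 2 * ((d * z - e * x) ^+ 2 + (d * v - e * y) ^+ 2
   + e ^+ 2 * (a * d - (x * x + y * y))) by ring.
rewrite h h' !mulr0 in E.
have h1 := sqr_ge0 (d * z - e * x); have h2 := sqr_ge0 (d * v - e * y).
have h3 : 0 <= e ^+ 2 * (a * d - (x * x + y * y)).
  by rewrite mulr_ge0 ?sqr_ge0 // ltW.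
have e0 : e = 0.
  have : e ^+ 2 * (a * d - (x * x + y * y)) = 0 by lra.
  by move/eqP; rewrite mulf_eq0 (gt_eqF hx) orbF sqrf_eq0 => /eqP.
subst e; rewrite !mul0r !subr0 in h1 h2 h3 E.
have z0 : z = 0.
  have : (d * z) ^+ 2 = 0 by lra.
  by move/eqP; rewrite sqrf_eq0 mulf_eq0 (gt_eqF d1) => /eqP.
have v0 : v = 0.
  have : (d * v) ^+ 2 = 0 by lra.
  by move/eqP; rewrite sqrf_eq0 mulf_eq0 (gt_eqF d1) => /eqP.
subst z v.
have : b * d = 0 by lra.
by move/eqP; rewrite mulf_eq0 (gt_eqF d1) orbF => /eqP ->.
Qed.

Lemma reverse_cs u w : timelike u -> lf u u * lf w w <= lf w u ^+ 2.
Proof.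
move=> hu; have [_ u0] := hu.
(* This is [lf u u] times the component of [w] orthogonal to [u]. *)
have h : lf (lf u u *: w - lf w u *: u) u = 0 by rewrite !lfE; ring.
have := timelike_orth hu h.
have -> : lf (lf u u *: w - lf w u *: u) (lf u u *: w - lf w u *: u) =
 lf u u * (lf u u * lf w w - lf w u ^+ 2) by rewrite !lfE (lfC u w); ring.
by rewrite pmulr_rle0 // subr_le0.
Qed.

(** The rank one matrix of the ideal point. With this choice [lf (nv p) (nv q)] is the squared
    Euclidean distance of two finite points, and 1 between a finite point and infinity. *)
Definition nv p : vec R :=
  match p with
  | None => (1, 0, 0, 0)
  | Some (Complex a b) => (a ^+ 2 + b ^+ 2, a, b, 1)
  end.

Lemma lf_nvv p : lf (nv p) (nv p) = 0.
Proof. case: p => [[a b]|]; rewrite !lf.unlock /=; ring. Qed.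

Lemma nv_causal p : causal (nv p).
Proof.
by split; rewrite ?lf_nvv //; case: p => [[a b]|] //=;
  rewrite addr_ge0 ?sqr_ge0.
Qed.

Lemma nv_neq0 p : nv p <> 0.
Proof. by case: p => [[a b]|] [] *; lra. Qed.

Lemma lf_nv_gt0 p q : p <> q -> 0 < lf (nv p) (nv q).
Proof.
case: p => [[a b]|]; case: q => [[c d]|] h //=; rewrite !lf.unlock /=; try lra.
have -> : (a ^+ 2 + b ^+ 2) * 1 + 1 * (c ^+ 2 + d ^+ 2) - 2 * a * c - 2 * b * d
  = (a - c) ^+ 2 + (b - d) ^+ 2 by ring.
rewrite lt_neqAle addr_ge0 ?sqr_ge0 // andbT eq_sym paddr_eq0 ?sqr_ge0 //.
by rewrite !sqrf_eq0 !subr_eq0; apply/negP => /andP[/eqP ac /eqP bd]; apply: h; rewrite ac bd.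
Qed.

Lemma lf_timelike_nv u p : timelike u -> 0 < lf u (nv p).
Proof. by move=> h; apply: lf_timelike_causal => //; [exact: nv_causal|exact: nv_neq0]. Qed.

Lemma null_nv u : u <> 0 -> causal u -> lf u u = 0 -> exists2 s, 0 < s & exists p, u = s *: nv p.
Proof.
case: u => [[[a x] y] d] u0 [/= d0 a0 _]; rewrite !lf.unlock /= => q.
have [d1|d1] := ltrP 0 d.
  exists d => //; exists (Some (Complex (x / d) (y / d))) => /=.
  have dn : d != 0 by rewrite gt_eqF.
  rewrite scale_vec; congr (_, _, _, _); [|by field..].
  have -> : d * ((x / d) ^+ 2 + (y / d) ^+ 2) = (x * x + y * y) / d by field.
  by apply/(mulIf dn); rewrite divfK //; lra.
have d2 : d = 0 by lra. subst d.
have x0 : x = 0.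
  apply/eqP; rewrite -sqrf_eq0 expr2; have := sqr_ge0 x; have := sqr_ge0 y.
  by rewrite !expr2 eq_le => ? ?; apply/andP; split; lra.
have y0 : y = 0.
  apply/eqP; rewrite -sqrf_eq0 expr2; have := sqr_ge0 x; have := sqr_ge0 y.
  by rewrite !expr2 eq_le => ? ?; apply/andP; split; lra.
subst x y; exists a.
  by rewrite lt_neqAle a0 andbT; apply/eqP => a00; apply: u0; rewrite -a00.
by exists None; rewrite scale_vec mulr1 mulr0.
Qed.

(** The Hermitian matrix of determinant 1 attached to a point of the upper half-space;
    [lf (X x) (X x)] is 2 since [lf] is twice the polar form. *)
Definition X x : vec R :=
  let: (a, b, t) := hcoord x in ((a ^+ 2 + b ^+ 2 + t ^+ 2) / t, a / t, b / t, t^-1).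

Lemma ht_gt0 x : 0 < ht x.
Proof. by case: x. Qed.

Lemma lf_XX x : lf (X x) (X x) = 2.
Proof.
case: x => [[[a b] t] /= t0]; rewrite !lf.unlock /X /=; field.
by rewrite gt_eqF.
Qed.

Lemma X_timelike x : timelike (X x).
Proof.
split; last by rewrite lf_XX.
by case: x => [[[a b] t] /= t0]; rewrite /X /= invr_gt0.
Qed.

Lemma lf_X_gt0 x y : 0 < lf (X x) (X y).
Proof. by apply: lf_timelike; exact: X_timelike. Qed.

Lemma lf_X_ge2 x y : 2 <= lf (X x) (X y).
Proof.
have := @reverse_cs (X y) (X x) (X_timelike y); rewrite !lf_XX.
have := lf_X_gt0 x y; nra.
Qed.

Definition H3_origin : H3 R := @MkH3 R (0, 0, 1) ltr01.

(* Junk value off the timelike cone. *)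
Definition hproj u : H3 R :=
  insubd H3_origin (u.1.1.2 / u.2, u.1.2 / u.2, Num.sqrt (lf u u / 2) / u.2).

Lemma hcoord_proj u : timelike u ->
  hcoord (hproj u) = (u.1.1.2 / u.2, u.1.2 / u.2, Num.sqrt (lf u u / 2) / u.2).
Proof.
move=> [h1 h2]; rewrite [LHS](insubdK H3_origin) //.
by rewrite unfold_in /= divr_gt0 // sqrtr_gt0 divr_gt0.
Qed.

Lemma X_proj u : timelike u -> X (hproj u) = (Num.sqrt (lf u u / 2))^-1 *: u.
Proof.
move=> hu; rewrite /X hcoord_proj //; case: (hu) => d0 q0.
have r0 : 0 < Num.sqrt (lf u u / 2) by rewrite sqrtr_gt0 divr_gt0.
have r2 : Num.sqrt (lf u u / 2) ^+ 2 = lf u u / 2 by rewrite sqr_sqrtr // ltW // divr_gt0.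
move: r0 r2; move: (Num.sqrt (lf u u / 2)) => r r0.
case: u hu d0 q0 => [[[a x] y] d] /= _ d0 _; rewrite !lf.unlock /= => r2.
have dn : d != 0 by rewrite gt_eqF.
have rn : r != 0 by rewrite gt_eqF.
rewrite scale_vec.
have -> : ((x / d) ^+ 2 + (y / d) ^+ 2 + (r / d) ^+ 2) / (r / d) = r^-1 * a.
  have -> : (r / d) ^+ 2 = r ^+ 2 / d ^+ 2 by rewrite expr_div_n.
  by rewrite r2; field; rewrite dn rn.
have -> : x / d / (r / d) = r^-1 * x by field; rewrite dn rn.
have -> : y / d / (r / d) = r^-1 * y by field; rewrite dn rn.
by have -> : (r / d)^-1 = r^-1 * d by field; rewrite dn rn.
Qed.

Lemma proj_X x : hproj (X x) = x.
Proof.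
apply/val_inj => /=; rewrite hcoord_proj; last exact: X_timelike.
rewrite lf_XX divff // sqrtr1 /X; case: x => [[[a b] t] /= t0].
have tn : t != 0 by rewrite gt_eqF.
congr (_, _, _); by field; rewrite tn.
Qed.

Lemma X_inj : injective X.
Proof. by move=> x y h; rewrite -(proj_X x) h proj_X. Qed.

Lemma projZ (k : R) u : 0 < k -> timelike u -> hproj (k *: u) = hproj u.
Proof.
move=> k0 hu; apply: X_inj; rewrite !X_proj //; last exact: timelikeZ.
rewrite scalerA; congr (_ *: _); rewrite !lfE.
have -> : k * (k * lf u u) / 2 = k ^+ 2 * (lf u u / 2) by ring.
rewrite sqrtrM ?sqr_ge0 // sqrtr_sqr gtr0_norm //; field.
by rewrite sqrtr_eq0 -ltNge divr_gt0 ?(gt_eqF k0) //; case: hu.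
Qed.

Lemma timelike_proj u : timelike u -> exists2 c, 0 < c & u = c *: X (hproj u).
Proof.
move=> hu; have r0 : 0 < Num.sqrt (lf u u / 2) by rewrite sqrtr_gt0 divr_gt0 //; case: hu.
exists (Num.sqrt (lf u u / 2)) => //.
by rewrite X_proj // scalerA divff ?gt_eqF // scale1r.
Qed.

End Lorentz.

(** * Distance and betweenness in vector terms *)

Section Dictionary.
Context (R : realType).
Implicit Types (u v w : vec R) (x y z : H3 R) (p q : ideal R) (A : set (H3 R)).

Lemma cabs_sqr (a b : R) : cabs (Complex a b) ^+ 2 = a ^+ 2 + b ^+ 2.
Proof. by rewrite /cabs /Normc.normc sqr_sqrtr // addr_ge0 ?sqr_ge0. Qed.

Lemma hdist_lf x y : hdist x y = arcosh (lf (X x) (X y) / 2).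
Proof.
rewrite /hdist; congr arcosh.
case: x => [[[a b] t] /= t0]; case: y => [[[c d] s] /= s0].
rewrite /hz /ht /= cabs_sqr lf.unlock /X /=; field.
by rewrite !gt_eqF.
Qed.

(** The exponential of [arcosh]. It turns the additive condition [between] into a product without
    logarithms. *)
Definition exparcosh (r : R) := r + Num.sqrt (r ^+ 2 - 1).

Lemma exparcosh_inv (r : R) : 1 <= r ->
  [/\ 0 < exparcosh r, exparcosh r * (r - Num.sqrt (r ^+ 2 - 1)) = 1,
      0 <= Num.sqrt (r ^+ 2 - 1) & Num.sqrt (r ^+ 2 - 1) ^+ 2 = r ^+ 2 - 1].
Proof.
move=> r1; have r2 : 0 <= r ^+ 2 - 1 by nra.
have h := sqrtr_ge0 (r ^+ 2 - 1); split=> //.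
- rewrite /exparcosh; lra.
- have h2 := sqr_sqrtr r2.
  have -> : exparcosh r * (r - Num.sqrt (r ^+ 2 - 1)) = r ^+ 2 - Num.sqrt (r ^+ 2 - 1) ^+ 2.
    rewrite /exparcosh; ring.
  rewrite h2; ring.
- exact: sqr_sqrtr.
Qed.

Lemma exparcosh_inj (r s : R) : 1 <= r -> 1 <= s -> exparcosh r = exparcosh s -> r = s.
Proof.
move=> r1 s1 e.
have [r0 ri _ _] := exparcosh_inv r1; have [s0 si _ _] := exparcosh_inv s1.
have : r - Num.sqrt (r ^+ 2 - 1) = s - Num.sqrt (s ^+ 2 - 1).
  by apply: (mulfI (lt0r_neq0 r0)); rewrite ri e si.
move: e; rewrite /exparcosh; lra.
Qed.

Lemma arcosh_inj (r s : R) : 1 <= r -> 1 <= s -> arcosh r = arcosh s -> r = s.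
Proof.
move=> r1 s1 e; apply: exparcosh_inj => //.
have [r0 _ _ _] := exparcosh_inv r1; have [s0 _ _ _] := exparcosh_inv s1.
by apply: ln_inj => //; rewrite posrE.
Qed.

Lemma lfX2 x y : 1 <= lf (X x) (X y) / 2.
Proof. by have := lf_X_ge2 x y; rewrite ler_pdivlMr // mul1r. Qed.

Lemma hdist_eq x y x' y' :
  hdist x y = hdist x' y' <-> lf (X x) (X y) = lf (X x') (X y').
Proof.
rewrite !hdist_lf; split=> [|-> //].
by move=> /(arcosh_inj (lfX2 _ _) (lfX2 _ _)); lra.
Qed.

Lemma between_exp x z y : between x z y <->
  exparcosh (lf (X x) (X z) / 2) * exparcosh (lf (X z) (X y) / 2) =
  exparcosh (lf (X x) (X y) / 2).
Proof.
rewrite /between !hdist_lf /arcosh -!/(exparcosh _).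
have [a0 _ _ _] := exparcosh_inv (lfX2 x z).
have [b0 _ _ _] := exparcosh_inv (lfX2 z y).
have [c0 _ _ _] := exparcosh_inv (lfX2 x y).
rewrite -lnM ?posrE //; split=> [|-> //].
by apply: ln_inj; rewrite posrE ?mulr_gt0.
Qed.

(** With [A], [B], [C] the hyperbolic cosines of the three distances and [a], [b], [c] their
    hyperbolic sines, betweenness is the addition theorem, and that is linear dependence with
    nonnegative weights. *)
Lemma betweenP x z y : between x z y <->
  exists a b, [/\ 0 <= a, 0 <= b & X z = a *: X x + b *: X y].
Proof.
rewrite between_exp.
have [a0 ai a1 a2] := exparcosh_inv (lfX2 x z).
have [b0 bi b1 b2] := exparcosh_inv (lfX2 z y).
have [c0 ci c1 c2] := exparcosh_inv (lfX2 x y).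
have hA := lfX2 x z; have hB := lfX2 z y; have hC := lfX2 x y.
have eA : lf (X x) (X z) = 2 * (lf (X x) (X z) / 2) by lra.
have eB : lf (X z) (X y) = 2 * (lf (X z) (X y) / 2) by lra.
have eC : lf (X x) (X y) = 2 * (lf (X x) (X y) / 2) by lra.
move: hA hB hC eA eB eC a0 ai a1 a2 b0 bi b1 b2 c0 ci c1 c2; rewrite /exparcosh.
move: (lf (X x) (X z) / 2) (lf (X z) (X y) / 2) (lf (X x) (X y) / 2) => A B C.
move: (Num.sqrt (A ^+ 2 - 1)) (Num.sqrt (B ^+ 2 - 1)) (Num.sqrt (C ^+ 2 - 1)).
move=> a b c hA hB hC eA eB eC a0 ai a1 a2 b0 bi b1 b2 c0 ci c1 c2.
split=> [h|[k [l [k0 l0 e]]]].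
  (* The reciprocal equation; half the sum and half the difference of the two are the addition
     formulas [hc1] and [hc2]. *)
  have h' : (A - a) * (B - b) = C - c.
    have cn : C + c != 0 by rewrite gt_eqF.
    apply: (mulfI cn); rewrite ci -h.
    have -> : (A + a) * (B + b) * ((A - a) * (B - b)) =
      ((A + a) * (A - a)) * ((B + b) * (B - b)) by ring.
    by rewrite ai bi mulr1.
  have hc1 : C = A * B + a * b by lra.
  have hc2 : c = A * b + a * B by lra.
  (* If [c = 0] then also [a = 0], so [z = x] and the weights are 1 and 0. *)
  have [c3|c3] := ltrP 0 c; last first.
    have cz : c = 0 by lra. 
    have az : a = 0 by nra.
    have A1 : A = 1 by nra.
    exists 1, 0; split=> //; rewrite scale0r addr0 scale1r.
    apply/subr0_eq; apply: (@timelike_orth_eq0 _ (X x)); first exact: X_timelike.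
      by rewrite lfBl lf_XX lfC eA A1; lra.
    by rewrite !lfE !lf_XX (lfC (X z)) eA A1; lra.
  have cn : c != 0 by rewrite gt_eqF.
  (* Each weight is the hyperbolic sine of the distance from [z] to the opposite end, divided by
     that of the whole distance. *)
  exists (b / c), (a / c); split; [exact: divr_ge0|exact: divr_ge0|].
  have e1 : lf (X z) (X x) = 2 * A by rewrite lfC.
  have e2 : lf (X y) (X x) = 2 * C by rewrite lfC.
  have e3 : lf (X y) (X z) = 2 * B by rewrite lfC.
  apply/subr0_eq; apply: (@timelike_orth_eq0 _ (X x)); first exact: X_timelike.
    rewrite !lfE !lf_XX e1 e2; apply: (mulfI cn).
    have -> : c * (2 * A - (b / c * 2 + a / c * (2 * C))) = 2 * (A * c - (b + a * C)) by field.
    by rewrite hc1 hc2 mulr0; move: a2 b2; nra.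
  have -> : X z - (b / c *: X x + a / c *: X y) = c^-1 *: (c *: X z - (b *: X x + a *: X y)).
    by rewrite scalerBr scalerDr !scalerA mulVf // scale1r ![_ / c]mulrC.
  have -> : lf (c^-1 *: (c *: X z - (b *: X x + a *: X y)))
     (c^-1 *: (c *: X z - (b *: X x + a *: X y))) =
     c^-1 * (c^-1 * (2 * (c ^+ 2 + a ^+ 2 + b ^+ 2 - 2 * b * c * A - 2 * a * c * B
       + 2 * a * b * C))).
    rewrite !lfE !lf_XX e1 e2 e3 eA eB eC; ring.
  have -> : c ^+ 2 + a ^+ 2 + b ^+ 2 - 2 * b * c * A - 2 * a * c * B + 2 * a * b * C =
     b ^+ 2 * (1 + a ^+ 2 - A ^+ 2) + a ^+ 2 * (1 + b ^+ 2 - B ^+ 2).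
    rewrite hc1 hc2; ring.
  rewrite a2 b2; ring.
have e1 : 1 = k ^+ 2 + l ^+ 2 + 2 * k * l * C.
  have := lf_XX z; rewrite e !lfE !lf_XX (lfC (X y)) eC => ?; lra.
have e2 : A = k + l * C.
  have := eA; rewrite e !lfE !lf_XX eC => ?; lra.
have e3 : B = k * C + l.
  have := eB; rewrite e !lfE !lf_XX eC => ?; lra.
have ea : a = l * c.
  apply/eqP; rewrite -(@eqrXn2 _ 2) // ?mulr_ge0 //; apply/eqP.
  by rewrite a2 exprMn c2 e2; lra.
have eb : b = k * c.
  apply/eqP; rewrite -(@eqrXn2 _ 2) // ?mulr_ge0 //; apply/eqP.
  by rewrite b2 exprMn c2 e3; lra.
have -> : (A + a) * (B + b) = (k ^+ 2 + l ^+ 2 + 2 * k * l * C) * C + (k ^+ 2 + l ^+ 2 + 2 * k * l * C) * c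
   + k * l * (c ^+ 2 - (C ^+ 2 - 1)) by rewrite e2 e3 ea eb; ring.
by rewrite c2 subrr mulr0 addr0 -e1 !mul1r.
Qed.

End Dictionary.

(** * Convex hulls and horoballs *)

Section Hulls.
Context (R : realType).
Implicit Types (u v w : vec R) (x y z : H3 R) (p q : ideal R) (A : set (H3 R)).

(** The cone over [A] inside the timelike cone. It is stable under positive scaling, so that working
    with it removes all normalisations. *)
Definition hat A u := timelike u /\ A (hproj u).

Lemma hat_X A x : hat A (X x) <-> A x.
Proof. by rewrite /hat proj_X; split=> [[]|] // ?; split=> //; exact: X_timelike. Qed.

Lemma hatZ A (k : R) u : 0 < k -> hat A u -> hat A (k *: u).
Proof. by move=> k0 [h1 h2]; split; [exact: timelikeZ|rewrite projZ]. Qed.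

Lemma hatZE A (k : R) u : 0 < k -> hat A (k *: u) <-> hat A u.
Proof.
move=> k0; split; last exact: hatZ.
have k1 : 0 < k^-1 by rewrite invr_gt0.
by move/(hatZ k1); rewrite scalerA mulVf ?scale1r // gt_eqF.
Qed.

Lemma hconvexP A : hconvex A <-> forall u v, hat A u -> hat A v -> hat A (u + v).
Proof.
split=> [h u v [tu Au] [tv Av]|h x y z Ax Ay].
  have tuv := timelikeD tu tv; split=> //.
  apply: h Au Av _; apply/betweenP.
  have [a a0 ea] := timelike_proj tu; have [b b0 eb] := timelike_proj tv.
  have [c c0 ec] := timelike_proj tuv.
  exists (a / c), (b / c); rewrite !divr_ge0 ?ltW //; split=> //.
  have cn : c != 0 by rewrite gt_eqF.
  apply: (scalerI cn); rewrite -ec scalerDr !scalerA ![c * _]mulrC !divfK //.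
  by rewrite -ea -eb.
move=> /betweenP[a [b [a0 b0 e]]].
move: a0 b0; rewrite !le_eqVlt => /predU1P[a0|a0] /predU1P[b0|b0].
- have := X_timelike z; rewrite e -a0 -b0 !scale0r addr0 => /timelike_neq0 //.
- rewrite -a0 scale0r add0r in e.
  by apply/hat_X; rewrite e; apply/hatZ => //; apply/hat_X.
- rewrite -b0 scale0r addr0 in e.
  by apply/hat_X; rewrite e; apply/hatZ => //; apply/hat_X.
by apply/hat_X; rewrite e; apply: h; apply/hatZ => //; apply/hat_X.
Qed.

Lemma geodesicP p q x : p <> q -> geodesic p q x <->
  exists a b, [/\ 0 < a, 0 < b & X x = a *: nv p + b *: nv q].
Proof.
have vert (z : R[i]) : hz x = z <-> exists a b,
    [/\ 0 < a, 0 < b & X x = a *: nv None + b *: nv (Some z)].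
  case: x => [[[a b] t] /= t0]; case: z => [c d]; rewrite /hz /=.
  have tn : t != 0 by rewrite gt_eqF.
  split=> [[<- <-]|[k [l [k0 l0]]]].
    exists t, t^-1; rewrite invr_gt0; split=> //.
    rewrite /X /= !scale_vec; congr (_, _, _, _) => /=; rewrite ?mulr0 ?add0r ?mulr1 //.
    - by field.
    - by rewrite mulrC.
    - by rewrite mulrC.
  rewrite /X /= !scale_vec => -[_ /= h1 h2 h3].
  rewrite mulr0 add0r in h1; rewrite mulr0 add0r in h2; rewrite mulr0 add0r mulr1 in h3.
  by congr Complex; apply: (mulIf (invr_neq0 tn)); rewrite ?h1 ?h2 h3 mulrC.
case: p => [z|]; case: q => [w|] pq //=.
- rewrite /=; split.
    case: x {vert} => [[[a b] t] /= t0] [s [/andP[s0 s1]]].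
    rewrite /hz /ht /=; case: z pq => z1 z2; case: w => w1 w2 pq.
    rewrite cabs_sqr /= => /eqP; rewrite eq_complex /= => /andP[/eqP e1 /eqP e2] e3.
    have tn : t != 0 by rewrite gt_eqF.
    exists ((1 - s) / t), (s / t); rewrite !divr_gt0 ?subr_gt0 //; split=> //.
    rewrite /X /= !scale_vec; congr (_, _, _, _) => /=; last by field.
    + rewrite e3 e1 e2; field; exact: tn.
    + rewrite e1; field; exact: tn.
    + rewrite e2; field; exact: tn.
  case: x {vert} => [[[a b] t] /= t0] [k [l [k0 l0]]].
  rewrite /hz /ht /=; case: z pq => z1 z2; case: w => w1 w2 pq.
  have tn : t != 0 by rewrite gt_eqF.
  rewrite /X /= !scale_vec => -[/= h1 h2 h3 h4].
  rewrite !mulr1 in h4.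
  have kl : k + l != 0 by rewrite gt_eqF ?addr_gt0.
  have et : t = (k + l)^-1 by rewrite -h4 invrK.
  (* The last coordinate gives [t^-1 = k + l], so the vertical projection has parameter
     [l / (k + l)]. *)
  exists (l / (k + l)); split.
  + rewrite divr_gt0 ?addr_gt0 //= ltr_pdivrMr ?addr_gt0 // mul1r; lra.
  + apply/eqP; rewrite eq_complex /=; apply/andP; split; apply/eqP.
      have -> : a = (a / t) * t by field.
      rewrite h2 et; field; exact: kl.
    have -> : b = (b / t) * t by field.
    rewrite h3 et; field; exact: kl.
  rewrite cabs_sqr /=.
  have ea : a = (k * z1 + l * w1) / (k + l) by rewrite -h2 et invrK mulfK.
  have eb : b = (k * z2 + l * w2) / (k + l) by rewrite -h3 et invrK mulfK.
  have : a ^+ 2 + b ^+ 2 + t ^+ 2 = (k * (z1 ^+ 2 + z2 ^+ 2) + l * (w1 ^+ 2 + w2 ^+ 2)) / (k + l).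
    by rewrite -h1 et invrK mulfK.
  move=> h5.
  have -> : t ^+ 2 = (k * (z1 ^+ 2 + z2 ^+ 2) + l * (w1 ^+ 2 + w2 ^+ 2)) / (k + l) - a ^+ 2 - b ^+ 2.
    by rewrite -h5; ring.
  rewrite ea eb; field; exact: kl.
- rewrite vert; split=> -[a [b [a0 b0 ->]]]; exists b, a; split=> //; exact: addrC.
Qed.

Lemma geodesic_self p : geodesic p p = set0.
Proof.
case: p => [z|] //=; rewrite -subset0 => x /= [s [_ _ h]].
have := ht_gt0 x; move: h; rewrite subrr cabs_sqr expr0n /= addr0 mulr0 => /eqP.
by rewrite sqrf_eq0 => /eqP ->; rewrite ltxx.
Qed.

Lemma geodesicC p q : geodesic p q = geodesic q p.
Proof.
have [->//|pq] := pselect (p = q).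
apply/seteqP; split=> x; rewrite !geodesicP //; try (by move=> e; apply: pq);
  move=> -[a [b [a0 b0 ->]]]; exists b, a; split=> //; exact: addrC.
Qed.

(** Meant for future null vectors [n]; enlarging [n] shrinks the horoball. *)
Definition hball (n : vec R) : set (H3 R) := [set x | lf (X x) n <= 1].

(** The parameter [h] of [horoball_at] is [s^-1] at a finite centre and [s] at infinity. *)
Lemma horoball_atP p B : horoball_at p B <-> exists2 s, 0 < s & B = hball (s *: nv p).
Proof.
case: p => [[c d]|].
  have h s : 0 < s -> hball (s *: nv (Some (Complex c d))) =
      [set x | cabs (hz x - Complex c d) ^+ 2 + ht x ^+ 2 <= s^-1 * ht x].
    move=> s0; apply/predeqP => -[[[a b] t] /= t0]; rewrite /hball /hz /ht /= cabs_sqr.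
    have -> : lf (X (@MkH3 R (a, b, t) t0)) (s *: ((c ^+ 2 + d ^+ 2, c, d, 1) : vec R)) =
      s / t * ((a - c) ^+ 2 + (b - d) ^+ 2 + t ^+ 2).
      rewrite lf.unlock /X /=; rewrite /GRing.scale /=; field; exact: lt0r_neq0.
    have -> : s^-1 * t = (s / t)^-1 * 1 by field; rewrite !gt_eqF.
    by rewrite ler_pdivlMl ?divr_gt0.
  split=> -[k k0]; last by move=> ->; exists k^-1; rewrite ?invr_gt0 ?h.
  by move=> ->; exists k^-1; rewrite ?invr_gt0 ?h ?invr_gt0 // invrK.
have h s : 0 < s -> hball (s *: nv None) = [set x : H3 R | s <= ht x].
  move=> s0; apply/predeqP => -[[[a b] t] /= t0]; rewrite /hball /ht /=.
  have -> : lf (X (@MkH3 R (a, b, t) t0)) (s *: ((1, 0, 0, 0) : vec R)) = s / t.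
    rewrite lf.unlock /X /=; rewrite /GRing.scale /=; field; exact: lt0r_neq0.
  by rewrite ler_pdivrMr // mul1r.
by split=> -[k k0]; move=> ->; exists k; rewrite ?h.
Qed.

Section Cone.
Context (I : finType) (n : I -> vec R).

Definition cone u := exists2 l : I -> R, (forall i, 0 <= l i) & u = \sum_i l i *: n i.

Lemma coneD u v : cone u -> cone v -> cone (u + v).
Proof.
move=> [l l0 ->] [k k0 ->]; exists (fun i => l i + k i) => [i|]; first exact: addr_ge0.
by rewrite -big_split; apply: eq_bigr => i _; rewrite scalerDl.
Qed.

Lemma coneZ (k : R) u : 0 <= k -> cone u -> cone (k *: u).
Proof.
move=> k0 [l l0 ->]; exists (fun i => k * l i) => [i|]; first exact: mulr_ge0.
by rewrite scaler_sumr; apply: eq_bigr => i _; rewrite scalerA.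
Qed.

Lemma cone_gen i : cone (n i).
Proof.
exists (fun j => (j == i)%:R) => [j|]; first by rewrite ler0n.
by rewrite (bigD1 i) //= eqxx scale1r big1 ?addr0 // => j /negPf ->; rewrite scale0r.
Qed.

(** [C] may fail to contain 0, as the cone over a set of points does; hence the sum is non-empty and
    the induction keeps the alternative of a zero partial sum. *)
Lemma closedD_sum (C : vec R -> Prop) (J : finType) (P : pred J) (F : J -> vec R) :
  (forall u v, C u -> C v -> C (u + v)) -> (exists i, P i) ->
  (forall i, P i -> C (F i)) -> C (\sum_(i | P i) F i).
Proof.
move=> CD [i0 Pi0] CF; rewrite (bigD1 i0) //=.
have [->|h] : \sum_(i | P i && (i != i0)) F i = 0 \/ C (\sum_(i | P i && (i != i0)) F i).
- elim/big_ind : _ => [|u v [->|hu] [->|hv]|i /andP[Pi _]]; rewrite ?addr0 ?add0r;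
    by [left|right|right; apply: CD|right; apply: CF].
- by rewrite addr0; apply: CF.
by apply: CD => //; apply: CF.
Qed.

(** A single null generator belongs to no [hat A], so a combination has to be assembled from pairs,
    that is, from points of geodesics. The weight of [i0] is divided equally among the other indices
    of positive weight. *)
Lemma sum_pairs (C : vec R -> Prop) (l : I -> R) i0 j0 :
  (forall u v, C u -> C v -> C (u + v)) ->
  (forall i, 0 <= l i) -> i0 != j0 -> 0 < l i0 -> 0 < l j0 ->
  (forall i j a b, i != j -> 0 < l i -> 0 < l j -> 0 < a -> 0 < b -> C (a *: n i + b *: n j)) ->
  C (\sum_i l i *: n i).
Proof.
move=> CD l0 ij li lj CF.
pose S := [pred k | (k != i0) && (0 < l k)].
have Sj : j0 \in S by rewrite inE eq_sym ij lj.
have m0 : (0 < #|S|)%N by apply/card_gt0P; exists j0.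
have mR : (0 : R) < #|S|%:R by rewrite ltr0n.
suff -> : \sum_i l i *: n i = \sum_(k | S k) ((l i0 / #|S|%:R) *: n i0 + l k *: n k).
  apply: closedD_sum => //; first by exists j0.
  move=> k; rewrite /S /= => /andP[ki lk]; apply: CF => //; first by rewrite eq_sym.
  by rewrite divr_gt0.
rewrite big_split /= sumr_const -scaler_nat scalerA mulrC divfK ?gt_eqF //.
rewrite (bigD1 i0) //=; congr (_ + _); rewrite (bigID (fun k => 0 < l k)) /=.
rewrite [X in _ + X]big1 ?addr0 // => k /andP[_].
by rewrite lt_neqAle l0 andbT negbK => /eqP <-; rewrite scale0r.
Qed.

Hypothesis n_null : forall i, lf (n i) (n i) = 0.

Lemma timelike_sum_pair (l : I -> R) : (forall i, 0 <= l i) ->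
  timelike (\sum_i l i *: n i) -> exists i j, [/\ i != j, 0 < l i & 0 < l j].
Proof.
move=> l0 ht.
have [i li] : exists i, 0 < l i.
  apply: contrapT => h; apply: (timelike_neq0 ht); apply: big1 => i _.
  have [li|li] := ltrP 0 (l i); first by case: h; exists i.
  by rewrite (_ : l i = 0) ?scale0r //; apply/eqP; rewrite eq_le l0 li.
exists i; apply: contrapT => h.
case: ht => _; rewrite (bigD1 i) //= big1 ?addr0.
  by rewrite !lfE n_null !mulr0 ltxx.
move=> j ji; have [lj|lj] := ltrP 0 (l j); first by case: h; exists j; rewrite eq_sym.
by rewrite (_ : l j = 0) ?scale0r //; apply/eqP; rewrite eq_le l0 lj.
Qed.

End Cone.

Lemma hat_cone_convex (I : finType) (n : I -> vec R) :
  hconvex [set x | cone n (X x)].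
Proof.
by move=> x y z /= hx hy /betweenP[a [b [a0 b0 ->]]]; apply: coneD; apply: coneZ.
Qed.

Lemma timelike_nvD (a b : R) p q : p <> q -> 0 < a -> 0 < b ->
  timelike (a *: nv p + b *: nv q).
Proof.
move=> pq a0 b0; apply: causal_timelike.
  by apply: causalD; apply: causalZ; rewrite ?ltW //; exact: nv_causal.
rewrite !lfE !lf_nvv (lfC (nv q)) !mulr0 add0r addr0.
have h := mulr_gt0 (mulr_gt0 a0 b0) (lf_nv_gt0 pq); lra.
Qed.

Lemma hat_geodesic p q u : p <> q -> hat (geodesic p q) u <->
  exists a b, [/\ 0 < a, 0 < b & u = a *: nv p + b *: nv q].
Proof.
move=> pq; split=> [[tu /geodesicP -/(_ pq)[a [b [a0 b0 e]]]]|[a [b [a0 b0 ->]]]].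
  have [c c0 ->] := timelike_proj tu; exists (c * a), (c * b).
  by rewrite !mulr_gt0 // e scalerDr !scalerA.
have tu := timelike_nvD pq a0 b0; split=> //; apply/geodesicP => //.
have [c c0 e] := timelike_proj tu.
have cn : c != 0 by rewrite gt_eqF.
exists (c^-1 * a), (c^-1 * b); rewrite !mulr_gt0 ?invr_gt0 //; split=> //.
by apply: (scalerI cn); rewrite -e scalerDr !scalerA !mulrA mulfV // !mul1r.
Qed.

(** The points of the cone form a convex set containing the joining geodesics; conversely a timelike
    combination of null vectors has two positive weights and splits into points of such
    geodesics. *)
Lemma ideal_hullP (I : finType) (v : I -> ideal R) x : injective v ->
  ideal_hull (range v) x <-> cone (fun i => nv (v i)) (X x).
Proof.
move=> vI; split=> [h|[l l0 e] C [Cc Cg]].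
  apply: (h [set x | cone (fun i => nv (v i)) (X x)]); split; first exact: hat_cone_convex.
  move=> {h}x /= [_ [_ [[i _ <-] [j _ <-]]]].
  have [->|pq] := pselect (v i = v j); first by rewrite geodesic_self.
  move=> /geodesicP -/(_ pq)[a [b [a0 b0 ->]]].
  by apply: coneD; apply: coneZ; rewrite ?ltW //; exact: (cone_gen (fun i => nv (v i))).
apply/hat_X; rewrite e.
have ht : timelike (\sum_i l i *: (fun i => nv (v i)) i) by rewrite -e; exact: X_timelike.
have [|i0 [j0 [ij li lj]]] := @timelike_sum_pair _ (fun i => nv (v i)) _ l l0 ht.
  by move=> i; exact: lf_nvv.
apply: (sum_pairs _ l0 ij li lj); first exact: (proj1 (hconvexP C) Cc).
move=> i j a b /eqP hij _ _ a0 b0 /=.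
have vij : v i <> v j by move=> /vI.
have [t1 t2] : hat (geodesic (v i) (v j)) (a *: nv (v i) + b *: nv (v j)).
  by apply/hat_geodesic => //; exists a, b.
by split=> //; apply: Cg; exists (v i), (v j).
Qed.

End Hulls.

(** * Topology *)

Section Topology.
Context (R : realType).
Implicit Types (u v w : vec R) (x y z : H3 R) (p q : ideal R) (A P : set (H3 R)).

Lemma cvg_pr1 {T : Type} {S1 S2 : topologicalType} (F : set_system T) {FF : Filter F}
  (f : T -> S1 * S2) (l : S1 * S2) : f @ F --> l -> (fun t => (f t).1) @ F --> l.1.
Proof. by case: l => l1 l2 h; apply: (@cvg_comp _ _ _ f fst F (nbhs (l1, l2)) (nbhs l1) h); exact: cvg_fst. Qed.

Lemma cvg_pr2 {T : Type} {S1 S2 : topologicalType} (F : set_system T) {FF : Filter F}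
  (f : T -> S1 * S2) (l : S1 * S2) : f @ F --> l -> (fun t => (f t).2) @ F --> l.2.
Proof. by case: l => l1 l2 h; apply: (@cvg_comp _ _ _ f snd F (nbhs (l1, l2)) (nbhs l2) h); exact: cvg_snd. Qed.

Lemma cvg_prod {T : Type} {S1 S2 : topologicalType} (F : set_system T) {FF : Filter F}
  (f : T -> S1) (g : T -> S2) (a : S1) (b : S2) :
  f @ F --> a -> g @ F --> b -> (fun t => (f t, g t)) @ F --> (a, b).
Proof. by move=> fa gb; apply: (@cvg_pair _ _ _ F (nbhs a) (nbhs b)). Qed.

Lemma cvg_vec {T : Type} (F : set_system T) {FF : Filter F} (a b c d : T -> R) (a' b' c' d' : R) :
  a @ F --> a' -> b @ F --> b' -> c @ F --> c' -> d @ F --> d' ->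
  (fun t => (a t, b t, c t, d t) : vec R) @ F --> ((a', b', c', d') : vec R).
Proof.
move=> ha hb hc hd.
exact: (@cvg_prod _ _ R F FF _ _ _ _ (@cvg_prod _ _ R F FF _ _ _ _ (@cvg_prod _ R R F FF _ _ _ _ ha hb) hc) hd).
Qed.

Lemma cvg_coords {T : Type} (F : set_system T) {FF : Filter F} (f : T -> vec R) u :
  f @ F --> u -> [/\ (fun t => (f t).1.1.1) @ F --> u.1.1.1, (fun t => (f t).1.1.2) @ F --> u.1.1.2,
   (fun t => (f t).1.2) @ F --> u.1.2 & (fun t => (f t).2) @ F --> u.2].
Proof.
move=> h.
have h1 : (fun t => (f t).1) @ F --> u.1 by exact: cvg_pr1 h.
have h2 : (fun t => (f t).1.1) @ F --> u.1.1 by exact: cvg_pr1 h1.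
split.
- exact: (@cvg_pr1 _ R R F FF _ _ h2).
- exact: (@cvg_pr2 _ R R F FF _ _ h2).
- exact: cvg_pr2 h1.
- exact: cvg_pr2 h.
Qed.

Lemma cvg_lf {T : Type} (F : set_system T) {FF : Filter F} (f g : T -> vec R) u v :
  f @ F --> u -> g @ F --> v -> (fun t => lf (f t) (g t)) @ F --> lf u v.
Proof.
move=> /cvg_coords[f1 f2 f3 f4] /cvg_coords[g1 g2 g3 g4].
rewrite lf.unlock; apply: cvgB; [apply: cvgB; [apply: cvgD|]|].
- exact: cvgM.
- exact: cvgM.
- by apply: cvgM => //; apply: cvgM => //; exact: cvg_cst.
- by apply: cvgM => //; apply: cvgM => //; exact: cvg_cst.
Qed.

Lemma hcoord_continuous : continuous (@hcoord R).
Proof. exact: initial_continuous. Qed.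

Lemma X_continuous : continuous (@X R).
Proof.
pose Y (a : R * R * R) : vec R := ((a.1.1 ^+ 2 + a.1.2 ^+ 2 + a.2 ^+ 2) * a.2^-1,
  a.1.1 * a.2^-1, a.1.2 * a.2^-1, a.2^-1).
have -> : @X R = Y \o @hcoord R.
  by apply/funext => y; rewrite /X /Y /=; case: (hcoord y) => [[a b] t].
move=> x; apply: (@cvg_comp _ _ _ _ _ _ (nbhs (hcoord x))); first exact: hcoord_continuous.
have h : (fun a : R * R * R => a) @ hcoord x --> hcoord x by exact: cvg_id.
have h1 : (fun a : R * R * R => a.1) @ hcoord x --> (hcoord x).1 by exact: cvg_pr1 h.
have h11 : (fun a : R * R * R => a.1.1) @ hcoord x --> (hcoord x).1.1 by exact: cvg_pr1 h1.
have h12 : (fun a : R * R * R => a.1.2) @ hcoord x --> (hcoord x).1.2 by exact: cvg_pr2 h1.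
have h2 : (fun a : R * R * R => a.2) @ hcoord x --> (hcoord x).2 by exact: cvg_pr2 h.
have hv : (fun a : R * R * R => a.2^-1) @ hcoord x --> (hcoord x).2^-1.
  by apply: cvgV => //; rewrite gt_eqF //; exact: ht_gt0.
apply: cvg_vec => //; apply: cvgM => //.
by apply: cvgD; [apply: cvgD|]; under eq_fun do rewrite expr2; rewrite expr2; apply: cvgM.
Qed.

Lemma near_timelike u : timelike u -> \forall v \near u, timelike v.
Proof.
move=> [u1 u2].
have h : (fun v : vec R => v) @ u --> u by exact: cvg_id.
have [_ _ _ h4] := cvg_coords h; have h5 := cvg_lf h h.
have n1 : \forall v \near u, 0 < v.2 by exact: (cvgr_gt _ h4 _ u1).
have n2 : \forall v \near u, 0 < lf v v by exact: (cvgr_gt _ (h5 _) _ u2).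
by apply: filterS2 n1 n2.
Qed.

Lemma cvg_hproj u : timelike u -> hproj v @[v --> u] --> hproj u.
Proof.
move=> tu.
suff : (@hcoord R \o @hproj R) @ u --> hcoord (hproj u).
  by move=> h U [? /= [[W oW <-]]] /= Wu /filterS; apply; apply: h; exact: open_nbhs_nbhs.
have h : (fun v : vec R => v) @ u --> u by exact: cvg_id.
have [h1 h2 h3 h4] := cvg_coords h; have h5 := cvg_lf h h.
have u0 : u.2 != 0 by rewrite gt_eqF //; case: tu.
have hv : (fun v : vec R => v.2^-1) @ u --> u.2^-1 by apply: cvgV.
rewrite hcoord_proj //.
apply: (cvg_trans (G := (fun v : vec R => (v.1.1.2 / v.2, v.1.2 / v.2, Num.sqrt (lf v v / 2) / v.2)) @ u)).
  apply: near_eq_cvg; apply: filterS (near_timelike tu) => v tv /=.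
  by rewrite hcoord_proj.
apply: (@cvg_prod _ (R * R)%type R (nbhs u)); [apply: (@cvg_prod _ R R (nbhs u))|]; apply: cvgM => //.
apply: (cvg_comp (fun v : vec R => lf v v / 2) (@Num.sqrt R)); last exact: sqrt_continuous.
by apply: cvgM; [exact: (h5 _)|exact: cvg_cst].
Qed.

(** Allows interiors in [H3] to be tested by adding small vectors in the ambient linear space. *)
Lemma nbhs_hat P u : timelike u -> nbhs (hproj u) P <-> nbhs u (hat P).
Proof.
move=> tu; split=> h.
  by apply: filterS2 (near_timelike tu) (cvg_hproj tu h).
have [c c0 e] := timelike_proj tu.
have hc : (fun y => c *: X y) @ hproj u --> u.
  rewrite [Z in _ --> Z]e.
  exact: (@continuous_comp _ _ _ (@X R) ( *:%R c) (hproj u) (@X_continuous _) (@scaler_continuous R (vec R) c _)).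
by apply: (@filterS _ _ (nbhs_filter (hproj u)) _ _ _ (hc _ h)) => y /= /(hatZE _ _ c0) /hat_X.
Qed.

Lemma nbhs_line P u w : nbhs u (hat P) -> exists2 e, 0 < e & forall r, `|r| < e -> hat P (u + r *: w).
Proof.
move=> h; have hc : (fun r : R => u + r *: w) @ 0 --> u.
  rewrite -{2}(addr0 u) -(scale0r w); apply: cvgD; first exact: cvg_cst.
  by apply: cvgZr_tmp; exact: cvg_id.
have := hc _ h; rewrite /= => /nbhs_ballP[e e0 he]; exists e => // r re.
by apply: he; rewrite /ball /= sub0r normrN.
Qed.

Lemma nbhs_shift P u w (k : R) : 0 < k -> nbhs u (hat P) ->
  (forall v, hat P v -> hat P (w + k *: v)) -> nbhs (w + k *: u) (hat P).
Proof.
move=> k0 h hP.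
have hc : (fun v => k^-1 *: (v - w)) @ (w + k *: u) --> u.
  have {2}-> : u = k^-1 *: ((w + k *: u) - w).
    by rewrite addrC addKr scalerA mulVf ?scale1r // gt_eqF.
  by apply: cvgZl_tmp; apply: cvgB; [exact: cvg_id|exact: cvg_cst].
apply: (@filterS _ _ (nbhs_filter _) _ _ _ (hc _ h)) => v /= /hP.
by rewrite scalerA mulfV ?gt_eqF // scale1r addrC subrK.
Qed.

End Topology.

(** * Closedness of cones, connectedness of segments *)

Section Closed.
Context (R : realType).
Implicit Types (u v w : vec R) (x y z : H3 R) (p q : ideal R) (A P : set (H3 R)).

Section ClosedCone.
Context (I : finType) (n : I -> vec R).
Import ArrowAsProduct.

Lemma compact_cone_box (M : R) :
  compact [set u | exists2 l : I -> R, (forall i, 0 <= l i <= M) & u = \sum_i l i *: n i].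
Proof.
have cK : compact [set l : I -> R | forall i, [set` `[0, M]] (l i)].
  exact: (@tychonoff I (fun=> R) (fun=> [set` `[0, M]]) (fun=> @segment_compact R 0 M)).
have cf : continuous (fun l : I -> R => \sum_i l i *: n i).
  apply: continuous_big => [|i _]; first exact: add_continuous.
  move=> l; have h := @continuous_comp _ _ _ (@proj I (fun=> R) i) (fun k : R => k *: n i) l.
  by apply: h; [exact: proj_continuous|exact: scalel_continuous].
have := continuous_compact (continuous_subspaceT cf) cK.
congr compact; apply/seteqP; split=> u /=.
  by move=> [l hl <-]; exists l => // i; have := hl i; rewrite /= in_itv.
by move=> [l hl ->]; exists l => // i /=; rewrite in_itv /= hl.
Qed.

(** Near [u] the pairing with [w] is bounded, and since it is positive on every generator it bounds
    all weights; so locally the cone is the continuous image of a compact box. *)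
Lemma cone_closed w : (forall i, 0 < lf (n i) w) -> closed [set u | cone n u].
Proof.
move=> nw u cu.
pose M := \sum_i (`|lf u w| + 1) / lf (n i) w.
have hM i : (`|lf u w| + 1) / lf (n i) w <= M.
  rewrite /M (bigD1 i) //= lerDl sumr_ge0 // => j _.
  by rewrite divr_ge0 ?addr_ge0 // ltW.
have hc : (fun v => lf v w) @ u --> lf u w.
  by apply: cvg_lf; [exact: cvg_id|exact: cvg_cst].
have nu : \forall v \near u, lf v w < `|lf u w| + 1.
  by apply: (cvgr_lt _ hc); rewrite ltr_pwDr // ler_norm.
suff : [set u | exists2 l : I -> R, (forall i, 0 <= l i <= M) & u = \sum_i l i *: n i] u.
  by move=> [l hl ->]; exists l => // i; have /andP[] := hl i.
apply: (compact_closed (@norm_hausdorff _ _) (@compact_cone_box M)).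
move=> B /(filterI nu)/cu[v /= [[l l0 e] [lv Bv]]]; exists v; split=> //.
exists l => // i; rewrite l0 /=; apply: le_trans (hM i).
rewrite ler_pdivlMr //; apply: le_trans (ltW lv).
rewrite e lf_suml (bigD1 i) //= lfZl lerDl sumr_ge0 // => j _.
by rewrite lfZl mulr_ge0 // ltW.
Qed.

End ClosedCone.

(** The parameters where [C] holds form a nonempty subset of the unit interval that is open and
    closed in it. All continuation arguments along paths rest on this. *)
Lemma segment_locally_constant (C : R -> Prop) :
  (forall r : R, 0 <= r <= 1 -> \forall s \near r, 0 <= s <= 1 -> (C r <-> C s)) -> C 0 -> C 1.
Proof.
move=> h C0.
pose B : set R := [set r | 0 <= r <= 1 /\ C r].
have e : B = `[0, 1]%classic.
  apply: segment_connected.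
  - by exists 0; split=> //; rewrite lexx ler01.
  - exists (interior [set r | 0 <= r <= 1 -> C r]); first exact: open_interior.
    apply/seteqP; split=> r /=.
      move=> [r01 Cr]; split; first by rewrite in_itv.
      by apply: filterS (h r r01) => s hs /hs[+ _]; apply.
    by rewrite in_itv /= => -[r01 /nbhs_singleton hr]; split=> //; exact: hr.
  - exists (closure B); first exact: closed_closure.
    apply/seteqP; split=> r /=.
      by move=> [r01 Cr]; split; [rewrite in_itv|exact: subset_closure].
    rewrite in_itv /= => -[r01 cr]; split=> //.
    by have [s [[s01 Cs] hs]] := cr _ (h r r01); apply/(hs s01).
have [] // : B 1 by rewrite e /= in_itv /= ler01 lexx.
Qed.

End Closed.

(** * Faces and ideal vertices *)

Section Faces.
Context (R : realType).
Implicit Types (u v w : vec R) (x y z : H3 R) (p q : ideal R) (A P F : set (H3 R)).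

(** In cone terms the side conditions [z <> x] and [z <> y] disappear: arbitrary summands are
    allowed, and for proportional ones the claim is trivial. *)
Lemma faceP P F : face P F <->
  [/\ F `<=` P, forall u v, hat F u -> hat F v -> hat F (u + v)
    & forall u v, hat P u -> hat P v -> hat F (u + v) -> hat F u].
Proof.
split=> [[FP /hconvexP Fc h]|[FP Fc h]]; split=> //.
  move=> u v [tu Pu] [tv Pv] [tuv Fuv].
  have [a a0 ea] := timelike_proj tu; have [b b0 eb] := timelike_proj tv.
  have [e|ne] := pselect (hproj u = hproj v).
    split=> //; suff -> : hproj u = hproj (u + v) by [].
    have -> : u + v = (a + b) *: X (hproj u) by rewrite scalerDl {2}e -ea -eb.
    by rewrite projZ ?proj_X ?addr_gt0 //; exact: X_timelike.
  have [c c0 ec] := timelike_proj tuv.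
  have cn : c != 0 by rewrite gt_eqF.
  have an : a != 0 by rewrite gt_eqF.
  have bn : b != 0 by rewrite gt_eqF.
  have eX : X (hproj (u + v)) = (a / c) *: X (hproj u) + (b / c) *: X (hproj v).
    apply: (scalerI cn); rewrite -ec scalerDr !scalerA ![c * _]mulrC !divfK //.
    by rewrite -ea -eb.
  have [] // := h (hproj u) (hproj v) (hproj (u + v)) Pu Pv.
  - by apply/betweenP; exists (a / c), (b / c); rewrite !divr_ge0 ?ltW.
  (* If the sum had the direction of [u], so would [v], against [ne]. *)
  - move=> e; apply: ne; apply: X_inj.
    move: eX; rewrite e => /eqP; rewrite addrC -subr_eq => /eqP eX.
    have tk : timelike ((1 - a / c) *: X (hproj u)).
      rewrite scalerBl scale1r eX; apply: timelikeZ; [exact: divr_gt0|exact: X_timelike].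
    have {}eX : (1 - a / c) *: X (hproj u) = b / c *: X (hproj v) by rewrite scalerBl scale1r.
    have k0 : 0 < 1 - a / c.
      have := lf_timelike tk (X_timelike (hproj u)); rewrite lfZl lf_XX; lra.
    by rewrite -(proj_X (hproj u)) -(projZ k0 (X_timelike _)) eX projZ ?proj_X ?divr_gt0 //;
      exact: X_timelike.
  - move=> e; apply: ne; apply: X_inj.
    move: eX; rewrite e => /eqP; rewrite -subr_eq => /eqP eX.
    have tk : timelike ((1 - b / c) *: X (hproj v)).
      rewrite scalerBl scale1r eX; apply: timelikeZ; [exact: divr_gt0|exact: X_timelike].
    have {}eX : (1 - b / c) *: X (hproj v) = a / c *: X (hproj u) by rewrite scalerBl scale1r.
    have k0 : 0 < 1 - b / c.
      have := lf_timelike tk (X_timelike (hproj v)); rewrite lfZl lf_XX; lra.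
    by rewrite -(proj_X (hproj v)) -(projZ k0 (X_timelike _)) eX projZ ?proj_X ?divr_gt0 //;
      exact: X_timelike.
  exact/hconvexP.
move=> x y z Px Py /betweenP[a [b [a0 b0 e]]] zx zy Fz.
have a1 : 0 < a.
  rewrite lt_neqAle a0 andbT; apply/eqP => a00; apply: zy.
  rewrite -a00 scale0r add0r in e.
  have b1 : 0 < b.
    rewrite lt_neqAle b0 andbT; apply/eqP => b00.
    by have := timelike_neq0 (X_timelike z); rewrite e -b00 scale0r.
  by rewrite -(proj_X z) e projZ ?proj_X //; exact: X_timelike.
have b1 : 0 < b.
  rewrite lt_neqAle b0 andbT; apply/eqP => b00; apply: zx.
  rewrite -b00 scale0r addr0 in e.
  by rewrite -(proj_X z) e projZ ?proj_X //; exact: X_timelike.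
have hx : hat P (a *: X x) by apply/hatZE => //; apply/hat_X.
have hy : hat P (b *: X y) by apply/hatZE => //; apply/hat_X.
have hz : hat F (a *: X x + b *: X y) by rewrite -e; apply/hat_X.
split; apply/hat_X.
  by apply/(hatZE _ _ a1); exact: h hx hy hz.
by apply/(hatZE _ _ b1); apply: h hy hx _; rewrite addrC.
Qed.

Definition rays (I : finType) (v : I -> ideal R) (n : I -> vec R) :=
  forall i, exists2 s, 0 < s & n i = s *: nv (v i).

Definition spanned (I : finType) P (n : I -> vec R) := forall x, P x <-> cone n (X x).

Section Family.
Context (I : finType) (v : I -> ideal R) (n : I -> vec R).
Hypothesis (nr : rays v n).

Lemma rays_causal i : causal (n i).
Proof. by have [s s0 ->] := nr i; apply: causalZ; [exact: ltW|exact: nv_causal]. Qed.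

Lemma rays_null i : lf (n i) (n i) = 0.
Proof. by have [s s0 ->] := nr i; rewrite !lfE lf_nvv !mulr0. Qed.

Lemma rays_neq0 i : n i <> 0.
Proof.
have [s s0 ->] := nr i; move/eqP; rewrite scaler_eq0 gt_eqF //= => /eqP.
exact: nv_neq0.
Qed.

Lemma rays_timelike u i : timelike u -> 0 < lf u (n i).
Proof. by move=> tu; apply: lf_timelike_causal => //; [exact: rays_causal|exact: rays_neq0]. Qed.

Lemma rays_gt0 i j : v i <> v j -> 0 < lf (n i) (n j).
Proof.
move=> ij; have [s s0 ->] := nr i; have [t t0 ->] := nr j.
by rewrite !lfE !mulr_gt0 // lf_nv_gt0.
Qed.

Lemma rays_nv_gt0 p i : v i <> p -> 0 < lf (nv p) (n i).
Proof.
move=> ip; have [s s0 ->] := nr i; rewrite lfZr mulr_gt0 // lf_nv_gt0 //.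
by move=> e; apply: ip.
Qed.

Lemma cone_rescale u : cone n u <-> cone (fun i => nv (v i)) u.
Proof.
have /choice[s hs] : forall i, exists s, 0 < s /\ n i = s *: nv (v i).
  by move=> i; have [s s0 e] := nr i; exists s.
split=> -[l l0 ->].
  exists (fun i => l i * s i) => [i|]; first by rewrite mulr_ge0 // ltW //; case: (hs i).
  by apply: eq_bigr => i _; have [_ ->] := hs i; rewrite scalerA.
exists (fun i => l i / s i) => [i|]; first by rewrite divr_ge0 // ltW //; case: (hs i).
apply: eq_bigr => i _; have [s0 ->] := hs i; rewrite scalerA divfK //.
by rewrite gt_eqF.
Qed.

Lemma hull_spanned P : injective v -> P = ideal_hull (range v) -> spanned P n.
Proof. by move=> vI -> x; rewrite cone_rescale ideal_hullP. Qed.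

Lemma timelike_pair i j (a b : R) : v i <> v j -> 0 < a -> 0 < b ->
  timelike (a *: n i + b *: n j).
Proof.
move=> ij a0 b0; have [s s0 ->] := nr i; have [t t0 ->] := nr j.
by rewrite !scalerA; apply: timelike_nvD => //; exact: mulr_gt0.
Qed.

Context (P : set (H3 R)).
Hypothesis Pn : spanned P n.

Lemma hat_spanned u : hat P u <-> timelike u /\ cone n u.
Proof.
rewrite /hat; split=> -[tu h]; split=> //.
  have [c c0 ->] := timelike_proj tu; apply: coneZ; first exact: ltW.
  exact/Pn.
by apply/Pn; rewrite X_proj //; apply: coneZ => //; rewrite invr_ge0 sqrtr_ge0.
Qed.

Lemma spanned_convex : hconvex P.
Proof.
by apply/hconvexP => u w /hat_spanned[tu cu] /hat_spanned[tw cw];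
  apply/hat_spanned; split; [exact: timelikeD|exact: coneD].
Qed.

(** A face is governed by supports: a small multiple of the second combination can be subtracted
    from the first without leaving [P], which makes it a summand of a vector over [F]. *)
Lemma face_support F (l m : I -> R) :
  face P F -> (forall i, 0 <= l i) -> (forall i, 0 <= m i) ->
  (forall i, 0 < m i -> 0 < l i) -> hat F (\sum_i l i *: n i) ->
  timelike (\sum_i m i *: n i) -> hat F (\sum_i m i *: n i).
Proof.
move=> /faceP[FP Fc h] l0 m0 ml hF tm.
(* Chosen so that [e * m i <= l i / 2]; half of the [l]-combination survives the subtraction and
   keeps the remainder timelike. *)
pose e := (1 + \sum_(i | 0 < l i) 2 * m i / l i)^-1.
have s0 : 0 <= \sum_(i | 0 < l i) 2 * m i / l i.
  by apply: sumr_ge0 => i li; apply: divr_ge0; [exact: mulr_ge0|exact: ltW].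
have e0 : 0 < e by rewrite invr_gt0 ltr_pwDl.
have he i : e * m i <= l i / 2.
  have [li|li] := ltrP 0 (l i); last first.
    have mi : m i <= 0 by rewrite leNgt; apply/negP => /ml; rewrite ltNge li.
    by rewrite (_ : m i = 0) ?mulr0 ?divr_ge0 //; apply/eqP; rewrite eq_le mi m0.
  have : 2 * m i / l i <= 1 + \sum_(i | 0 < l i) 2 * m i / l i.
    rewrite (bigD1 i) //= addrCA lerDl addr_ge0 //; apply: sumr_ge0 => j /andP[lj _].
    by apply: divr_ge0; [exact: mulr_ge0|exact: ltW].
  rewrite -(invrK (1 + _)) -/e ler_pdivrMr // ler_pdivlMl // => ?; lra.
apply/(hatZE _ _ e0); apply: (h _ (\sum_i (l i - e * m i) *: n i)).
- apply/hat_spanned; split; first exact: timelikeZ.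
  by apply: coneZ; [exact: ltW|exists m].
- apply/hat_spanned; split; last first.
    by exists (fun i => l i - e * m i) => // i; have := he i; have := l0 i; lra.
  have -> : \sum_i (l i - e * m i) *: n i =
      2^-1 *: (\sum_i l i *: n i) + \sum_i (l i / 2 - e * m i) *: n i.
    rewrite scaler_sumr -big_split /=; apply: eq_bigr => i _.
    rewrite scalerA -scalerDl; congr (_ *: _); lra.
  apply: timelikeDcausal.
    by apply: timelikeZ; [rewrite invr_gt0|case: hF].
  apply: causal_sum => i _; apply: causalZ; last exact: rays_causal.
  by rewrite subr_ge0.
rewrite scaler_sumr -big_split /= (eq_bigr (fun i => l i *: n i)) // => i _.
by rewrite scalerA -scalerDl; congr (_ *: _); ring.
Qed.

Lemma face_full F (l : I -> R) : face P F -> (forall i, 0 < l i) ->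
  hat F (\sum_i l i *: n i) -> F = P.
Proof.
move=> fF l0 hF; apply/seteqP; split; first by case: fF.
move=> x /Pn[m m0 e]; apply/hat_X; rewrite e.
by apply: (face_support fF _ _ _ hF) => // [i|]; [exact: ltW|rewrite -e; exact: X_timelike].
Qed.

(** A functional that is nonnegative over [P] vanishes on a sum only if it vanishes on both
    terms. *)
Lemma functional_face (c : vec R) : (forall i, 0 <= lf c (n i)) ->
  face P [set x | P x /\ lf c (X x) = 0].
Proof.
move=> c0; set F := [set x | _].
have hF u : hat F u <-> hat P u /\ lf c u = 0.
  rewrite /hat /F /=; split=> [[tu [Pu cu]]|[[tu Pu] cu]]; split=> //.
    by have [k k0 ->] := timelike_proj tu; rewrite lfZr cu mulr0.
  by split=> //; rewrite X_proj // lfZr cu mulr0.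
have cP u : hat P u -> 0 <= lf c u.
  move=> /hat_spanned[_ [l l0 ->]]; rewrite lf_sumr sumr_ge0 // => i _.
  by rewrite lfZr mulr_ge0.
have PD := proj1 (hconvexP P) spanned_convex.
apply/faceP; split.
- by move=> x [].
- move=> u w /hF[Pu cu] /hF[Pw cw]; apply/hF; split; first exact: PD.
  by rewrite lfDr cu cw addr0.
move=> u w Pu Pw /hF[_]; rewrite lfDr => e; apply/hF; split=> //.
have := cP _ Pu; have := cP _ Pw; lra.
Qed.

(** If [p] were not a vertex, [nv p] would pair positively with all generators, and on the cone the
    pairing with [o] would be at most [M] times the pairing with [nv p]. Towards the end [p] of the
    geodesic the latter tends to 0 and the former does not. *)
Lemma extreme_ray p q : p <> q -> geodesic p q `<=` P -> exists i, v i = p.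
Proof.
move=> pq gP; apply: contrapT => h.
have g0 i : 0 < lf (nv p) (n i) by apply: rays_nv_gt0 => e; apply: h; exists i.
pose o := X (H3_origin R); have to : timelike o by exact: X_timelike.
pose M := \sum_i lf o (n i) / lf (nv p) (n i).
have q0 i : 0 <= lf o (n i) / lf (nv p) (n i).
  by rewrite divr_ge0 ?ltW //; exact: rays_timelike.
have M0 : 0 <= M by apply: sumr_ge0.
have hM i : lf o (n i) <= M * lf (nv p) (n i).
  rewrite -ler_pdivrMr // /M (bigD1 i) //= lerDl sumr_ge0 //.
have g := lf_nv_gt0 pq.
have tp : 0 < lf o (nv p) by exact: lf_timelike_nv.
(* Small enough that at [nv p + e *: nv q] the bound by [M] already fails. *)
pose e := lf o (nv p) / (1 + M * lf (nv p) (nv q)).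
have d0 : 0 < 1 + M * lf (nv p) (nv q).
  by rewrite ltr_pwDl // mulr_ge0 // ltW.
have e0 : 0 < e by rewrite divr_gt0.
have : hat P (nv p + e *: nv q).
  have : hat (geodesic p q) (nv p + e *: nv q).
    by apply/hat_geodesic => //; exists 1, e; rewrite scale1r.
  by move=> [t hg]; split=> //; exact: gP.
move=> /hat_spanned[_ [l l0 E]].
have h1 : lf o (nv p + e *: nv q) <= M * lf (nv p) (nv p + e *: nv q).
  rewrite E !lf_sumr mulr_sumr; apply: ler_sum => i _.
  by rewrite !lfZr mulrCA ler_wpM2l.
rewrite !lfE lf_nvv add0r in h1.
have h2 : 0 < e * lf o (nv q) by rewrite mulr_gt0 //; exact: lf_timelike_nv.
have h3 : e * (1 + M * lf (nv p) (nv q)) = lf o (nv p) by rewrite divfK // gt_eqF.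
by clear pq; lra.
Qed.

Lemma spanned_closed : closed P.
Proof.
have -> : P = @X R @^-1` [set u | cone n u] by apply/predeqP => x; exact: Pn.
apply: closed_comp => [x _|]; first exact: X_continuous.
apply: (@cone_closed R I n (X (H3_origin R))) => i; rewrite lfC.
by apply: rays_timelike; exact: X_timelike.
Qed.

End Family.

Lemma rays_nv (I : finType) (v : I -> ideal R) : rays v (fun i => nv (v i)).
Proof. by move=> i; exists 1; rewrite ?scale1r. Qed.

Lemma finite_indexed (V : set (ideal R)) : finite_set V ->
  exists k (v : 'I_k -> ideal R), injective v /\ V = range v.
Proof.
move=> /finite_seqP[s ->]; exists (size (undup s)), (tnth (in_tuple (undup s))).
split; first by apply/tuple_uniqP; exact: undup_uniq.
apply/seteqP; split=> p /=.
  by rewrite -mem_undup => /(tnthP (in_tuple _))[i ->]; exists i.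
by move=> [i _ <-]; rewrite -mem_undup mem_tnth.
Qed.

(** The vertex set is intrinsic: a point of any other finite set with the same hull is the end of a
    geodesic inside [P], hence extreme. *)
Lemma ideal_vertexP (I : finType) (v : I -> ideal R) P p :
  injective v -> P = ideal_hull (range v) -> P !=set0 ->
  ideal_vertex P p <-> exists i, v i = p.
Proof.
move=> vI Pv [x Px]; split; last first.
  by move=> [i <-]; exists (range v); split; [exact: finite_image| |exists i].
move=> [V [Vf PV Vp]].
have [k [w [wI eV]]] := finite_indexed Vf; subst V.
have Pv' := hull_spanned (rays_nv v) vI Pv.
have Pw := hull_spanned (rays_nv w) wI PV.
case: Vp => i0 _ <-.
have [l l0 e] := proj1 (Pw x) Px.
have tx : timelike (\sum_i l i *: nv (w i)) by rewrite -e; exact: X_timelike.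
have [i [j [ij li lj]]] := timelike_sum_pair (fun i => lf_nvv (w i)) l0 tx.
have [j1 hj1] : exists j1, j1 != i0.
  by have [<-|] := eqVneq i i0; [exists j; rewrite eq_sym|exists i].
apply: (extreme_ray (rays_nv v) Pv' (q := w j1)) => [/wI e1|y]; first by rewrite e1 eqxx in hj1.
move/geodesicP => [|a [b [a0 b0 ey]]]; first by move/wI => e1; rewrite e1 eqxx in hj1.
apply/Pw; rewrite ey; apply: coneD; apply: coneZ; rewrite ?ltW //;
  exact: (cone_gen (fun i => nv (w i))).
Qed.

End Faces.

(** * Polyhedra and tilings *)

Section Polyhedra.
Context (R : realType).
Implicit Types (u v w : vec R) (x y z : H3 R) (p q : ideal R) (A P Q F : set (H3 R)).

Definition seg u v (r : R) : vec R := (1 - r) *: u + r *: v.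

Lemma seg0 u v : seg u v 0 = u.
Proof. by rewrite /seg subr0 scale1r scale0r addr0. Qed.

Lemma seg1 u v : seg u v 1 = v.
Proof. by rewrite /seg subrr scale1r scale0r add0r. Qed.

Lemma seg_ind (C : vec R -> Prop) u v (r : R) :
  (forall a b, C a -> C b -> C (a + b)) -> (forall k a, 0 < k -> C a -> C (k *: a)) ->
  C u -> C v -> 0 <= r <= 1 -> C (seg u v r).
Proof.
move=> CD CZ Cu Cv /andP[]; rewrite le_eqVlt => /predU1P[<-|r0]; first by rewrite seg0.
rewrite le_eqVlt => /predU1P[->|r1]; first by rewrite seg1.
by apply: CD; apply: CZ => //; rewrite subr_gt0.
Qed.

Lemma seg_timelike u v (r : R) : timelike u -> timelike v -> 0 <= r <= 1 -> timelike (seg u v r).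
Proof. by apply: seg_ind; [exact: timelikeD|exact: timelikeZ]. Qed.

Lemma seg_hat A u v (r : R) : hconvex A -> hat A u -> hat A v -> 0 <= r <= 1 -> hat A (seg u v r).
Proof. by move=> /hconvexP Ac; apply: seg_ind => // k a; exact: hatZ. Qed.

Lemma cvg_seg u v (r : R) : seg u v s @[s --> r] --> seg u v r.
Proof.
apply: cvgD; apply: cvgZr_tmp; last exact: cvg_id.
by apply: cvgB; [exact: cvg_cst|exact: cvg_id].
Qed.

Lemma cvg_hproj_seg u v (r : R) : timelike u -> timelike v -> 0 <= r <= 1 ->
  hproj (seg u v s) @[s --> r] --> hproj (seg u v r).
Proof.
move=> tu tv r01; apply: (cvg_comp (seg u v) (@hproj R) (@cvg_seg u v r)).
by apply: cvg_hproj; exact: seg_timelike.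
Qed.

Lemma near_seg A u v (r : R) : timelike u -> timelike v -> 0 <= r <= 1 ->
  nbhs (hproj (seg u v r)) A -> \forall s \near r, A (hproj (seg u v s)).
Proof. by move=> tu tv r01 hA; exact: (cvg_hproj_seg tu tv r01 hA). Qed.

Lemma interior_hat P x : P^° x <-> nbhs (X x) (hat P).
Proof. by rewrite -nbhs_hat ?proj_X //; exact: X_timelike. Qed.

Lemma interior_mix P u v (k : R) : hconvex P -> nbhs u (hat P) -> hat P v ->
  0 < k -> nbhs (v + k *: u) (hat P).
Proof.
move=> /hconvexP PD hu hv k0; apply: nbhs_shift => // w hw.
by apply: PD => //; exact: hatZ.
Qed.

Lemma interior_convex P : hconvex P -> hconvex P^°.
Proof.
move=> Pc; apply/hconvexP => u v [tu /(nbhs_hat _ tu) hu] [tv /(nbhs_hat _ tv) hv].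
have tuv := timelikeD tu tv; split=> //; apply/(nbhs_hat _ tuv).
rewrite addrC -[u]scale1r; apply: interior_mix => //.
exact: nbhs_singleton hv.
Qed.

(** From an interior point a little of any vector over [P] can be subtracted, so every point of [P]
    is a summand of a vector over [F]. *)
Lemma face_interior P F y : face P F -> F y -> P^° y -> F = P.
Proof.
move=> /faceP[FP Fc h] Fy /interior_hat hy; apply/seteqP; split=> // x Px.
have [e e0 he] := nbhs_line (X x) hy.
have e2 : 0 < e / 2 by rewrite divr_gt0.
apply/hat_X; apply/(hatZE _ _ e2); apply: (h _ (X y + (- (e / 2)) *: X x)).
- by apply/hatZE => //; apply/hat_X.
- apply: he; rewrite normrN gtr0_norm //; lra.
by rewrite addrCA scaleNr subrr addr0; apply/hat_X.
Qed.

Lemma polyhedron_span P : ideal_polyhedron P -> exists k (v : 'I_k -> ideal R),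
  [/\ injective v, P = ideal_hull (range v) & spanned P (fun i => nv (v i))].
Proof.
move=> [_ [V /finite_indexed[k [v [vI ->]]] PV]]; exists k, v; split=> //.
have h := hull_spanned (rays_nv v) vI PV. exact: h.
Qed.

Lemma polyhedron_convex P : ideal_polyhedron P -> hconvex P.
Proof. by move=> /polyhedron_span[k [v [_ _ Pn]]]; exact: spanned_convex Pn. Qed.

Lemma polyhedron_closed P : ideal_polyhedron P -> closed P.
Proof. by move=> /polyhedron_span[k [v [_ _ Pn]]]; have := spanned_closed (rays_nv v) Pn. Qed.

Section FaceSupport.
Context (I : finType) (n : I -> vec R).

(** All indices used by some expression of some point of [F]: when the generators are dependent a
    point has many expressions, and none is preferred. *)
Definition face_set F : {set I} :=
  [set i | `[< exists2 l : I -> R, (forall j, 0 <= l j) & hat F (\sum_j l j *: n j) /\ 0 < l i >]].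

Lemma face_setP F i : reflect
  (exists2 l : I -> R, (forall j, 0 <= l j) & hat F (\sum_j l j *: n j) /\ 0 < l i)
  (i \in face_set F).
Proof. by rewrite inE; exact: asboolP. Qed.

Lemma face_setS F F' : F `<=` F' -> face_set F \subset face_set F'.
Proof.
move=> FF; apply/fintype.subsetP => i /face_setP[l l0 [[tl Fl] li]]; apply/face_setP.
by exists l => //; split=> //; split=> //; exact: FF.
Qed.

Lemma face_set_witness F : (forall u v, hat F u -> hat F v -> hat F (u + v)) ->
  face_set F != finset.set0 -> exists l : I -> R,
    [/\ forall i, 0 <= l i, forall i, i \in face_set F -> 0 < l i & hat F (\sum_i l i *: n i)].
Proof.
move=> FD /set0Pn[i0 Fi0].
have /choice[L hL] : forall i, exists l : I -> R, i \in face_set F ->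
    [/\ forall j, 0 <= l j, hat F (\sum_j l j *: n j) & 0 < l i].
  move=> i; have [/face_setP[l l0 [h1 h2]]|_] := boolP (i \in face_set F); last by exists (fun=> 0).
  by exists l.
exists (fun j => \sum_(i in face_set F) L i j); split.
- by move=> j; apply: sumr_ge0 => i /hL[].
- move=> j Fj; have [h1 _ h2] := hL _ Fj.
  rewrite (bigD1 j) //=; apply: ltr_pwDl => //.
  by apply: sumr_ge0 => i /andP[/hL[]].
have -> : \sum_j (\sum_(i in face_set F) L i j) *: n j =
    \sum_(i in face_set F) \sum_j L i j *: n j.
  by rewrite exchange_big /=; apply: eq_bigr => j _; rewrite scaler_suml.
apply: (@closedD_sum R (hat F) I (fun i => i \in face_set F)) => //; first by exists i0.
by move=> i /hL[].
Qed.

End FaceSupport.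

(** A boundary point lies in a proper face; among the proper faces through it, one with the largest
    support is maximal, because nested faces with equal support coincide. *)
Lemma boundary_facet P x : ideal_polyhedron P -> P x -> ~ P^° x ->
  exists2 F, facet P F & F x.
Proof.
move=> Pp Px nPx; have [k [v [vI PV Pn]]] := polyhedron_span Pp.
have Pc := polyhedron_convex Pp; have PD := proj1 (hconvexP P) Pc.
pose n i := nv (v i); have nr : rays v n := rays_nv v.
pose good F := [/\ face P F, F <> P & F x].
have [F0 gF0] : exists F, good F.
  (* The smallest face through [x]: the points from which the segment to [x] can be prolonged inside
     [P]. It is proper, for if it contained an interior point then [x] would be interior. *)
  pose F := [set z | P z /\ exists2 e, 0 < e & hat P (X x - e *: X z)].
  have hF u : hat F u <-> hat P u /\ exists2 e, 0 < e & hat P (X x - e *: u).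
    rewrite /hat /F /=; split=> [[tu [Pu [e e0 he]]]|[[tu Pu] [e e0 he]]].
      split=> //; have [c c0 ec] := timelike_proj tu; exists (e / c); first exact: divr_gt0.
      by rewrite {1}ec {2}ec scalerA divfK ?gt_eqF.
    split=> //; split=> //; have [c c0 ec] := timelike_proj tu; exists (e * c); first exact: mulr_gt0.
    by rewrite -scalerA -ec.
  exists F; split.
  - apply/faceP; split=> [z []//|u w /hF[Pu [e e0 he]] /hF[Pw [d d0 hd]]|u w Pu Pw /hF[_ [e e0 he]]].
      apply/hF; split; first exact: PD.
      have ed : 0 < d + e by rewrite addr_gt0.
      exists (e * d / (d + e)); first by rewrite divr_gt0 // mulr_gt0.
      apply/(hatZE _ _ ed).
      have -> : (d + e) *: (X x - (e * d / (d + e)) *: (u + w)) =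
          d *: (X x - e *: u) + e *: (X x - d *: w).
        rewrite !scalerBr !scalerA mulrC divfK ?gt_eqF // scalerDl scalerDr opprD.
        by rewrite addrACA (mulrC d).
      by apply: PD; exact: hatZ.
    apply/hF; split=> //; exists e => //.
    have -> : X x - e *: u = (X x - e *: (u + w)) + e *: w.
      by rewrite scalerDr opprD addrA subrK.
    by apply: PD => //; exact: hatZ.
  - move=> FP; have [y Py] := proj1 Pp.
    have : F y by rewrite FP; exact: interior_subset Py.
    move=> [_ [e e0 he]]; apply: nPx; apply/interior_hat.
    have -> : X x = (X x - e *: X y) + e *: X y by rewrite subrK.
    by apply: interior_mix => //; apply/interior_hat.
  split=> //; exists (1 / 2); first by rewrite divr_gt0.
  have -> : X x - (1 / 2) *: X x = (1 / 2) *: X x.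
    by rewrite -{1}[X x]scale1r -scalerBl; congr (_ *: _); lra.
  by apply: hatZ; [rewrite divr_gt0|apply/hat_X].
have exm : exists m, `[< exists2 F, good F & #|face_set n F| = m >].
  by exists #|face_set n F0|; apply/asboolP; exists F0.
have bnd m : `[< exists2 F, good F & #|face_set n F| = m >] -> (m <= k)%N.
  by move=> /asboolP[F _ <-]; rewrite -[k in X in (_ <= X)%N]card_ord max_card.
case: (ex_maxnP exm bnd) => m /asboolP[F [fF FP Fx] Fm] mmax.
exists F => //; split=> // F' fF' F'P FF'.
have hc : (#|face_set n F'| <= #|face_set n F|)%N.
  by rewrite Fm; apply: mmax; apply/asboolP; exists F' => //; split=> //; exact: FF'.
have eS : face_set n F = face_set n F'.
  by apply/eqP; rewrite eqEcard face_setS.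
apply/seteqP; split=> // y F'y.
have [_ FD _] := proj1 (faceP P F) fF.
have Py : P y by case: fF' => + _ _; apply.
have [l l0 ey] := proj1 (Pn y) Py.
have lS i : 0 < l i -> i \in face_set n F.
  move=> li; rewrite eS; apply/face_setP; exists l => //; split=> //.
  by rewrite -ey; apply/hat_X.
have ty : timelike (\sum_i l i *: n i) by rewrite -ey; exact: X_timelike.
have [i [j [_ li _]]] := timelike_sum_pair (rays_null nr) l0 ty.
have [|L [L0 LF hL]] := face_set_witness FD (n := n).
  by apply/set0Pn; exists i; exact: lS.
apply/hat_X; rewrite ey.
by apply: (face_support nr Pn fF L0 l0 _ hL ty) => a /lS /LF.
Qed.

Lemma facet_interior P F x : facet P F -> F x -> ~ P^° x.
Proof. by move=> [fF FP _] Fx Px; apply: FP; exact: face_interior Px. Qed.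

(** * A tiling is determined by its facets *)

Section Tilings.
Implicit Types T : set (set (H3 R)).

Lemma tile_sub_eq T P Q : tiling T -> T P -> T Q -> Q `<=` P -> P = Q.
Proof.
move=> [poly _ _ disj _] TP TQ QP; apply: contrapT => PQ.
have [[x Qx] _] := poly _ TQ.
have : (P^° `&` Q^°) x by split=> //; exact: interiorS Qx.
by rewrite disj.
Qed.

Lemma tile_meets_interior T P Q x : tiling T -> T P -> T Q -> P x -> Q^° x -> P = Q.
Proof.
move=> hT TP TQ Px Qx; apply: (tile_sub_eq hT) => //.
case: hT => [_ _ _ _ faces]; have [_ fQ] := faces _ _ TP TQ.
have <- : P `&` Q = Q.
  by apply: (face_interior fQ _ Qx); split=> //; exact: interior_subset.
by move=> y [].
Qed.

Lemma facet_avoids_interior T Q F x : tiling T -> T Q -> tiling_facets T F -> F x -> ~ Q^° x.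
Proof.
move=> hT TQ [P TP fF] Fx Qx; have Px : P x by case: (fF) => -[+ _ _] _ _; apply.
have PQ := tile_meets_interior hT TP TQ Px Qx; subst P.
exact: facet_interior fF Fx Qx.
Qed.

(** A path in the interior of [P] can leave [Q] only through a facet of [Q], but that is also a
    facet of the first tiling, and those avoid the interior of [P]. *)
Lemma tile_interior_sub T T' P Q x : tiling T -> tiling T' -> T P -> T' Q ->
  tiling_facets T = tiling_facets T' -> P^° x -> Q x -> P^° `<=` Q.
Proof.
move=> hT hT' TP TQ ff Px Qx y Py.
have Pp : ideal_polyhedron P by case: hT => + _ _ _ _; apply.
have Qp : ideal_polyhedron Q by case: hT' => + _ _ _ _; apply.
have PiC := interior_convex (polyhedron_convex Pp).
have tX z := X_timelike z.
suff : Q (hproj (seg (X x) (X y) 1)) by rewrite seg1 proj_X.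
apply: (@segment_locally_constant R (fun r => Q (hproj (seg (X x) (X y) r)))); last first.
  by rewrite seg0 proj_X.
move=> r r01.
have [_ Pr] : hat P^° (seg (X x) (X y) r) by apply: seg_hat => //; apply/hat_X.
have [Qr|nQr] := pselect (Q (hproj (seg (X x) (X y) r))).
  have Qi : Q^° (hproj (seg (X x) (X y) r)).
    apply: contrapT => nQ; have [F fF Fr] := boundary_facet Qp Qr nQ.
    by apply: (facet_avoids_interior hT TP _ Fr Pr); rewrite ff; exists Q.
  by apply: filterS (near_seg (tX x) (tX y) r01 Qi) => s /= Qs _.
have nQn : nbhs (hproj (seg (X x) (X y) r)) (~` Q).
  by apply: open_nbhs_nbhs; split=> //; apply: closed_openC; exact: polyhedron_closed.
by apply: filterS (near_seg (tX x) (tX y) r01 nQn) => s /= Qs _.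
Qed.

Lemma convex_closure_interior P Q x : ideal_polyhedron P -> closed Q -> P^° x ->
  P^° `<=` Q -> P `<=` Q.
Proof.
move=> Pp Qc Px PQ z Pz; apply: contrapT => nQz.
have tX z := X_timelike z.
have nQn : nbhs (hproj (seg (X z) (X x) 0)) (~` Q).
  by rewrite seg0 proj_X; apply: open_nbhs_nbhs; split=> //; exact: closed_openC.
have r01 : 0 <= (0 : R) <= 1 by apply/andP; split.
have /nbhs_ballP[e /= e0 he] := near_seg (tX z) (tX x) r01 nQn.
pose r := Num.min (e / 2) (1 / 2).
have r0 : 0 < r by rewrite lt_min !divr_gt0.
have r1 : r < 1 by rewrite gt_min; apply/orP; right; lra.
have re : r < e by rewrite gt_min; apply/orP; left; lra.
apply: (he r); first by rewrite /ball /= sub0r normrN gtr0_norm.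
apply: PQ; have ts : timelike (seg (X z) (X x) r) by apply: seg_timelike => //; apply/andP; split; exact: ltW.
apply/(nbhs_hat _ ts); apply: interior_mix => //.
- exact: polyhedron_convex.
- exact/interior_hat.
by apply: hatZ; [rewrite subr_gt0|apply/hat_X].
Qed.

Lemma tiling_facets_sub T T' : tiling T -> tiling T' ->
  tiling_facets T = tiling_facets T' -> T `<=` T'.
Proof.
move=> hT hT' ff P TP.
have [Pp cov] : ideal_polyhedron P /\ \bigcup_(Q in T') Q = setT.
  by case: hT hT' => h _ _ _ _ [_ ? _ _ _]; split=> //; exact: h.
have [x Px] := proj1 Pp.
have [Q TQ Qx] : (\bigcup_(Q in T') Q) x by rewrite cov.
have Qp : ideal_polyhedron Q by case: hT' => + _ _ _ _; apply.
have PQ := tile_interior_sub hT hT' TP TQ ff Px Qx.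
have Qi : Q^° x.
  apply: contrapT => nQ; have [F fF Fx] := boundary_facet Qp Qx nQ.
  by apply: (facet_avoids_interior hT TP _ Fx Px); rewrite ff; exists Q.
have QP := tile_interior_sub hT' hT TQ TP (esym ff) Qi (interior_subset Px).
suff -> : P = Q by [].
apply/seteqP; split.
  by apply: (convex_closure_interior Pp _ Px PQ); exact: polyhedron_closed.
by apply: (convex_closure_interior Qp _ Qi QP); exact: polyhedron_closed.
Qed.

Lemma tiling_facets_inj T T' : tiling T -> tiling T' ->
  tiling_facets T = tiling_facets T' -> T = T'.
Proof.
by move=> hT hT' ff; apply/seteqP; split; exact: tiling_facets_sub.
Qed.

End Tilings.

End Polyhedra.

(** * Isometries *)

Section Isometries.
Context (R : realType).
Implicit Types (u v w : vec R) (x y z : H3 R) (p q : ideal R) (A P F B : set (H3 R)).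

Lemma null_causal w o : timelike o -> lf w w = 0 -> 0 < lf w o -> causal w.
Proof.
move=> to; case: w => [[[a x] y] d]; rewrite lf.unlock /= => q h.
have q' : a * d = x ^+ 2 + y ^+ 2 by lra.
have ad : 0 <= a * d by rewrite q' addr_ge0 ?sqr_ge0.
have [[a0 d0]|[a0 d0]] : (0 <= a /\ 0 <= d) \/ (a <= 0 /\ d <= 0) by nra.
  by split=> //; rewrite lf.unlock /=; lra.
have : 0 <= lf ((- a, - x, - y, - d) : vec R) o.
  apply: lf_causal; last exact: timelike_causal.
  by split => /=; rewrite ?oppr_ge0 // lf.unlock /=; lra.
rewrite lf.unlock /=; lra.
Qed.

Lemma lf_null_gt0 p w : w <> 0 -> lf w w = 0 -> (exists2 o, timelike o & 0 < lf w o) ->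
  exists2 s, 0 < s & exists q, w = s *: nv q.
Proof. by move=> w0 ww [c ho wo]; apply: null_nv => //; exact: null_causal ho _ wo. Qed.

Lemma ideal_other p : exists q, p <> q.
Proof. by case: p => [z|]; [exists None|exists (Some 0)]. Qed.

(** Test points at a prescribed depth: the two pairings vary inversely, so [b] moves the point from
    the end [p] towards the end [q]. *)
Lemma geodesic_point p q (b : R) : p <> q -> 0 < b -> exists x,
  [/\ X x = (b * lf (nv p) (nv q))^-1 *: nv p + b *: nv q,
      lf (X x) (nv p) = b * lf (nv p) (nv q) & lf (X x) (nv q) = b^-1].
Proof.
move=> pq b0; have g0 := lf_nv_gt0 pq.
move: (g0); set g := lf _ _ => g1.
have bg : 0 < b * g by rewrite mulr_gt0.
set u := _ + _; have tu : timelike u by apply: timelike_nvD; rewrite ?invr_gt0.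
have uu : lf u u = 2.
  rewrite /u !lfE !lf_nvv (lfC (nv q)) -/g; field; rewrite !gt_eqF //.
have eX : X (hproj u) = u by rewrite X_proj // uu divff // sqrtr1 invr1 scale1r.
exists (hproj u); rewrite eX; split=> //.
  by rewrite /u !lfE lf_nvv (lfC (nv q)) -/g mulr0 add0r.
rewrite /u !lfE lf_nvv -/g mulr0 addr0; field; rewrite !gt_eqF //.
Qed.

Lemma hball_sub p q (s t : R) : 0 < s -> 0 < t ->
  hball (s *: nv p) `<=` hball (t *: nv q) -> p = q /\ t <= s.
Proof.
move=> s0 t0 h.
have pq : p = q.
  apply: contrapT => pq; have g0 := lf_nv_gt0 pq.
  have sg : 0 < s * lf (nv p) (nv q) by rewrite mulr_gt0.
  (* The first bound puts the point into the horoball at [p], the second makes its pairing with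
     [t *: nv q] at least 2. *)
  pose b := Num.min (s * lf (nv p) (nv q))^-1 (t / 2).
  have b0 : 0 < b by rewrite lt_min invr_gt0 sg divr_gt0.
  have [x [_ xp xq]] := geodesic_point pq b0.
  have : hball (t *: nv q) x.
    apply: h; rewrite /hball /= lfZr xp mulrCA -ler_pdivlMr // mul1r.
    by rewrite ge_min lexx.
  rewrite /hball /= lfZr xq ler_pdivrMr // mul1r.
  have : b <= t / 2 by rewrite ge_min lexx orbT.
  by clear pq h; lra.
split=> //; subst q; have [q pq] := ideal_other p; have g0 := lf_nv_gt0 pq.
have b0 : 0 < (s * lf (nv p) (nv q))^-1 by rewrite invr_gt0 mulr_gt0.
have [x [_ xp _]] := geodesic_point pq b0.
have xp' : lf (X x) (nv p) = s^-1 by rewrite xp; field; rewrite !gt_eqF.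
have : hball (t *: nv p) x by apply: h; rewrite /hball /= lfZr xp' divff // gt_eqF.
by rewrite /hball /= lfZr xp' ler_pdivrMr // mul1r.
Qed.

Lemma hball_inj p q (s t : R) : 0 < s -> 0 < t ->
  hball (s *: nv p) = hball (t *: nv q) -> p = q /\ s = t.
Proof.
move=> s0 t0 e; have [-> st] : p = q /\ t <= s by apply: hball_sub => //; rewrite e.
have [_ ts] : q = p /\ s <= t by apply: hball_sub => //; rewrite e.
by split=> //; apply/eqP; rewrite eq_le st ts.
Qed.

Lemma horoball_hball p q (s : R) : 0 < s -> horoball_at p (hball (s *: nv q)) <-> p = q.
Proof.
move=> s0; rewrite horoball_atP; split=> [[t t0 e]|->]; last by exists s.
by have [] := hball_inj s0 t0 e.
Qed.

Record linearizes (g : H3 R -> H3 R) (L : vec R -> vec R) : Prop := Linearizes {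
  linD : forall u v, L (u + v) = L u + L v;
  linZ : forall k u, L (k *: u) = k *: L u;
  lin_lf : forall u v, lf (L u) (L v) = lf u v;
  lin_X : forall x, L (X x) = X (g x) }.

(** Distances determine pairings, so four points with linearly independent [X] and their images have
    the same Gram matrix; the linear map so defined preserves [lf], and every further point is
    recognised by its pairings. *)
Lemma isometry_linear g : is_isometry g -> exists L, linearizes g L.
Proof.
move=> [_ hg].
have gX x y : lf (X (g x)) (X (g y)) = lf (X x) (X y) by apply/hdist_eq.
pose mk a b t (t0 : 0 < t) := @MkH3 R (a, b, t) t0.
have t2 : (0 : R) < 2 by [].
(* With [q2] and [q3], these have the vectors (1, 0, 0, 1), (2, 0, 0, 1/2), (2, 1, 0, 1), (2, 0, 1,
   1), a basis in which [c0], [c1] and the two middle entries of [u] are the coordinates. *)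
pose q0 := @mk 0 0 1 ltr01; pose q1 := @mk 0 0 2 t2.
pose q2 := @mk 1 0 1 ltr01; pose q3 := @mk 0 1 1 ltr01.
pose c1 u : R := 2 * (u.1.1.1 - u.2 - u.1.1.2 - u.1.2) / 3.
pose c0 u : R := u.1.1.1 - 2 * u.1.1.2 - 2 * u.1.2 - 2 * c1 u.
pose D (f : H3 R -> H3 R) (u : vec R) : vec R := c0 u *: X (f q0) + c1 u *: X (f q1) +
  u.1.1.2 *: X (f q2) + u.1.2 *: X (f q3).
have Did u : D id u = u.
  case: u => [[[a x] y] d]; rewrite /D /c0 /c1 /X /= !scale_vec.
  by congr (_, _, _, _) => /=; field.
have DD u v : lf (D g u) (D g v) = lf u v.
  by rewrite -[in RHS](Did u) -[in RHS](Did v) /D !lfE !gX.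
exists (D g); split=> //.
- move=> u v; rewrite /D.
  have -> : c0 (u + v) = c0 u + c0 v by rewrite /c0 /c1 /=; field.
  have -> : c1 (u + v) = c1 u + c1 v by rewrite /c1 /=; field.
  rewrite /= !scalerDl [RHS]addrACA; congr (_ + _); rewrite [RHS]addrACA; congr (_ + _).
  by rewrite [RHS]addrACA.
- move=> k u; rewrite /D.
  have -> : c0 (k *: u) = k * c0 u by rewrite /c0 /c1 /= /GRing.scale /=; field.
  have -> : c1 (k *: u) = k * c1 u by rewrite /c1 /= /GRing.scale /=; field.
  by rewrite !scalerDr !scalerA.
move=> x.
have e1 : lf (D g (X x)) (X (g x)) = 2.
  by rewrite -(lf_XX x) -[Z in _ = lf Z _](Did (X x)) /D !lfE !gX.
have e2 : lf (D g (X x)) (D g (X x)) = 2 by rewrite DD lf_XX.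
move: (D g (X x)) e1 e2 => w e1 e2.
apply/subr0_eq; apply: (@timelike_orth_eq0 _ (X (g x))); first exact: X_timelike.
  by rewrite lfBl e1 lf_XX subrr.
by rewrite !lfE e1 e2 lf_XX lfC e1; lra.
Qed.

Section Linearized.
Context (g : H3 R -> H3 R) (L : vec R -> vec R).
Hypotheses (gB : bijective g) (gL : linearizes g L).

Lemma lin0 : L 0 = 0.
Proof. by rewrite -(scale0r 0) (linZ gL) !scale0r. Qed.

Lemma lin_sum (I : Type) (r : seq I) (Q : pred I) (f : I -> vec R) :
  L (\sum_(i <- r | Q i) f i) = \sum_(i <- r | Q i) L (f i).
Proof. exact: (big_morph L (linD gL) lin0). Qed.

Lemma lin_eq0 u : L u = 0 -> u = 0.
Proof. by move=> h; apply: lf_nondegenerate => v; rewrite -(lin_lf gL) h lf0l. Qed.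

Lemma lin_inj : injective L.
Proof.
move=> u v e; apply/subr0_eq; apply: lin_eq0.
by rewrite -scaleN1r (linD gL) (linZ gL) scaleN1r e subrr.
Qed.

Lemma lin_timelike u : timelike u -> timelike (L u).
Proof.
by move=> tu; have [c c0 ->] := timelike_proj tu; rewrite (linZ gL) (lin_X gL);
  apply: timelikeZ => //; exact: X_timelike.
Qed.

Lemma lin_cone (I : finType) (n : I -> vec R) u :
  cone (fun i => L (n i)) (L u) <-> cone n u.
Proof.
have E (l : I -> R) : \sum_i l i *: L (n i) = L (\sum_i l i *: n i).
  by rewrite lin_sum; apply: eq_bigr => i _; rewrite (linZ gL).
split=> -[l l0 e]; exists l => //; last by rewrite e E.
by apply: lin_inj; rewrite e E.
Qed.

Lemma image_spanned (I : finType) (n : I -> vec R) P :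
  spanned P n -> spanned (g @` P) (fun i => L (n i)).
Proof.
move=> Pn x; split=> [[y Py <-]|h].
  by rewrite -(lin_X gL) lin_cone; apply/Pn.
have [f fK gK] := gB; exists (f x); rewrite ?gK //.
by apply/Pn/lin_cone; rewrite (lin_X gL) gK.
Qed.

Lemma image_hball n : g @` hball n = hball (L n).
Proof.
apply/seteqP; split=> x; rewrite /hball /=.
  by move=> [y hy <-]; rewrite -(lin_X gL) (lin_lf gL).
have [f fK gK] := gB; move=> hx; exists (f x); rewrite ?gK //=.
by rewrite -(lin_lf gL) (lin_X gL) gK.
Qed.

Lemma lin_ray p : exists2 s, 0 < s & exists q, L (nv p) = s *: nv q.
Proof.
apply: lf_null_gt0 => //.
- by move=> /lin_eq0; exact: nv_neq0.
- by rewrite (lin_lf gL) lf_nvv.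
exists (L (X (H3_origin R))); first by apply: lin_timelike; exact: X_timelike.
by rewrite (lin_lf gL) lfC lf_timelike_nv //; exact: X_timelike.
Qed.

(** The map induced on light rays. The factor [s] at each point is the unknown that the
    normalisation has to eliminate. *)
Definition boundary_action (phi : ideal R -> ideal R) :=
  forall p, exists2 s, 0 < s & L (nv p) = s *: nv (phi p).

Lemma boundary_action_exists : exists phi, boundary_action phi.
Proof.
have /choice[phi h] : forall p, exists q, exists2 s, 0 < s & L (nv p) = s *: nv q.
  by move=> p; have [s s0 [q e]] := lin_ray p; exists q, s.
by exists phi.
Qed.

Context (phi : ideal R -> ideal R) (Lphi : boundary_action phi).

Lemma boundary_action_inj : injective phi.
Proof.
move=> p q e; apply: contrapT => pq; have := lf_nv_gt0 pq.
rewrite -(lin_lf gL); have [s _ ->] := Lphi p; have [t _ ->] := Lphi q.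
by rewrite !lfE e lf_nvv !mulr0 ltxx.
Qed.

Lemma image_rays (I : finType) (v : I -> ideal R) (n : I -> vec R) :
  rays v n -> rays (fun i => phi (v i)) (fun i => L (n i)).
Proof.
move=> nr i; have [s s0 ->] := nr i; have [t t0 e] := Lphi (v i).
by exists (s * t); rewrite ?mulr_gt0 // (linZ gL) e scalerA.
Qed.

Lemma image_geodesic p q : g @` geodesic p q = geodesic (phi p) (phi q).
Proof.
have [->|pq] := pselect (p = q); first by rewrite !geodesic_self image_set0.
have pq' : phi p <> phi q by move=> /boundary_action_inj.
have [s s0 ep] := Lphi p; have [t t0 eq] := Lphi q.
apply/seteqP; split=> x.
  move=> [y /(geodesicP _ pq)[a [b [a0 b0 e]]] <-]; apply/(geodesicP _ pq').
  exists (a * s), (b * t); rewrite !mulr_gt0 // -(lin_X gL) e (linD gL) !(linZ gL) ep eq.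
  by rewrite !scalerA.
move=> /(geodesicP _ pq')[a [b [a0 b0 e]]].
have [f fK gK] := gB; exists (f x); rewrite ?gK //; apply/(geodesicP _ pq).
exists (a / s), (b / t); rewrite !divr_gt0 //; split=> //; apply: lin_inj.
rewrite (lin_X gL) gK e (linD gL) !(linZ gL) ep eq !scalerA !divfK //; exact: lt0r_neq0.
Qed.

Lemma image_hull (I : finType) (v : I -> ideal R) : injective v ->
  g @` ideal_hull (range v) = ideal_hull (range (fun i => phi (v i))).
Proof.
move=> vI; have nr := rays_nv v.
have h1 := image_spanned (hull_spanned nr vI erefl).
have vI' : injective (fun i => phi (v i)) by move=> i j /boundary_action_inj /vI.
have h2 := hull_spanned (image_rays nr) vI' erefl.
by apply/predeqP => x; rewrite (h1 x) (h2 x).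
Qed.

Lemma maps_ideal_phi p q : maps_ideal g p q <-> phi p = q.
Proof.
have [s s0 ep] := Lphi p.
split=> [h|<- B /horoball_atP[t t0 ->]]; last first.
  by rewrite image_hball (linZ gL) ep scalerA; apply/horoball_hball => //; exact: mulr_gt0.
have : horoball_at p (hball (1 *: nv p)) by apply/horoball_hball.
move=> /h; rewrite image_hball scale1r ep => /horoball_atP[t t0 e].
by have [] := hball_inj s0 t0 e.
Qed.

End Linearized.

End Isometries.

(** * Normalised vertex vectors of regular tiles *)

Section Frames.
Context (R : realType).
Implicit Types (u v w : vec R) (x y z : H3 R) (p q : ideal R) (A P F B : set (H3 R)).

Lemma orthogonal_basis_eq0 (e : 'I_4 -> vec R) w :
  (forall i j, i != j -> lf (e i) (e j) = 0) -> (forall i, lf (e i) (e i) != 0) ->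
  (forall i, lf w (e i) = 0) -> w = 0.
Proof.
move=> e0 e1 we.
pose co u (j : 'I_4) : R := nth 0 [:: u.1.1.1; u.1.1.2; u.1.2; u.2] j.
(* Coordinates of the functional [lf _ u]: the pairing becomes a matrix product, and the Gram matrix
   of the [e i] is diagonal and invertible. *)
pose cd u (j : 'I_4) : R := nth 0 [:: u.2; - 2 * u.1.1.2; - 2 * u.1.2; u.1.1.1] j.
have lfco u v : lf u v = \sum_j co u j * cd v j.
  by rewrite !big_ord_recl big_ord0 /co /cd lf.unlock /=; ring.
pose E : 'M[R]_4 := \matrix_(i, j) co (e i) j.
pose E' : 'M[R]_4 := \matrix_(i, j) cd (e j) i.
have EE : E *m E' = diag_mx (\row_i lf (e i) (e i)).
  apply/matrixP => i j; rewrite !mxE.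
  under eq_bigr do rewrite !mxE.
  by rewrite -lfco; case: eqVneq => [->|/e0 ->]; rewrite ?mulr1n ?mulr0n.
have uE' : E' \in unitmx.
  have : E *m E' \in unitmx.
    rewrite EE unitmxE det_diag unitfE; apply/prodf_neq0 => i _.
    by rewrite !mxE.
  by rewrite unitmx_mul => /andP[].
have wE : (\row_j co w j) *m E' = 0.
  apply/rowP => j; rewrite !mxE; under eq_bigr do rewrite !mxE.
  by rewrite -lfco we.
have w0 : \row_j co w j = 0.
  by rewrite -[LHS]mulmx1 -(mulmxV uE') mulmxA wE mul0mx.
have h j : co w j = 0 by move/rowP: w0 => /(_ j); rewrite !mxE.
move: (h (@Ordinal 4 0 isT)) (h (@Ordinal 4 1 isT)) (h (@Ordinal 4 2 isT)) (h (@Ordinal 4 3 isT)).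
by case: w {we wE w0 h} => [[[a x] y] d]; rewrite /co /= => -> -> -> ->.
Qed.

(** A vertex of a tetrahedron sees three pairings 1; one of an octahedron sees four pairings 1 and,
    at the opposite vertex, the pairing 2. *)
Definition vertex_product (m : nat) : R := if m == 4%N then 1 else 2.

(* [tf_prod] is what fixes the scale of [n].  [tf_tri] says that a face is the
   whole tile or lies in an ideal triangle, [S] being the support of one of its
   points. *)
Record tile_frame (I : finType) (P : set (H3 R)) (v : I -> ideal R) (n : I -> vec R)
    (c : vec R) : Prop := TileFrame {
  tf_inj : injective v;
  tf_hull : P = ideal_hull (range v);
  tf_rays : rays v n;
  tf_ge1 : forall i j, i != j -> 1 <= lf (n i) (n j);
  tf_center : forall i, lf c (n i) = 1;
  tf_comb : exists2 k : R, 0 <= k & c = \sum_i k *: n i;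
  tf_cc : 1 <= lf c c;
  tf_card : #|I| = 4%N \/ #|I| = 6%N;
  tf_prod : forall i, \prod_(j | j != i) lf (n i) (n j) = vertex_product #|I|;
  tf_tri : forall S : {set I},
    (exists i j k, [/\ lf (n i) (n j) = 1, lf (n j) (n k) = 1, lf (n i) (n k) = 1
       & S \subset finset.setU (finset.setU (finset.set1 i) (finset.set1 j)) (finset.set1 k)]) \/
    (exists l m : I -> R, [/\ forall i, 0 <= l i, forall i, 0 < l i -> i \in S,
       forall i, 0 < m i & \sum_i l i *: n i = \sum_i m i *: n i]);
  tf_wedge : forall i j, lf (n i) (n j) = 1 -> exists k l,
    [/\ k != i, k != j, l != i, l != j &
        forall a b d e : R, a *: n i + b *: n j + d *: n k + e *: n l = 0 -> d = 0 /\ e = 0] }.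

Lemma pair_complement (I : finType) (i j : I) : (#|I| = 4)%N -> i != j ->
  exists k l, [/\ k != i, k != j, l != i, l != j & k != l].
Proof.
move=> I4 ij; have : #|~: [set i; j]%SET| == 2%N.
  by rewrite -(eqn_add2l #|[set i; j]%SET|) cardsC I4 cards2 ij.
move=> /cards2P[k [l [kl e]]].
have : k \in ~: [set i; j]%SET by rewrite e !inE eqxx.
have : l \in ~: [set i; j]%SET by rewrite e !inE eqxx orbT.
rewrite !inE !negb_or => /andP[? ?] /andP[? ?].
by exists k, l.
Qed.

(** Each vertex pairs to 1 with three others, whence the factor [3^-1] in the centre; then [lf c c]
    is 4/3. *)
Lemma tetrahedron_frame P (v : 'I_4 -> ideal R) (n : 'I_4 -> vec R) :
  injective v -> P = ideal_hull (range v) -> rays v n ->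
  (forall i j, i != j -> lf (n i) (n j) = 1) ->
  tile_frame P v n (\sum_i 3^-1 *: n i).
Proof.
move=> vI PV nr n1; have n0 := rays_null nr.
have hc i : lf (\sum_i 3^-1 *: n i) (n i) = 1.
  rewrite lf_suml (bigD1 i) //= lfZl n0 mulr0 add0r.
  rewrite (eq_bigr (fun=> 3^-1)) => [|j ji]; last by rewrite lfZl n1 // mulr1.
  by rewrite sumr_const cardC1 card_ord -mulr_natl /=; lra.
split=> //.
- by move=> i j /n1 ->.
- by exists 3^-1.
- rewrite lf_sumr.
  under eq_bigr do rewrite lfZr hc mulr1.
  by rewrite sumr_const card_ord -mulr_natl; lra.
- by left; rewrite card_ord.
- move=> i; rewrite card_ord /vertex_product /= big1 // => j ji.
  by rewrite n1 // eq_sym.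
- move=> S; have [->|/eqP] := pselect (S = [set: 'I_4]%SET).
    by right; exists (fun=> 1), (fun=> 1); split.
  rewrite -finset.subTset => /subsetPn[l _ lS]; left.
  exists (lift l (@Ordinal 3 0 isT)), (lift l (@Ordinal 3 1 isT)), (lift l (@Ordinal 3 2 isT)).
  split; try by rewrite n1 // (inj_eq lift_inj).
  apply/fintype.subsetP => x xS; rewrite !inE.
  have xl : l != x by apply: contraNneq lS => ->.
  have [j -> _] := unlift_some xl.
  by rewrite !(inj_eq lift_inj); case: j => [[|[|[|]]]].
- move=> i j; have [->|ij] := eqVneq i j; first by rewrite n0 => /eqP; rewrite eq_sym oner_eq0.
  have [k [l [ki kj li lj kl]]] := pair_complement (card_ord 4) ij.
  move=> _; exists k, l; split=> // a b d e h.
  have ij' := ij; rewrite eq_sym in ij'.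
  have lk := kl; rewrite eq_sym in lk.
  (* The Gram matrix has 0 on the diagonal and 1 elsewhere, hence is nonsingular. *)
  have h1 := congr1 (fun w => lf w (n i)) h; have h2 := congr1 (fun w => lf w (n j)) h.
  have h3 := congr1 (fun w => lf w (n k)) h; have h4 := congr1 (fun w => lf w (n l)) h.
  rewrite /= !lfE !n0 !n1 // in h1 h2 h3 h4; try by rewrite eq_sym.
  by clear -h1 h2 h3 h4; split; lra.
Qed.

Section Octahedron.
Let wedge_arith (A B C E : R) :
  A * 0 + B * 1 + C * 1 + E * 1 = 0 -> A * 1 + B * 0 + C * 1 + E * 1 = 0 ->
  A * 1 + B * 1 + C * 0 + E * 2 = 0 -> A * 1 + B * 1 + C * 2 + E * 0 = 0 ->
  C = 0 /\ E = 0.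
Proof. by move=> *; split; lra. Qed.

Context (P : set (H3 R)) (v : 'I_3 * bool -> ideal R) (n : 'I_3 * bool -> vec R).
Hypotheses (vI : injective v) (PV : P = ideal_hull (range v)) (nr : rays v n).
Hypothesis n1 : forall i a j b, i != j -> lf (n (i, a)) (n (j, b)) = 1.

Let n0 := rays_null nr.

Lemma ord3_third (i j : 'I_3) : exists k : 'I_3, k != i /\ k != j.
Proof.
by case: i => [[|[|[|//]]] hi]; case: j => [[|[|[|//]]] hj];
  (try by exists (@Ordinal 3 0 isT)); (try by exists (@Ordinal 3 1 isT)); exists (@Ordinal 3 2 isT).
Qed.

Let D (i : 'I_3) := n (i, true) - n (i, false).
Let S (i : 'I_3) := n (i, true) + n (i, false).

Let DD i j : i != j -> lf (D i) (D j) = 0.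
Proof. by move=> ij; rewrite /D !lfE !n1 //; lra. Qed.

Let DS i j : lf (D i) (S j) = 0.
Proof.
rewrite /D /S; have [->|ij] := eqVneq i j; rewrite !lfE.
  by rewrite !n0 (lfC (n (j, false))); lra.
by rewrite !n1 //; lra.
Qed.

Let SS i j : i != j -> lf (S i) (S j) = 4.
Proof. by move=> ij; rewrite /S !lfE !n1 //; lra. Qed.

Let opp_gt0 i : 0 < lf (n (i, true)) (n (i, false)).
Proof. by apply: (rays_gt0 nr) => /vI. Qed.

Let DDi i : lf (D i) (D i) = - 2 * lf (n (i, true)) (n (i, false)).
Proof. by rewrite /D !lfE !n0 (lfC (n (i, false))); lra. Qed.

Let SSi i : lf (S i) (S i) = 2 * lf (n (i, true)) (n (i, false)).
Proof. by rewrite /S !lfE !n0 (lfC (n (i, false))); lra. Qed.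

(* The three differences of opposite vertices and one sum form an orthogonal
   basis, so the diagonals of an octahedron with equal edges all cross at its
   centre. *)
Lemma octahedron_diagonals i j :
  n (i, true) + n (i, false) = n (j, true) + n (j, false).
Proof.
have [->//|ij] := eqVneq i j; have [k [ki kj]] := ord3_third i j.
pose o0 := @Ordinal 3 0 isT; pose o1 := @Ordinal 3 1 isT; pose o2 := @Ordinal 3 2 isT.
apply/subr0_eq; rewrite -/(S i) -/(S j).
apply: (@orthogonal_basis_eq0 (fun a : 'I_4 => nth 0 [:: D o0; D o1; D o2; S k] a)).
- by move=> [[|[|[|[|//]]]] ha]; move=> [[|[|[|[|//]]]] hb] //= _; rewrite ?DD ?DS // lfC DS.
- have N l : lf (D l) (D l) != 0 by rewrite DDi mulNr oppr_eq0 mulf_neq0 // gt_eqF.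
  have N' : lf (S k) (S k) != 0 by rewrite SSi mulf_neq0 // gt_eqF.
  by move=> [[|[|[|[|//]]]] ha]; [exact: N|exact: N|exact: N|exact: N'].
have Sk : lf (S i - S j) (S k) = 0.
  by rewrite lfBl !SS ?subrr // eq_sym.
have SD l : lf (S i - S j) (D l) = 0 by rewrite lfBl !(lfC _ (D l)) !DS subrr.
by move=> [[|[|[|[|//]]]] ha]; [exact: SD|exact: SD|exact: SD|exact: Sk].
Qed.

(** All [S i] are one vector, so its norm, twice the wanted pairing, equals the pairing 4 of two of
    them. *)
Lemma octahedron_opposite i : lf (n (i, true)) (n (i, false)) = 2.
Proof.
have [j [ji _]] := ord3_third i i.
have := SSi i; rewrite {2}/S (octahedron_diagonals i j) -/(S j) SS; first by lra.
by rewrite eq_sym.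
Qed.

Lemma octahedron_lf i a j b :
  lf (n (i, a)) (n (j, b)) = if i == j then (if a == b then 0 else 2) else 1.
Proof.
case: eqVneq => [->|/n1 //]; case: eqVneq => [->|]; first exact: n0.
by case: a; case: b => //= _; rewrite ?octahedron_opposite // lfC octahedron_opposite.
Qed.

(** Each vertex pairs to 1 with four others and to 2 with its opposite, whence the factor [6^-1];
    here [lf c c] is exactly 1. *)
Lemma octahedron_frame : tile_frame P v n (\sum_i 6^-1 *: n i).
Proof.
pose o0 := @Ordinal 3 0 isT; pose o1 := @Ordinal 3 1 isT; pose o2 := @Ordinal 3 2 isT.
have card6 : #|{: 'I_3 * bool}| = 6%N by rewrite card_prod card_ord card_bool.
have sumE (V : zmodType) (F : 'I_3 * bool -> V) : \sum_i F i =
    F (o0, true) + F (o0, false) + (F (o1, true) + F (o1, false)) + (F (o2, true) + F (o2, false)).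
  rewrite (eq_bigr (fun i => F (i.1, i.2))); last by case.
  rewrite -(pair_bigA _ (fun i b => F (i, b))) /= !big_ord_recl big_ord0 addr0 !big_bool /=.
  rewrite addrA; congr (_ + _ + (_ + _) + (_ + _)); congr (F (_, _)); exact: val_inj.
have hc i : lf (\sum_i 6^-1 *: n i) (n i) = 1.
  rewrite lf_suml sumE; case: i => i b; rewrite !lfZl !octahedron_lf.
  case: i => [[|[|[|//]]] hi]; case: b => /=; lra.
have opp_i (i : 'I_3 * bool) : (i.1, ~~ i.2) != i by case: i => i []; rewrite xpair_eqE eqxx.
split=> //.
- move=> [i a] [j b]; rewrite octahedron_lf; have [->|_ _] := eqVneq i j; last exact: lexx.
  by have [->|_ _] := eqVneq a b; [rewrite eqxx|lra].
- by exists 6^-1.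
- rewrite lf_sumr; under eq_bigr do rewrite lfZr hc mulr1.
  by rewrite sumr_const card6 -mulr_natl; lra.
- by right.
- move=> i; rewrite card6 /vertex_product /= (bigD1 (i.1, ~~ i.2)) //= big1.
    by case: i => i []; rewrite octahedron_lf eqxx mulr1.
  move=> [j b] /andP[]; case: i => i a /=; rewrite octahedron_lf.
  have [->|//] := eqVneq i j; rewrite !xpair_eqE eqxx /=; by case: a; case: b.
- move=> A.
  have [[i /andP[iA iA']]|h] := pselect (exists i, ((i, true) \in A) && ((i, false) \in A)).
    (* A set containing an opposite pair supports the sum of the pair, which is a third of the sum
       of all six vertices. *)
    right; exists (fun j => (j.1 == i)%:R), (fun=> 3^-1); split=> //.
    + by move=> [j b] /=; rewrite ltr0n lt0b => /eqP ->; case: b.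
    have T k (a : R) : a *: n (k, true) + a *: n (k, false) = a *: (n (i, true) + n (i, false)).
      by rewrite -scalerDr (octahedron_diagonals k i).
    rewrite !sumE !T -!scalerDl; congr (_ *: _).
    by case: i {iA iA' T} => [[|[|[|//]]] hi] /=; lra.
  (* Otherwise the set takes at most one vertex from each opposite pair, and so lies in a
     triangle. *)
  left; pose s i := (i, (i, true) \in A); exists (s o0), (s o1), (s o2).
  split; try by rewrite n1.
  apply/fintype.subsetP => -[i b] iA.
  have -> : (i, b) = s i.
    rewrite /s; congr pair; case: b iA => [->//|iA]; apply/esym/negbTE/negP => iA'.
    by apply: h; exists i; rewrite iA iA'.
  rewrite !inE; case: i {iA} => [[|[|[|//]]] hi]; apply/orP.
  + by left; apply/orP; left; apply/eqP; congr s; exact: val_inj.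
  + by left; apply/orP; right; apply/eqP; congr s; exact: val_inj.
  + by right; apply/eqP; congr s; exact: val_inj.
move=> [i a] [j b]; rewrite octahedron_lf; case: eqVneq => [->|ij _].
  by case: eqVneq => _ /eqP; [rewrite eq_sym oner_eq0|rewrite (eqr_nat R 2 1)].
have [k [ki kj]] := ord3_third i j.
exists (k, true), (k, false); split; try by rewrite xpair_eqE (negPf ki) // (negPf kj).
- by rewrite xpair_eqE (negPf kj).
- by rewrite xpair_eqE (negPf kj).
have ik := ki; have jk := kj; have ji := ij; rewrite eq_sym in ik; rewrite eq_sym in jk; rewrite eq_sym in ji.
move=> A B C E h.
have h1 := congr1 (fun w => lf w (n (i, a))) h; have h2 := congr1 (fun w => lf w (n (j, b))) h.
have h3 := congr1 (fun w => lf w (n (k, true))) h; have h4 := congr1 (fun w => lf w (n (k, false))) h.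
rewrite /= !lfE !octahedron_lf !eqxx (negPf ki) (negPf kj) (negPf ik) (negPf jk)
  (negPf ij) (negPf ji) /= in h1 h2 h3 h4.
exact: wedge_arith h1 h2 h3 h4.
Qed.

End Octahedron.

End Frames.

(** * Isometries and faces of hulls, flags of an ideal simplex *)

Section RawTiles.
Context (R : realType).
Implicit Types (u v w : vec R) (x y z : H3 R) (p q : ideal R) (A P F B : set (H3 R)).

Lemma hull_vertex (I J : finType) (v : I -> ideal R) (w : J -> ideal R) i :
  injective v -> injective w -> ideal_hull (range v) !=set0 ->
  ideal_hull (range v) = ideal_hull (range w) -> exists j, w j = v i.
Proof.
move=> vI wI v0 e; apply/(ideal_vertexP (v i) wI e v0).
by apply/(ideal_vertexP (v i) vI erefl v0); exists i.
Qed.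

(** Two points as a family over [bool]: a geodesic becomes an ideal hull and inherits the results on
    vertices and faces. *)
Definition pairv (T : Type) (p q : T) (b : bool) := if b then p else q.

Lemma pairv_inj (T : Type) (p q : T) : p <> q -> injective (pairv p q).
Proof. by move=> pq [] [] //= e; case: pq. Qed.

Lemma geodesic_nonempty p q : p <> q -> geodesic p q !=set0.
Proof.
move=> pq; have [|x [h _ _]] := geodesic_point pq (b := 1); first exact: ltr01.
exists x; apply/(geodesicP _ pq); exists (1 * lf (nv p) (nv q))^-1, 1; split=> //.
by rewrite invr_gt0 mul1r lf_nv_gt0.
Qed.

Lemma geodesic_hull p q : p <> q -> geodesic p q = ideal_hull (range (pairv p q)).
Proof.
move=> pq; apply/seteqP; split=> x.
  by move=> gx C [_]; apply; exists p, q; split=> //; [exists true|exists false].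
move/(ideal_hullP x (pairv_inj pq)) => [l l0]; rewrite big_bool /= => e.
have h a : 0 < l a.
  rewrite lt_neqAle l0 andbT; apply/eqP => la; have [_] := X_timelike x.
  rewrite e !lfE !lf_nvv (lfC (nv q)) => h.
  by case: a la => la; rewrite -la !(mul0r, mulr0, add0r, addr0) ltxx in h.
by apply/(geodesicP _ pq); exists (l true), (l false).
Qed.

Lemma geodesic_inj p q r : p <> q -> p <> r -> geodesic p q = geodesic p r -> q = r.
Proof.
move=> pq pr e.
have [||||[] /= h] // := @hull_vertex _ _ (pairv p q) (pairv p r) false.
- exact: pairv_inj.
- exact: pairv_inj.
- by rewrite -geodesic_hull //; exact: geodesic_nonempty.
- by rewrite -!geodesic_hull.
Qed.

Lemma sub_hull (I J : finType) (v : I -> ideal R) (f : J -> I) : injective v -> injective f ->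
  ideal_hull (range (v \o f)) `<=` ideal_hull (range v).
Proof.
move=> vI fI x /(ideal_hullP x (inj_comp vI fI))[l l0 e].
apply/(ideal_hullP x vI); rewrite e.
apply: (big_ind (cone (fun i => nv (v i)))); [|exact: coneD|move=> j _].
  by exists (fun=> 0) => //; rewrite big1 // => i _; rewrite scale0r.
by apply: coneZ => //; exact: (cone_gen (fun i => nv (v i))).
Qed.

Lemma geodesic_sub_hull (I : finType) (v : I -> ideal R) i j : injective v -> i != j ->
  geodesic (v i) (v j) `<=` ideal_hull (range v).
Proof.
move=> vI /eqP ij x; have vij : v i <> v j by move=> /vI.
by move=> gx C [_]; apply; exists (v i), (v j); split.
Qed.

Lemma face_setI P F F' : face P F -> face P F' -> face P (F `&` F').
Proof.
move=> [FP Fc h] [FP' Fc' h']; split.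
- by move=> x [/FP].
- by move=> x y z [Fx Fx'] [Fy Fy'] b; split; [exact: (Fc x y)|exact: (Fc' x y)].
move=> x y z Px Py b zx zy [Fz Fz'].
by have [? ?] := h _ _ _ Px Py b zx zy Fz; have [? ?] := h' _ _ _ Px Py b zx zy Fz'.
Qed.

Lemma isometry_inverse (g f : H3 R -> H3 R) :
  is_isometry g -> cancel g f -> cancel f g -> is_isometry f.
Proof.
move=> [_ hg] gK fK; split; first by exists g.
by move=> p q; rewrite -hg !fK.
Qed.

Lemma isometry_between (g : H3 R -> H3 R) x y z :
  is_isometry g -> between (g x) (g y) (g z) <-> between x y z.
Proof. by move=> [_ hg]; rewrite /between !hg. Qed.

Lemma image_face (g : H3 R -> H3 R) P F : is_isometry g -> face P F -> face (g @` P) (g @` F).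
Proof.
move=> gi [FP Fc h]; have [[f gK fK] _] := gi; split.
- exact: image_subset.
- move=> _ _ z [x Fx <-] [y Fy <-]; rewrite -(fK z) isometry_between // => b.
  by exists (f z); rewrite ?fK //; exact: Fc b.
move=> _ _ z [x Px <-] [y Py <-]; rewrite -(fK z) isometry_between // => b zx zy [w Fw].
move=> /(can_inj gK) ?; subst w.
have [||Fx Fy] := h _ _ _ Px Py b _ _ Fw.
- by move=> e; apply: zx; rewrite e.
- by move=> e; apply: zy; rewrite e.
by split; [exists x|exists y].
Qed.

Lemma image_can (g f : H3 R -> H3 R) A : cancel f g -> g @` (f @` A) = A.
Proof.
move=> fK; apply/seteqP; split=> [_ [_ [x Ax <-] <-]|x Ax]; first by rewrite fK.
by exists (f x); [exists x|rewrite fK].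
Qed.

Lemma image_facet (g : H3 R -> H3 R) P F : is_isometry g -> facet P F ->
  facet (g @` P) (g @` F).
Proof.
move=> gi [fF FP Fmax]; have [[f gK fK] _] := gi.
have fi := isometry_inverse gi gK fK.
split; first exact: image_face.
  by move=> e; apply: FP; rewrite -(image_can F gK) e image_can.
move=> F' fF' F'P FF'; rewrite -(image_can F' fK); congr image; apply: Fmax.
- by rewrite -(image_can P gK); exact: image_face.
- by move=> e; apply: F'P; rewrite -e image_can.
by rewrite -(image_can F gK); exact: image_subset.
Qed.

Lemma symmetry_vertices (I : finType) (v : I -> ideal R) P g : injective v ->
  P = ideal_hull (range v) -> P !=set0 -> symmetries P g ->
  exists L phi, [/\ linearizes g L, boundary_action L phi & forall i, exists j, phi (v i) = v j].
Proof.
move=> vI PV P0 [gi gP]; have [L gL] := isometry_linear gi; have [gB _] := gi.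
have [phi Lphi] := boundary_action_exists gL.
exists L, phi; split=> // i.
have vI' : injective (fun i => phi (v i)) by move=> a b /(boundary_action_inj gL Lphi) /vI.
have e : ideal_hull (range (fun i => phi (v i))) = ideal_hull (range v).
  by rewrite -(image_hull gB gL Lphi vI) -PV gP.
have e0 : ideal_hull (range (fun i => phi (v i))) !=set0 by rewrite e -PV.
by have [j <-] := hull_vertex i vI' vI e0 e; exists j.
Qed.

Lemma regular_transitive (I : finType) (v : I -> ideal R) P : regular P ->
  (forall i, exists e F, flag P (v i) e F) ->
  forall i j, exists2 g, symmetries P g & maps_ideal g (v i) (v j).
Proof.
move=> rP h i j; have [e [F fi]] := h i; have [e' [F' fj]] := h j.
by have [g [g1 g2 _ _]] := rP _ _ _ _ _ _ fi fj; exists g.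
Qed.

Lemma sum_supported (V : nmodType) (J I : finType) (f : J -> I) (G : I -> V) : injective f ->
  (forall i, i \notin codom f -> G i = 0) -> \sum_i G i = \sum_j G (f j).
Proof.
move=> fI h; rewrite (bigID (mem (codom f))) /= [X in _ + X]big1 ?addr0 //.
have U : uniq (codom f) by rewrite codomE map_inj_uniq ?enum_uniq.
by rewrite -(big_uniq _ U) codomE big_map big_enum.
Qed.

Lemma cone_subfamily (I J : finType) (n : I -> vec R) (f : J -> I) u : injective f ->
  cone (fun j => n (f j)) u <-> exists l : I -> R,
    [/\ forall i, 0 <= l i, forall i, i \notin codom f -> l i = 0 & u = \sum_i l i *: n i].
Proof.
move=> fI; split=> [[l l0 ->]|[l [l0 lf ->]]]; last first.
  exists (l \o f) => [j|]; first exact: l0.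
  by apply: sum_supported => // i /lf ->; rewrite scale0r.
exists (fun i => \sum_(j | f j == i) l j); split.
- by move=> i; apply: sumr_ge0.
- move=> i iN; apply: big1 => j /eqP fj; case/negP: iN.
  by rewrite -fj codom_f.
have E j : \sum_(k | f k == f j) l k = l j.
  rewrite (bigD1 j) //= big1 ?addr0 // => k /andP[/eqP/fI -> ]; by rewrite eqxx.
rewrite (sum_supported fI) => [|i iN].
  by apply: eq_bigr => j _; rewrite E.
rewrite big1 ?scale0r // => j /eqP fj; case/negP: iN; by rewrite -fj codom_f.
Qed.

Section Simplex.
Context (P : set (H3 R)) (v : 'I_4 -> ideal R).
Hypotheses (vI : injective v) (PV : P = ideal_hull (range v)) (P0 : P^° !=set0).
Let m i := nv (v i).
Let Pm : spanned P m := hull_spanned (rays_nv v) vI PV.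

(** Around an interior point one can move in every coordinate direction inside the cone, so the four
    [m i] span a space of dimension four and their coordinate matrix is invertible. *)
Lemma simplex_free (a : 'I_4 -> R) : \sum_i a i *: m i = 0 -> forall i, a i = 0.
Proof.
move=> ha.
pose co (u : vec R) (j : 'I_4) : R := nth 0 [:: u.1.1.1; u.1.1.2; u.1.2; u.2] j.
have coD u w j : co (u + w) j = co u j + co w j.
  by case: j => [[|[|[|[|//]]]]].
have coZ (k : R) u j : co (k *: u) j = k * co u j.
  by case: j => [[|[|[|[|//]]]]].
have co0 j : co 0 j = 0 by case: j => [[|[|[|[|//]]]]].
have co_sum (b : 'I_4 -> R) j : co (\sum_i b i *: m i) j = \sum_i b i * co (m i) j.
  rewrite (big_morph (fun u => co u j) (fun u w => coD u w j) (co0 j)); apply: eq_bigr => i _; exact: coZ.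
pose e (j : 'I_4) : vec R := ((j == 0%N :> nat)%:R, (j == 1%N :> nat)%:R, (j == 2%N :> nat)%:R, (j == 3%N :> nat)%:R).
have coe i j : co (e i) j = (i == j)%:R.
  by case: j => [[|[|[|[|//]]]]] ?; case: i => [[|[|[|[|//]]]]] ?.
have [y /interior_hat hy] := P0.
have /choice[M hM] : forall j, exists b : 'I_4 -> R, e j = \sum_i b i *: m i.
  move=> j; have [r r0 hr] := nbhs_line (e j) hy.
  have r2 : 0 < r / 2 by rewrite divr_gt0.
  have /(hat_spanned Pm)[_ [l _ el]] : hat P (X y + (r / 2) *: e j).
    by apply: hr; rewrite gtr0_norm //; lra.
  have /(hat_spanned Pm)[_ [k _ ek]] := nbhs_singleton hy.
  exists (fun i => (r / 2)^-1 * (l i - k i)).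
  apply: (scalerI (lt0r_neq0 r2)); rewrite scaler_sumr.
  under eq_bigr do rewrite scalerA mulrA mulfV ?lt0r_neq0 // mul1r scalerBl.
  by rewrite sumrB -el -ek addrC addKr.
pose MM : 'M[R]_4 := \matrix_(j, i) M j i; pose N : 'M[R]_4 := \matrix_(i, k) co (m i) k.
have MN : MM *m N = 1%:M.
  apply/matrixP => j k; rewrite !mxE; under eq_bigr do rewrite !mxE.
  by rewrite -co_sum -hM coe.
have aN : (\row_i a i) *m N = 0.
  apply/rowP => k; rewrite !mxE; under eq_bigr do rewrite !mxE.
  by rewrite -co_sum ha co0.
have a0 : \row_i a i = 0 by rewrite -[LHS]mulmx1 -(mulmx1C MN) mulmxA aN mul0mx.
by move=> i; move/rowP: a0 => /(_ i); rewrite !mxE.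
Qed.

Lemma simplex_coef (a b : 'I_4 -> R) :
  \sum_i a i *: m i = \sum_i b i *: m i -> a =1 b.
Proof.
move=> e i; apply/subr0_eq; apply: (simplex_free (a := fun i => a i - b i)).
under eq_bigr do rewrite scalerBl.
by rewrite sumrB e subrr.
Qed.

Lemma simplex_face (J : finType) (f : J -> 'I_4) : injective f ->
  face P (ideal_hull (range (fun j => v (f j)))).
Proof.
move=> fI; have vfI : injective (fun j => v (f j)) by move=> a b /vI /fI.
have nr := rays_nv (fun j => v (f j)).
have Fm := hull_spanned nr vfI erefl.
apply/faceP; split.
- by rewrite PV; exact: (sub_hull vI fI).
- exact: (proj1 (hconvexP _) (spanned_convex Fm)).
move=> u w /(hat_spanned Pm)[tu [l l0 eu]] /(hat_spanned Pm)[tw [k k0 ew]].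
move=> /(hat_spanned Fm)[_ /(@cone_subfamily _ _ m _ _ fI)[h [h0 hf]]] euw.
apply/(hat_spanned Fm); split=> //; apply/(@cone_subfamily _ _ m) => //.
exists l; split=> // i /hf hi.
have := @simplex_coef (fun i => l i + k i) h _ i.
rewrite hi => /(_ _)/wrap[].
  by rewrite -euw eu ew -big_split; apply: eq_bigr => j _; rewrite scalerDl.
by have := l0 i; have := k0 i; lra.
Qed.

Definition simplex_facet (l : 'I_4) := ideal_hull (range (fun i : 'I_3 => v (lift l i))).

Lemma lift_codom (l i : 'I_4) : (i \notin codom (lift l)) = (i == l).
Proof.
apply/idP/eqP => [|->].
  apply: contraNeq => il; have il' : l != i by rewrite eq_sym.
  by have [j -> _] := unlift_some il'; rewrite codom_f.
by apply/codomP => -[j /eqP]; rewrite (negPf (neq_lift _ _)).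
Qed.

Lemma simplex_facetP l x : simplex_facet l x <-> exists a : 'I_4 -> R,
  [/\ forall i, 0 <= a i, a l = 0 & X x = \sum_i a i *: m i].
Proof.
have vfI : injective (fun j => v (lift l j)) by move=> a b /vI /lift_inj.
rewrite /simplex_facet ideal_hullP // (@cone_subfamily _ _ m _ _ lift_inj).
split=> -[a [a0 al e]]; exists a; split=> //.
  by apply: al; rewrite lift_codom.
by move=> i; rewrite lift_codom => /eqP ->.
Qed.

(** A face that contains the triangle opposite to [l] and also a point with positive weight at [l]
    contains the sum of that point and one with full support on the triangle, hence is
    everything. *)
Lemma facet_simplex l : facet P (simplex_facet l).
Proof.
have fF : face P (simplex_facet l) by apply: simplex_face; exact: lift_inj.
have ts (a : 'I_4 -> R) i j : i != j -> 0 < a i -> 0 < a j -> (forall i, 0 <= a i) ->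
    timelike (\sum_i a i *: m i).
  move=> ij ai aj a0; have ji := ij; rewrite eq_sym in ji.
  rewrite (bigD1 i) //= (bigD1 j) //= addrA; apply: timelikeDcausal.
    by apply: (timelike_pair (rays_nv v)) => // /vI /eqP; rewrite (negPf ij).
  by apply: causal_sum => k _; apply: causalZ => //; exact: nv_causal.
have [i [j [il jl _ _ ij]]] : exists i j, [/\ i != l, j != l, i != l, j != l & i != j].
  have ll : l != lift l ord0 by exact: neq_lift.
  have [i [j [h1 _ h2 _ h3]]] := pair_complement (card_ord 4) ll.
  by exists i, j.
split=> //.
  move=> e; pose a (i : 'I_4) : R := 1.
  have t := ts a i j ij ltr01 ltr01 (fun=> ler01).
  have [c c0 ec] := timelike_proj t.
  have : simplex_facet l (hproj (\sum_i a i *: m i)).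
    rewrite e; have [] // : hat P (\sum_i a i *: m i).
    by apply/(hat_spanned Pm); split=> //; exists a => // k; exact: ler01.
  move=> /simplex_facetP[b [b0 bl eb]].
  have := @simplex_coef a (fun i => c * b i) _ l.
  rewrite bl mulr0 => /(_ _)/wrap[|/eqP]; last by rewrite oner_eq0.
  by rewrite {1}ec eb scaler_sumr; apply: eq_bigr => k _; rewrite scalerA.
move=> F' fF' F'P FF'; apply/seteqP; split=> // x F'x.
have Px : P x by case: fF' => + _ _; apply.
have [a a0 ea] := proj1 (Pm x) Px; apply/simplex_facetP; exists a; split=> //.
apply: contrapT => /eqP al; apply: F'P.
pose b (i : 'I_4) : R := if i == l then 0 else 1.
have b0 k : 0 <= b k by rewrite /b; case: eqP.
have tb : timelike (\sum_i b i *: m i).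
  by apply: (ts b i j ij) => //; rewrite /b ?(negPf il) ?(negPf jl).
have hb : hat F' (\sum_i b i *: m i).
  split=> //; apply: FF'; apply/simplex_facetP; have [c c0 ec] := timelike_proj tb.
  exists (fun i => c^-1 * b i); split.
  - by move=> k; rewrite mulr_ge0 // invr_ge0 ltW.
  - by rewrite /b eqxx mulr0.
  rewrite -[LHS]scale1r -(mulVf (lt0r_neq0 c0)) -scalerA -ec scaler_sumr.
  by apply: eq_bigr => k _; rewrite scalerA.
have [_ F'D _] := proj1 (faceP P F') fF'.
apply: (face_full (rays_nv v) Pm (l := fun i => a i + b i) fF').
  move=> k; rewrite /b; case: eqP => [->|_]; last by rewrite ltr_wpDl.
  by rewrite addr0 lt_neqAle a0 andbT eq_sym.
under eq_bigr do rewrite scalerDl.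
by rewrite big_split /=; apply: F'D => //; rewrite -ea; apply/hat_X.
Qed.

Lemma simplex_flag i j l : i != j -> i != l -> j != l ->
  flag P (v i) (geodesic (v i) (v j)) (simplex_facet l).
Proof.
move=> ij il jl; have vij : v i <> v j by move=> /vI /eqP; rewrite (negPf ij).
have [x Px] := P0; have Px' := interior_subset Px.
split.
- by apply/(ideal_vertexP _ vI PV); [exists x|exists i].
- split; last by exists (v i), (v j).
  have fI : injective (pairv i j) by apply: pairv_inj => /eqP; rewrite (negPf ij).
  have := simplex_face fI; rewrite geodesic_hull // (_ : (fun b => v (pairv i j b)) = pairv (v i) (v j)) //.
  by apply/funext => -[].
- exact: facet_simplex.
- by exists (v j) => // e; apply: vij.
move=> x' /(geodesicP _ vij)[a [b [a0 b0 e]]]; apply/simplex_facetP.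
exists (fun k => if k == i then a else if k == j then b else 0); split.
- by move=> k; case: eqP => _; [exact: ltW|case: eqP => _ //; exact: ltW].
- by rewrite eq_sym (negPf il) eq_sym (negPf jl).
have ji := ij; rewrite eq_sym in ji.
rewrite e (bigD1 i) //= (bigD1 j) //= eqxx (negPf ji) eqxx big1 ?addr0 // => k /andP[ki kj].
by rewrite (negPf ki) (negPf kj) scale0r.
Qed.

End Simplex.

End RawTiles.

(** * Scaling the vertices of a regular tile *)

Section RegularTiles.
Context (R : realType).
Implicit Types (u v w : vec R) (x y z : H3 R) (p q : ideal R) (A P F B : set (H3 R)).

Lemma swap_eq (A B C : R) : 0 < A -> 0 < B -> 0 < C -> A = C * B -> B = C * A -> A = B.
Proof.
move=> A0 B0 C0 e1 e2.
have : (C ^+ 2 - 1) * A = 0 by rewrite mulrBl mul1r expr2 -mulrA -e2 -e1 subrr.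
move/eqP; rewrite mulf_eq0 (gt_eqF A0) orbF subr_eq0 sqrf_eq1 => /orP[]/eqP C1; subst C.
  by rewrite e1 mul1r.
by move: C0; rewrite oppr_gt0 ltr10.
Qed.

Lemma uniq_full (I : finType) (s : seq I) : uniq s -> size s = #|I| -> forall i, i \in s.
Proof.
move=> us ss i; have sE : (size (enum I) <= size s)%N by rewrite -cardE ss.
have [_ ->] := uniq_min_size us (fun a _ => mem_enum I a) sE.
by rewrite mem_enum.
Qed.

Definition vertex_transitive (I : finType) P (v : I -> ideal R) :=
  forall i j, exists2 g, symmetries P g & maps_ideal g (v i) (v j).

(** Regularity supplies a symmetry that fixes [i] and [l] and exchanges [j] and [k]. Each side
    involves all four vertices once, so the symmetry exchanges the two sides up to one common
    factor, which must be 1. *)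
Lemma simplex_cross P (v : 'I_4 -> ideal R) i j k l :
  injective v -> P = ideal_hull (range v) -> P^° !=set0 -> regular P ->
  uniq [:: i; j; k; l] ->
  lf (nv (v i)) (nv (v j)) * lf (nv (v k)) (nv (v l)) =
  lf (nv (v i)) (nv (v k)) * lf (nv (v j)) (nv (v l)).
Proof.
move=> vI PV P0 rP; rewrite /= !inE !negb_or => /and4P[/and3P[ij ik il] /andP[jk jl] kl _].
have [x Px] := P0.
have f1 := simplex_flag vI PV P0 ij il jl.
have f2 := simplex_flag vI PV P0 ik il kl.
have [g [gs gi gE gF]] := rP _ _ _ _ _ _ f1 f2.
have [L [phi [gL Lphi hphi]]] : exists L phi, [/\ linearizes g L, boundary_action L phi
    & forall i, exists j, phi (v i) = v j].
  by apply: (symmetry_vertices vI PV _ gs); exists x; exact: interior_subset Px.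
have [[gB _] gP] := gs.
have phI := boundary_action_inj gL Lphi.
have phi_i : phi (v i) = v i by apply/(maps_ideal_phi gB gL Lphi).
have vd a b : a != b -> v a <> v b by move=> ab /vI /eqP; rewrite (negPf ab).
have phi_j : phi (v j) = v k.
  move: gE; rewrite (image_geodesic gB gL Lphi) phi_i => e.
  apply: (geodesic_inj _ _ e); last exact: vd.
  by rewrite -phi_i => /phI; exact: vd.
have full a : a \in [:: i; j; k; l].
  apply: uniq_full; last by rewrite card_ord.
  by rewrite /= !inE !negb_or ij ik il jk jl kl.
have phi_kl : phi (v k) <> v l.
  have vfI : injective (fun a => v (lift l a)) by move=> a b /vI /lift_inj.
  have vfI' : injective (fun a => phi (v (lift l a))) by move=> a b /phI /vI /lift_inj.
  have lk : l != k by rewrite eq_sym.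
  have [a ea _] := unlift_some lk.
  move: gF; rewrite /simplex_facet (image_hull gB gL Lphi vfI) => e'.
  have n0 : ideal_hull (range (fun a => phi (v (lift l a)))) !=set0.
    rewrite e'; have [y Fy] := geodesic_nonempty (vd _ _ ij).
    by exists y; case: f1 => _ _ _ _; apply.
  have [b] := hull_vertex a vfI' vfI n0 e'.
  by rewrite -ea => <- /vI /eqP; rewrite eq_sym (negPf (neq_lift _ _)).
have neq_phi a b a' b' : phi (v a) = v a' -> phi (v b) = v b' -> a != b -> a' != b'.
  by move=> ea eb; apply: contraNneq => e; apply/eqP/vI/phI; rewrite ea eb e.
have [k' ek] := hphi k; have [l' el] := hphi l.
have k'j : k' = j.
  have := full k'; rewrite !inE => /or4P[] /eqP // e; exfalso.
  - by move: (neq_phi _ _ _ _ phi_i ek ik); rewrite e eqxx.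
  - by move: (neq_phi _ _ _ _ phi_j ek jk); rewrite e eqxx.
  - by apply: phi_kl; rewrite ek e.
subst k'.
have l'l : l' = l.
  have := full l'; rewrite !inE => /or4P[] /eqP // e; exfalso.
  - by move: (neq_phi _ _ _ _ phi_i el il); rewrite e eqxx.
  - by move: (neq_phi _ _ _ _ ek el kl); rewrite e eqxx.
  - by move: (neq_phi _ _ _ _ phi_j el jl); rewrite e eqxx.
subst l'; move: ek el => phi_k phi_l.
have [ci ci0 ei] := Lphi (v i); have [cj cj0 ej] := Lphi (v j).
have [ck ck0 ek] := Lphi (v k); have [cl cl0 el] := Lphi (v l).
rewrite phi_i in ei; rewrite phi_j in ej; rewrite phi_k in ek; rewrite phi_l in el.
have g1 := lin_lf gL (nv (v i)) (nv (v j)); have g2 := lin_lf gL (nv (v k)) (nv (v l)).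
have g3 := lin_lf gL (nv (v i)) (nv (v k)); have g4 := lin_lf gL (nv (v j)) (nv (v l)).
rewrite ei ej !lfE in g1; rewrite ek el !lfE in g2.
rewrite ei ek !lfE in g3; rewrite ej el !lfE in g4.
have G a b : a != b -> 0 < lf (nv (v a)) (nv (v b)) by move=> ab; apply: lf_nv_gt0; exact: vd.
apply: (@swap_eq _ _ (ci * cj * ck * cl)).
- by rewrite mulr_gt0 // G.
- by rewrite mulr_gt0 // G.
- by rewrite !mulr_gt0.
- by rewrite -[in LHS]g1 -[in LHS]g2; ring.
by rewrite -[in LHS]g3 -[in LHS]g4; ring.
Qed.

Lemma tetrahedron_scale (g01 g02 g03 g12 g13 g23 : R) :
  0 < g01 -> 0 < g02 -> 0 < g03 -> 0 < g12 ->
  g01 * g23 = g02 * g13 -> g01 * g23 = g03 * g12 ->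
  exists s0 s1 s2 s3, [/\ 0 < s0, 0 < s1, 0 < s2 & 0 < s3] /\
    [/\ s0 * s1 * g01 = 1, s0 * s2 * g02 = 1 & s0 * s3 * g03 = 1] /\
    [/\ s1 * s2 * g12 = 1, s1 * s3 * g13 = 1 & s2 * s3 * g23 = 1].
Proof.
move=> p01 p02 p03 p12 E1 E2.
have q0 : 0 < g12 / (g01 * g02) by rewrite divr_gt0 // mulr_gt0.
(* The edges at vertex 0 express the other three scales through [s]; the edge between 1 and 2 then
   gives [s ^+ 2]. The remaining edges are handled by [E1] and [E2]. *)
pose s := Num.sqrt (g12 / (g01 * g02)); have s0 : 0 < s by rewrite sqrtr_gt0.
have e12 : g12 = s ^+ 2 * g01 * g02.
  by rewrite sqr_sqrtr ?ltW // -mulrA divfK // gt_eqF // mulr_gt0.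
have e23 : g23 = s ^+ 2 * g02 * g03.
  by apply: (mulfI (lt0r_neq0 p01)); rewrite E2 e12; ring.
have e13 : g13 = s ^+ 2 * g01 * g03.
  by apply: (mulfI (lt0r_neq0 p02)); rewrite -E1 e23; ring.
exists s, (s * g01)^-1, (s * g02)^-1, (s * g03)^-1.
split; first by rewrite !invr_gt0 !mulr_gt0.
by split; split; rewrite ?e12 ?e13 ?e23; field; rewrite !gt_eqF.
Qed.

Lemma nv_lf_gt0 (I : finType) (v : I -> ideal R) i j : injective v -> i != j ->
  0 < lf (nv (v i)) (nv (v j)).
Proof. by move=> vI /eqP ij; apply: lf_nv_gt0 => /vI. Qed.

Lemma regular_tetrahedron_frame P : regular_ideal_tetrahedron P ->
  exists (v : 'I_4 -> ideal R) n c, tile_frame P v n c /\ vertex_transitive P v.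
Proof.
move=> [[[P0 _] [v [vI PV]]] rP].
pose i0 := @Ordinal 4 0 isT; pose i1 := @Ordinal 4 1 isT.
pose i2 := @Ordinal 4 2 isT; pose i3 := @Ordinal 4 3 isT.
pose G i j := lf (nv (v i)) (nv (v j)).
have GC i j : G i j = G j i by exact: lfC.
have E1 : G i0 i1 * G i2 i3 = G i0 i2 * G i1 i3 by exact: (simplex_cross (i := i0) (j := i1) (k := i2) (l := i3) vI PV P0 rP).
have E2 : G i0 i1 * G i2 i3 = G i0 i3 * G i1 i2.
  by rewrite (GC i2); exact: (simplex_cross (i := i0) (j := i1) (k := i3) (l := i2) vI PV P0 rP).
have G0 i j : i != j -> 0 < G i j by exact: nv_lf_gt0.
have [s0 [s1 [s2 [s3 [[p0 p1 p2 p3] [[e01 e02 e03] [e12 e13 e23]]]]]]] :=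
  tetrahedron_scale (G0 i0 i1 isT) (G0 i0 i2 isT) (G0 i0 i3 isT) (G0 i1 i2 isT) E1 E2.
pose s (i : 'I_4) : R := nth 0 [:: s0; s1; s2; s3] i.
pose n i := s i *: nv (v i).
have nr : rays v n.
  move=> i; exists (s i) => //.
  by rewrite /s; case: i => [[|[|[|[|//]]]] hi].
have n1 i j : i != j -> lf (n i) (n j) = 1.
  have S a b : s a * s b * G a b = 1 -> lf (n a) (n b) = 1.
    by move=> <-; rewrite /n !lfE /G; ring.
  have S' a b : s b * s a * G b a = 1 -> lf (n a) (n b) = 1 by rewrite lfC; exact: S.
  have V k (hk : (k < 4)%N) : Ordinal hk = nth i0 [:: i0; i1; i2; i3] k.
    by apply: val_inj; case: k hk => [|[|[|[|//]]]].
  case: i => i hi; case: j => j hj; rewrite !V.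
  case: i hi => [|[|[|[|//]]]] hi; case: j hj => [|[|[|[|//]]]] hj //= _;
    by [apply: S|apply: S'].
exists v, n, (\sum_i 3^-1 *: n i); split; first exact: tetrahedron_frame.
apply: (regular_transitive rP) => i.
have [j [k [ji ki _ _ jk]]] : exists j k, [/\ j != i, k != i, j != i, k != i & j != k].
  have il : i != lift i ord0 by exact: neq_lift.
  have [j [k [h1 _ h2 _ h3]]] := pair_complement (card_ord 4) il.
  by exists j, k.
exists (geodesic (v i) (v j)), (simplex_facet v k).
by apply: simplex_flag => //; rewrite eq_sym.
Qed.

(** Here 1 and 2 are opposite vertices fixed by a symmetry, 3 and 4 two vertices that it exchanges,
    and [c1] to [c4] its scale factors. The last four equations give [c1 ^+ 2 = c2 ^+ 2]. *)
Lemma cross_arith (c1 c2 c3 c4 G12 G13 G14 G23 G24 : R) :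
  0 < c1 -> 0 < c2 -> 0 < G12 -> 0 < G13 -> 0 < G24 ->
  c1 * (c2 * G12) = G12 -> c1 * (c3 * G14) = G13 -> c1 * (c4 * G13) = G14 ->
  c2 * (c3 * G24) = G23 -> c2 * (c4 * G23) = G24 -> G13 * G24 = G14 * G23.
Proof.
move=> c10 c20 p12 p13 p24 g12 g13 g14 g23 g24.
have h12 : c1 * c2 = 1 by apply: (mulIf (lt0r_neq0 p12)); rewrite -mulrA g12 mul1r.
have h1 : c1 ^+ 2 * (c3 * c4) = 1.
  by apply: (mulIf (lt0r_neq0 p13)); rewrite mul1r -[RHS]g13 -g14; ring.
have h2 : c2 ^+ 2 * (c3 * c4) = 1.
  by apply: (mulIf (lt0r_neq0 p24)); rewrite mul1r -[RHS]g24 -g23; ring.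
have c34 : c3 * c4 != 0.
  by apply/eqP => h; move/eqP: h1; rewrite h mulr0 eq_sym oner_eq0.
have c12 : c1 = c2.
  apply/eqP; rewrite -(@eqrXn2 _ 2) ?ltW //; apply/eqP.
  by apply: (mulIf c34); rewrite h1 h2.
by rewrite -g23 -g13 c12; ring.
Qed.

Section Octahedron.
Context (P : set (H3 R)) (v : 'I_3 * bool -> ideal R).
Hypotheses (vI : injective v) (PV : P = ideal_hull (range v)) (P0 : P^° !=set0).

Definition octahedron_facet (s : 'I_3 -> bool) := ideal_hull (range (fun i => v (i, s i))).
Hypothesis facets : forall F, facet P F <-> exists s, F = octahedron_facet s.
Hypothesis rP : regular P.

Let nr := rays_nv v.
Let Pn := hull_spanned nr vI PV.

Let sI (s : 'I_3 -> bool) : injective (fun i => (i, s i)).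
Proof. by move=> i j []. Qed.

Let vsI (s : 'I_3 -> bool) : injective (fun i => v (i, s i)).
Proof. by move=> i j /vI []. Qed.

Let facet_face s : face P (octahedron_facet s).
Proof. by have [] : facet P (octahedron_facet s) by apply/facets; exists s. Qed.

(** The edge is the intersection of the two facets that contain it, and intersections of faces are
    faces. *)
Lemma octahedron_edge i a j b : i != j -> edge P (geodesic (v (i, a)) (v (j, b))).
Proof.
move=> ij; have vij : v (i, a) <> v (j, b) by move=> /vI [/eqP]; rewrite (negPf ij).
split; last by exists (v (i, a)), (v (j, b)).
have [k [ki kj]] := ord3_third i j.
have full l : l \in [:: i; j; k].
  by apply: uniq_full; rewrite ?card_ord //= !inE !negb_or ij eq_sym ki eq_sym kj.
pose s d l := if l == i then a else if l == j then b else d.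
have sk d : s d k = d by rewrite /s (negPf ki) (negPf kj).
have ji : j != i by rewrite eq_sym.
suff -> : geodesic (v (i, a)) (v (j, b)) = octahedron_facet (s true) `&` octahedron_facet (s false).
  by apply: face_setI; exact: facet_face.
apply/seteqP; split=> x.
  have h d : geodesic (v (i, a)) (v (j, b)) `<=` octahedron_facet (s d).
    have := @geodesic_sub_hull _ _ (fun l => v (l, s d l)) i j (@vsI (s d)) ij.
    by rewrite /s eqxx (negPf ji) eqxx.
  by move=> gx; split; exact: h gx.
move=> [/(ideal_hullP x (@vsI (s true)))[l l0 e] Fx].
pose m r := nv (v (r, s true r)).
have tx : timelike (\sum_r l r *: m r) by rewrite -e; exact: X_timelike.
have [i1 [j1 [ij1 li1 lj1]]] := timelike_sum_pair (fun r => lf_nvv (v (r, s true r))) l0 tx.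
have mi : m i = nv (v (i, a)) by rewrite /m /s eqxx.
have mj : m j = nv (v (j, b)) by rewrite /m /s (negPf ji) eqxx.
(* Weight at the third vertex would, by the face property, put a geodesic ending at [v (k, true)]
   into the facet through [v (k, false)], although [v (k, true)] is not one of its vertices. *)
have [lk|lk] := ltrP 0 (l k).
  exfalso.
  have [r rk lr] : exists2 r, r != k & 0 < l r.
    by have [ek|] := eqVneq i1 k; [exists j1; rewrite // -ek eq_sym|exists i1].
  have vkr : v (k, true) <> v (r, s true r) by move=> /vI [/esym/eqP]; rewrite (negPf rk).
  have gF : geodesic (v (k, true)) (v (r, s true r)) `<=` octahedron_facet (s false).
    move=> y /(geodesicP _ vkr)[ck [cr [ck0 cr0 ey]]].
    (* Extension by 0 from the three vertices of the facet given by [s true] to all six. *)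
    pose lift_coef (c : 'I_3 -> R) (q : 'I_3 * bool) := if q.2 == s true q.1 then c q.1 else 0.
    have lift_sum c : \sum_q lift_coef c q *: nv (v q) = \sum_t c t *: m t.
      rewrite (sum_supported (@sI (s true))) => [|[t d] td].
        by apply: eq_bigr => t _; rewrite /lift_coef eqxx.
      rewrite /lift_coef /=; case: eqP => [ed|]; last by rewrite scale0r.
      by case/negP: td; rewrite ed; exact: (codom_f (fun t => (t, s true t))).
    pose c t := if t == k then ck else if t == r then cr else 0.
    have c0 t : 0 <= c t by rewrite /c; case: eqP => _; [exact: ltW|case: eqP => _ //; exact: ltW].
    have ec : \sum_t c t *: m t = X y.
      rewrite ey (bigD1 k) //= (bigD1 r) //= /c eqxx (negPf rk) eqxx big1 ?addr0.
        by rewrite /m sk.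
      by move=> t /andP[tk tr]; rewrite (negPf tk) (negPf tr) scale0r.
    apply/hat_X; rewrite -ec -lift_sum.
    apply: (face_support nr Pn (facet_face (s false)) (l := lift_coef l)).
    - by move=> q; rewrite /lift_coef; case: ifP.
    - by move=> q; rewrite /lift_coef; case: ifP.
    - move=> q; rewrite /lift_coef; case: ifP => // _; rewrite /c.
      by case: eqP => [->//|_]; case: eqP => [->//|_]; rewrite ltxx.
    - by rewrite lift_sum -e; apply/hat_X.
    - by rewrite lift_sum ec; exact: X_timelike.
  have [t /= /vI[tk]] := extreme_ray (rays_nv (fun t => v (t, s false t)))
    (hull_spanned (rays_nv _) (@vsI (s false)) erefl) vkr gF.
  by rewrite tk sk.
have lk0 : l k = 0 by apply/eqP; rewrite eq_le lk l0.
have e2 : X x = l i *: nv (v (i, a)) + l j *: nv (v (j, b)).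
  rewrite e (bigD1 i) //= (bigD1 j) //= -/(m i) -/(m j) mi mj big1 ?addr0 // => t /andP[ti tj].
  by have := full t; rewrite !inE (negPf ti) (negPf tj) /= => /eqP ->; rewrite lk0 scale0r.
apply/(geodesicP _ vij); exists (l i), (l j).
have pos t : t != k -> 0 < l t.
  move=> tk; rewrite lt_neqAle l0 andbT eq_sym; apply/negP => /eqP lt.
  have two r : 0 < l r -> r \in [:: i; j].
    move=> lr; have := full r; rewrite !inE => /or3P[->|->|/eqP rk]; rewrite ?orbT //.
    by move: lr; rewrite rk lk0 ltxx.
  move: (two _ li1) (two _ lj1) (full t); rewrite !inE (negPf tk) orbF.
  move=> /orP[] /eqP ei1 /orP[] /eqP ej1; subst i1 j1; rewrite ?eqxx // in ij1;
    move=> /orP[] /eqP et; subst t; by move: li1 lj1; rewrite ?lt ?ltxx.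
by split=> //; apply: pos; rewrite eq_sym.
Qed.

Lemma octahedron_flag i j s : i != j ->
  flag P (v (i, s i)) (geodesic (v (i, s i)) (v (j, s j))) (octahedron_facet s).
Proof.
move=> ij; have vij : v (i, s i) <> v (j, s j) by move=> /vI [/eqP]; rewrite (negPf ij).
have [x /interior_subset Px] := P0; split.
- by apply/(ideal_vertexP _ vI PV); [exists x|exists (i, s i)].
- exact: octahedron_edge.
- by apply/facets; exists s.
- by exists (v (j, s j)) => // e; apply: vij.
exact: (geodesic_sub_hull (@vsI s) ij).
Qed.

(** A flag symmetry fixes [v (i, a)], exchanges [v (j, b)] and [v (k, c)], and turns out to fix the
    opposite vertex [v (i, ~~ a)] too; its scale factors give the equation. *)
Lemma octahedron_cross i j k a b c : uniq [:: i; j; k] ->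
  lf (nv (v (i, a))) (nv (v (j, b))) * lf (nv (v (i, ~~ a))) (nv (v (k, c))) =
  lf (nv (v (i, a))) (nv (v (k, c))) * lf (nv (v (i, ~~ a))) (nv (v (j, b))).
Proof.
move=> uijk; have := uijk; rewrite /= !inE !negb_or => /and3P[/andP[ij ik] jk _].
have full l : l \in [:: i; j; k] by apply: uniq_full; rewrite ?card_ord.
pose t d l := if l == i then d else if l == j then b else c.
have ti d : t d i = d by rewrite /t eqxx.
have tj d : t d j = b by rewrite /t eq_sym (negPf ij) eqxx.
have tk d : t d k = c by rewrite /t eq_sym (negPf ik) eq_sym (negPf jk).
have f1 := octahedron_flag (t a) ij; have f2 := octahedron_flag (t a) ik.
rewrite !ti tj in f1; rewrite !ti tk in f2.
have [g [gs gi gE gF]] := rP f1 f2.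
have [x Px] := P0.
have [L [phi [gL Lphi hphi]]] : exists L phi, [/\ linearizes g L, boundary_action L phi
    & forall i, exists j, phi (v i) = v j].
  by apply: (symmetry_vertices vI PV _ gs); exists x; exact: interior_subset Px.
have [[gB _] gP] := gs; have [gI _] := gs.
have phI := boundary_action_inj gL Lphi.
have phi_i : phi (v (i, a)) = v (i, a) by apply/(maps_ideal_phi gB gL Lphi).
have vd d e : d != e -> v d <> v e by move=> de /vI /eqP; rewrite (negPf de).
have ijn (d e : bool) : (i, d) != (j, e) by rewrite xpair_eqE (negPf ij).
have ikn (d e : bool) : (i, d) != (k, e) by rewrite xpair_eqE (negPf ik).
have jkn (d e : bool) : (j, d) != (k, e) by rewrite xpair_eqE (negPf jk).
have phi_j : phi (v (j, b)) = v (k, c).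
  move: gE; rewrite (image_geodesic gB gL Lphi) phi_i => e.
  apply: (geodesic_inj _ _ e); last exact: vd.
  by rewrite -phi_i => /phI; exact: vd.
have neq_phi d e d' e' : phi (v d) = v d' -> phi (v e) = v e' -> d != e -> d' != e'.
  by move=> ed ee; apply: contraNneq => h; apply/eqP/vI/phI; rewrite ed ee h.
have facet_phi s s' : g @` octahedron_facet s = octahedron_facet s' ->
    forall r, exists r', phi (v (r, s r)) = v (r', s' r').
  move=> e r; have psI : injective (fun r => phi (v (r, s r))) by move=> r1 r2 /phI /vsI.
  have e' := e; rewrite /octahedron_facet (image_hull gB gL Lphi (@vsI s)) in e'.
  have n0 : ideal_hull (range (fun r => phi (v (r, s r)))) !=set0.
    rewrite e'; have [y Fy] := geodesic_nonempty (vd _ _ (ijn (s' i) (s' j))).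
    by exists y; exact: (geodesic_sub_hull (@vsI s') ij).
  by have [r' er] := hull_vertex r psI (@vsI s') n0 e'; exists r'.
have phi_k : phi (v (k, c)) = v (j, b).
  have [r] := facet_phi _ _ gF k; rewrite tk.
  have := full r; rewrite !inE => /or3P[]/eqP->; rewrite ?ti ?tj ?tk // => e; exfalso.
  - by move: (neq_phi _ _ _ _ phi_i e (ikn _ _)); rewrite eqxx.
  - by move: (neq_phi _ _ _ _ phi_j e (jkn _ _)); rewrite eqxx.
(* The facet through [v (i, ~~ a)] and the exchanged pair goes to a facet containing that pair; its
   third vertex is on the axis [i], and it is not the fixed vertex [v (i, a)]. *)
have phi_i' : phi (v (i, ~~ a)) = v (i, ~~ a).
  have [s' es] : exists s', g @` octahedron_facet (t (~~ a)) = octahedron_facet s'.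
    by apply/facets; rewrite -{1}gP; apply: image_facet => //; apply/facets; exists (t (~~ a)).
  have hs := facet_phi _ _ es.
  have [r1 hr1] := hs i; have [r2 hr2] := hs j; have [r3 hr3] := hs k.
  rewrite ti in hr1; rewrite tj phi_j in hr2; rewrite tk phi_k in hr3.
  have [er2 ec] : k = r2 /\ c = s' r2 by move: hr2 => /vI[].
  have [er3 eb] : j = r3 /\ b = s' r3 by move: hr3 => /vI[].
  subst r2 r3; rewrite hr1.
  have := full r1; rewrite !inE => /or3P[]/eqP er; subst r1.
  - have h := neq_phi _ _ _ _ phi_i hr1; congr (v (i, _)).
    have : (i, a) != (i, s' i) by apply: h; rewrite xpair_eqE eqxx; case: (a).
    by rewrite xpair_eqE eqxx; case: (a); case: (s' i).
  - exfalso; move: (neq_phi _ _ _ _ phi_k hr1).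
    by rewrite -eb eqxx eq_sym => /(_ (ikn _ _)).
  - exfalso; move: (neq_phi _ _ _ _ phi_j hr1).
    by rewrite -ec eqxx eq_sym => /(_ (ijn _ _)).
have ivn : (i, a) != (i, ~~ a) by rewrite xpair_eqE eqxx; case: (a).
have [c1 c10 e1] := Lphi (v (i, a)); have [c2 c20 e2] := Lphi (v (i, ~~ a)).
have [c3 c30 e3] := Lphi (v (j, b)); have [c4 c40 e4] := Lphi (v (k, c)).
rewrite phi_i in e1; rewrite phi_i' in e2; rewrite phi_j in e3; rewrite phi_k in e4.
have g12 := lin_lf gL (nv (v (i, a))) (nv (v (i, ~~ a))).
have g13 := lin_lf gL (nv (v (i, a))) (nv (v (j, b))).
have g14 := lin_lf gL (nv (v (i, a))) (nv (v (k, c))).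
have g23 := lin_lf gL (nv (v (i, ~~ a))) (nv (v (j, b))).
have g24 := lin_lf gL (nv (v (i, ~~ a))) (nv (v (k, c))).
have p12 := nv_lf_gt0 vI ivn; have p13 := nv_lf_gt0 vI (ijn a b).
have p24 := nv_lf_gt0 vI (ikn (~~ a) c).
rewrite e1 e2 !lfE in g12; rewrite e1 e3 !lfE in g13; rewrite e1 e4 !lfE in g14.
rewrite e2 e3 !lfE in g23; rewrite e2 e4 !lfE in g24.
by apply: (cross_arith c10 c20 p12 p13 p24 g12 g13 g14 g23 g24).
Qed.

End Octahedron.

Lemma octahedron_scale (A B C : R) : 0 < A -> 0 < B -> 0 < C ->
  exists s0 s1 s2, [/\ 0 < s0, 0 < s1 & 0 < s2] /\
    [/\ s0 * s1 * A = 1, s0 * s2 * B = 1 & s1 * s2 * C = 1].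
Proof.
move=> A0 B0 C0; have q0 : 0 < C / (A * B) by rewrite divr_gt0 // mulr_gt0.
pose s := Num.sqrt (C / (A * B)); have s0 : 0 < s by rewrite sqrtr_gt0.
have eC : C = s ^+ 2 * A * B by rewrite sqr_sqrtr ?ltW // -mulrA divfK // gt_eqF // mulr_gt0.
exists s, (s * A)^-1, (s * B)^-1; split; first by rewrite !invr_gt0 !mulr_gt0.
by split; rewrite ?eC; field; rewrite !gt_eqF.
Qed.

Lemma regular_octahedron_frame P : regular_ideal_octahedron P ->
  exists (v : 'I_3 * bool -> ideal R) n c,
    [/\ tile_frame P v n c, vertex_transitive P v &
      forall i a j b, lf (n (i, a)) (n (j, b)) = if i == j then (if a == b then 0 else 2) else 1].
Proof.
move=> [[[P0 _] [v [vI PV facets]]] rP].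
pose G d e := lf (nv (v d)) (nv (v e)).
have GC d e : G d e = G e d by exact: lfC.
have dn (i j : 'I_3) (d e : bool) : i != j -> (i, d) != (j, e).
  by move=> ij; rewrite xpair_eqE (negPf ij).
have G0 d e : d != e -> 0 < G d e by exact: nv_lf_gt0.
have cross i j k a b c : uniq [:: i; j; k] ->
    G (i, a) (j, b) * G (i, ~~ a) (k, c) = G (i, a) (k, c) * G (i, ~~ a) (j, b).
  exact: (octahedron_cross vI PV P0 facets rP).
pose i0 := @Ordinal 3 0 isT; pose i1 := @Ordinal 3 1 isT; pose i2 := @Ordinal 3 2 isT.
have [s0 [s1 [s2 [[p0 p1 p2] [e01 e02 e12]]]]] := octahedron_scale
  (G0 (i0, true) (i1, true) isT) (G0 (i0, true) (i2, true) isT) (G0 (i1, true) (i2, true) isT).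
pose s (i : 'I_3) : R := nth 0 [:: s0; s1; s2] i.
have sp i : 0 < s i by rewrite /s; case: i => [[|[|[|//]]] hi].
have V (k : nat) (hk : (k < 3)%N) : Ordinal hk = nth i0 [:: i0; i1; i2] k.
  by apply: val_inj; case: k hk => [|[|[|//]]].
have st i j : i != j -> s i * s j * G (i, true) (j, true) = 1.
  have S a b : s b * s a * G (b, true) (a, true) = 1 -> s a * s b * G (a, true) (b, true) = 1.
    by rewrite GC (mulrC (s b)).
  case: i => i hi; case: j => j hj; rewrite !V.
  case: i hi => [|[|[|//]]] hi; case: j hj => [|[|[|//]]] hj //= _;
    first [exact: e01|exact: e02|exact: e12|apply: S; first [exact: e01|exact: e02|exact: e12]].
have /choice[t ht] : forall i : 'I_3, exists j, j != i.
  by move=> i; have [j [ji _]] := ord3_third i i; exists j.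
(* The scale needed at [(i, false)] relative to [(i, true)]; [rhoE] says that it can be read off at
   any vertex of another axis. *)
pose rho i := G (i, true) (t i, true) / G (i, false) (t i, true).
have tn i : i != t i by rewrite eq_sym.
have rho0 i : 0 < rho i by rewrite divr_gt0 // G0 // dn.
have rhoE i j b : i != j -> rho i * G (i, false) (j, b) = G (i, true) (j, b).
  move=> ij; have g1 : G (i, false) (t i, true) != 0 by rewrite gt_eqF // G0 // dn.
  suff h : G (i, true) (t i, true) * G (i, false) (j, b) =
      G (i, true) (j, b) * G (i, false) (t i, true).
    by rewrite /rho mulrAC h mulfK.
  (* [cross] compares vertices on different axes; on the axis [t i] itself a vertex of the third
     axis serves as intermediary. *)
  have [jt|jt] := eqVneq j (t i); last first.
    by apply: (cross i (t i) j true true b); rewrite /= !inE !negb_or tn ij eq_sym jt.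
  have [k [ki kt]] := ord3_third i (t i).
  have ik : i != k by rewrite eq_sym.
  have tk : t i != k by rewrite eq_sym.
  have u1 : uniq [:: i; t i; k] by rewrite /= !inE !negb_or tn ik tk.
  have c1 := cross i (t i) k true true true u1.
  have c2 := cross i (t i) k true b true u1.
  rewrite /= in c1 c2; rewrite jt.
  have g2 : G (i, true) (k, true) != 0 by rewrite gt_eqF // G0 // dn.
  have g3 : G (i, false) (k, true) != 0 by rewrite gt_eqF // G0 // dn.
  apply: (mulIf g3).
  have -> : G (i, true) (t i, true) * G (i, false) (t i, b) * G (i, false) (k, true) =
     (G (i, true) (t i, true) * G (i, false) (k, true)) * G (i, false) (t i, b) by ring.
  by rewrite c1 -mulrA (mulrC (G (i, false) (t i, true))) mulrA -c2; ring.
pose r (d : 'I_3 * bool) := if d.2 then s d.1 else s d.1 * rho d.1.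
pose n d := r d *: nv (v d).
have nr : rays v n.
  by move=> [i b]; exists (r (i, b)) => //; rewrite /r; case: b => //=; rewrite mulr_gt0.
have n1 i a j b : i != j -> lf (n (i, a)) (n (j, b)) = 1.
  move=> ij; have ji : j != i by rewrite eq_sym.
  have -> : lf (n (i, a)) (n (j, b)) = r (i, a) * r (j, b) * G (i, a) (j, b).
    by rewrite /n !lfE /G; ring.
  have hj c : r (j, b) * G (i, c) (j, b) = s j * G (i, c) (j, true).
    by rewrite /r; case: b => //=; rewrite -mulrA GC rhoE // GC.
  have -> : r (i, a) * r (j, b) * G (i, a) (j, b) = r (i, a) * G (i, a) (j, true) * s j.
    by rewrite -mulrA hj; ring.
  have -> : r (i, a) * G (i, a) (j, true) = s i * G (i, true) (j, true).
    by rewrite /r; case: a => //=; rewrite -mulrA rhoE.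
  by rewrite mulrAC st.
exists v, n, (\sum_i 6^-1 *: n i); split.
- exact: octahedron_frame.
- apply: (regular_transitive rP) => -[i a].
  exists (geodesic (v (i, a)) (v (t i, true))), (octahedron_facet v (fun k => if k == i then a else true)).
  have := octahedron_flag vI PV P0 facets (fun k => if k == i then a else true) (tn i).
  by rewrite eqxx (negPf (ht i)).
exact: (octahedron_lf vI nr n1).
Qed.

End RegularTiles.

(** * The canonical packing of a tile *)

Section Packings.
Context (R : realType).
Implicit Types (u v w : vec R) (x y z : H3 R) (p q : ideal R) (A P F B : set (H3 R)) (K : set (set (H3 R))).

Lemma hball_interior n x : lf (X x) n < 1 -> (hball n)^° x.
Proof.
move=> h; apply/interior_hat; have tx := X_timelike x.
apply/(nbhs_hat _ tx); rewrite proj_X.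
have hc : (fun y => lf (X y) n) @ x --> lf (X x) n.
  apply: (@continuous_comp _ _ _ (@X R) (fun u => lf u n)); first exact: X_continuous.
  by apply: cvg_lf; [exact: cvg_id|exact: cvg_cst].
have h' : nbhs (lf (X x) n) [set r : R | r < 1] by exact: lt_nbhsl.
apply: (@filterS _ _ (nbhs_filter x) _ _ _ (hc _ h')) => y /= ?; exact: ltW.
Qed.

Lemma interior_singleton x : (set1 x)^° = set0 :> set (H3 R).
Proof.
rewrite -subset0 => y /interior_hat hy.
have yx : y = x by have [_] := nbhs_singleton hy; rewrite proj_X.
subst y; have [e e0 he] := nbhs_line (nv None) hy.
have e2 : 0 < e / 2 by rewrite divr_gt0.
have [tu hu] : hat [set x] (X x + (e / 2) *: nv None).
  by apply: he; rewrite gtr0_norm //; lra.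
have [c c0 ec] := timelike_proj tu; rewrite hu in ec.
have g0 := lf_timelike_nv None (X_timelike x).
have c1 : c = 1.
  have h : lf (X x + (e / 2) *: nv None) (nv None) = lf (c *: X x) (nv None) by rewrite ec.
  by rewrite !lfE lf_nvv mulr0 addr0 in h; apply: (mulIf (lt0r_neq0 g0)); rewrite mul1r.
move: ec; rewrite c1 scale1r -[RHS]addr0 => /addrI /eqP.
by rewrite scaler_eq0 (gt_eqF e2) orFb => /eqP /(@nv_neq0 R None).
Qed.

Section TwoBalls.
Context (p q : ideal R) (s t : R) (n m : vec R).
Hypotheses (pq : p <> q) (s0 : 0 < s) (t0 : 0 < t) (en : n = s *: nv p) (em : m = t *: nv q).

Let nn : lf n n = 0. Proof. by rewrite en !lfE lf_nvv !mulr0. Qed.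
Let mm : lf m m = 0. Proof. by rewrite em !lfE lf_nvv !mulr0. Qed.
Let tnm : timelike (n + m). Proof. by rewrite en em; exact: timelike_nvD. Qed.
Let lfnm : lf (n + m) (n + m) = 2 * lf n m.
Proof. by rewrite !lfE nn mm (lfC m n); lra. Qed.

(** In both balls [X x] pairs with [n + m] to at most 2, while reverse Cauchy-Schwarz gives at least
    2 because [n + m] has norm at least 2. Equality identifies [X x]. *)
Lemma hball_meet x : 1 <= lf n m -> hball n x -> hball m x ->
  X x = n + m /\ lf n m = 1.
Proof.
rewrite /hball /= => h1 hn hm.
have h := reverse_cs (X x) tnm; rewrite lf_XX lfnm in h.
have g0 : 0 < lf (X x) (n + m) by apply: lf_timelike => //; exact: X_timelike.
have h2 : lf (X x) (n + m) <= 2 by rewrite lfDr; lra.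
have e1 : lf n m = 1 by nra.
have e2 : lf (X x) (n + m) = 2 by nra.
split=> //; apply/subr0_eq; apply: (@timelike_orth_eq0 _ (X x)); first exact: X_timelike.
  by rewrite lfBl lf_XX (lfC (n + m)) e2 subrr.
by rewrite lfBl !lfBr lf_XX (lfC (n + m) (X x)) e2 lfnm e1; lra.
Qed.

Lemma hball_tangent : lf n m = 1 -> hball n `&` hball m = [set hproj (n + m)].
Proof.
move=> e.
have eX : X (hproj (n + m)) = n + m.
  by rewrite X_proj // lfnm e mulr1 divff // sqrtr1 invr1 scale1r.
apply/seteqP; split=> [x [hn hm]|_ ->].
  have [|ex _] := hball_meet _ hn hm; first by rewrite e.
  by apply: X_inj; rewrite eX.
by rewrite /hball; split; rewrite /= eX lfDl ?nn ?mm ?(lfC m) e ?add0r ?addr0.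
Qed.

Lemma hball_disjoint : 1 <= lf n m -> (hball n)^° `&` (hball m)^° = set0.
Proof.
move=> h; rewrite -interiorI -subset0 -(interior_singleton (hproj (n + m))).
apply: interiorS => x [hn hm]; have [e _] := hball_meet h hn hm.
by apply: X_inj; rewrite -e proj_X.
Qed.

(** The normalised sum of [n] and [m] pairs with both to the square root of [lf n m]. *)
Lemma hball_overlap : lf n m < 1 -> (hball n)^° `&` (hball m)^° !=set0.
Proof.
move=> h; have [c c0 ec] := timelike_proj tnm.
have cc : c ^+ 2 = lf n m.
  have := lfnm; rewrite {1 2}ec !lfE lf_XX; lra.
have c1 : c < 1 by nra.
have cn : c != 0 by rewrite gt_eqF.
have ln : lf (X (hproj (n + m))) n = c.
  by apply: (mulfI cn); rewrite -lfZl -ec lfDl nn add0r lfC -cc expr2.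
have lm : lf (X (hproj (n + m))) m = c.
  by apply: (mulfI cn); rewrite -lfZl -ec lfDl mm addr0 -cc expr2.
by exists (hproj (n + m)); split; apply: hball_interior; rewrite ?ln ?lm.
Qed.

End TwoBalls.

Lemma packing_ge1 K p q (s t : R) : packing K -> p <> q -> 0 < s -> 0 < t ->
  K (hball (s *: nv p)) -> K (hball (t *: nv q)) -> 1 <= lf (s *: nv p) (t *: nv q).
Proof.
move=> [_ disj] pq s0 t0 Kp Kq; rewrite leNgt; apply/negP => h.
have ne : hball (s *: nv p) <> hball (t *: nv q) by move=> /(hball_inj s0 t0)[].
by have := hball_overlap pq s0 t0 erefl erefl h; rewrite disj // => -[].
Qed.

Lemma packing_center K p B B' : packing K -> K B -> K B' ->
  horoball_at p B -> horoball_at p B' -> B = B'.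
Proof.
move=> [_ disj] KB KB' /horoball_atP[s s0 eB] /horoball_atP[t t0 eB'].
apply: contrapT => ne; have [q pq] := ideal_other p; have g0 := lf_nv_gt0 pq.
have st0 : 0 < s + t by rewrite addr_gt0.
have b0 : 0 < ((s + t) * 2 * lf (nv p) (nv q))^-1 by rewrite invr_gt0 !mulr_gt0.
have [x [_ xp _]] := geodesic_point pq b0.
have {}xp : lf (X x) (nv p) = ((s + t) * 2)^-1.
  by rewrite xp; field; rewrite !gt_eqF.
suff : (B^° `&` B'^°) x by rewrite disj.
split; rewrite ?eB ?eB'; apply: hball_interior; rewrite lfZr xp ltr_pdivrMr ?mulr_gt0 //; lra.
Qed.

(** With [m (f i) = u i *: n i], equality of the vertex products makes [u i ^+ (#|I| - 2)] times the
    product of all [u j] equal to 1. Hence all [u i] agree, and a positive power of their common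
    value is 1. *)
Lemma canonical_unique (I J : finType) (v : I -> ideal R) (w : J -> ideal R)
    (n : I -> vec R) (m : J -> vec R) :
  injective v -> injective w -> rays v n -> rays w m -> #|I| = #|J| ->
  (#|I| = 4 \/ #|I| = 6)%N ->
  (forall i, \prod_(j | j != i) lf (n i) (n j) = vertex_product R #|I|) ->
  (forall i, \prod_(j | j != i) lf (m i) (m j) = vertex_product R #|J|) ->
  (forall i, exists j, w j = v i) ->
  forall i j, w j = v i -> m j = n i.
Proof.
move=> vI wI nr mr IJ I46 pn pm /choice[f hf].
have fI : injective f by move=> a b e; apply: vI; rewrite -!hf e.
have fB : bijective f by apply: inj_card_bij => //; rewrite IJ.
have /choice[u hu] : forall i, exists u : R, 0 < u /\ m (f i) = u *: n i.
  move=> i; have [s s0 es] := nr i; have [t t0 et] := mr (f i).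
  exists (t / s); rewrite divr_gt0 //; split=> //.
  by rewrite et es scalerA divfK ?gt_eqF // hf.
have u0 i : 0 < u i by case: (hu i).
have um i : m (f i) = u i *: n i by case: (hu i).
have vp0 : vertex_product R #|I| != 0.
  by rewrite /vertex_product; case: ifP => _; rewrite ?oner_neq0 // pnatr_eq0.
have P1 i : \prod_(j | j != i) (u i * u j) = 1.
  apply: (mulIf vp0); rewrite -{1}(pn i) -big_split /= mul1r IJ -(pm (f i)).
  rewrite [RHS](reindex f) /=; last exact: onW_bij.
  apply: eq_big => [j|j _]; first by rewrite (inj_eq fI).
  by rewrite !um !lfE mulrA.
pose U := \prod_i u i.
have U0 : 0 < U by apply: prodr_gt0.
have P2 i : u i ^+ (#|I| - 2) * U = 1.
  rewrite -(P1 i) big_split /= prodr_const cardC1 /U (bigD1 i) //= mulrA -exprSr.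
  by congr (_ ^+ _ * _); case: I46 => ->.
have k0 : (0 < #|I| - 2)%N by case: I46 => ->.
move=> i0 j0 e0; have uE i : u i = u i0.
  apply/eqP; rewrite -(@eqrXn2 _ (#|I| - 2)) ?ltW //; apply/eqP.
  by apply: (mulIf (lt0r_neq0 U0)); rewrite !P2.
have u1 : u i0 = 1.
  have := P2 i0; rewrite /U (eq_bigr (fun=> u i0)) // prodr_const -exprD => /eqP.
  rewrite pexpr_eq1 ?addn_gt0 ?k0 //; last exact: ltW.
  by move/eqP.
have -> : j0 = f i0 by apply: wI; rewrite e0 hf.
by rewrite um u1 scale1r.
Qed.

Section TilePacking.
Context (I : finType) (P : set (H3 R)) (v : I -> ideal R) (n : I -> vec R) (c : vec R).
Hypotheses (fr : tile_frame P v n c).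

Lemma tile_spanned : spanned P n.
Proof. by have := hull_spanned (tf_rays fr) (tf_inj fr) (tf_hull fr). Qed.

Lemma tile_null i : lf (n i) (n i) = 0.
Proof. by have := rays_null (tf_rays fr) i. Qed.

Lemma tile_neq i j : lf (n i) (n j) = 1 -> i != j.
Proof.
by move=> h; apply/eqP => e; move/eqP: h; rewrite e tile_null eq_sym oner_eq0.
Qed.

Lemma tile_timelike i j (a b : R) : i != j -> 0 < a -> 0 < b -> timelike (a *: n i + b *: n j).
Proof.
by move=> /eqP ij; apply: (timelike_pair (tf_rays fr)) => /(tf_inj fr).
Qed.

Lemma tile_card_gt1 (i : I) : exists j, j != i.
Proof.
have : (0 < #|predC1 i|)%N by rewrite cardC1; case: (tf_card fr) => ->.
by case/card_gt0P => j; exists j.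
Qed.

Lemma tile_timelike_sum (a : I -> R) i j : i != j -> (forall i, 0 <= a i) ->
  0 < a i -> 0 < a j -> timelike (\sum_i a i *: n i).
Proof.
move=> ij a0 ai aj; have ji : j != i by rewrite eq_sym.
rewrite (bigD1 i) //= (bigD1 j) //= addrA; apply: timelikeDcausal.
  exact: tile_timelike.
by apply: causal_sum => k _; apply: causalZ => //; exact: rays_causal (tf_rays fr) k.
Qed.

Lemma tile_inh : exists i : I, true.
Proof.
have : (0 < #|I|)%N by case: (tf_card fr) => ->.
by case/card_gt0P => i _; exists i.
Qed.

Lemma tile_nonempty : P !=set0.
Proof.
have [i _] := tile_inh; have [j ji] := tile_card_gt1 i.
have tn := tile_timelike ji (@ltr01 R) (@ltr01 R).
exists (hproj (1 *: n j + 1 *: n i)).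
suff [] : hat P (1 *: n j + 1 *: n i) by [].
apply/(hat_spanned tile_spanned); split=> //.
by apply: coneD; apply: coneZ => //; exact: cone_gen.
Qed.

Lemma tile_vertexP p : ideal_vertex P p <-> exists i, v i = p.
Proof. exact: ideal_vertexP (tf_inj fr) (tf_hull fr) tile_nonempty. Qed.

(** [tf_tri] is applied to a single vertex: a multiple of one null vector cannot equal a combination
    with full support, which is timelike, so the vertex lies in a triangle. *)
Lemma tile_adjacent i : exists j, lf (n i) (n j) = 1.
Proof.
have [[i1 [j1 [k1 [h1 h2 h3 /fintype.subsetP/(_ i)]]]]|[l [m [l0 lS m0 e]]]] :=
  tf_tri fr [set i]%SET.
  rewrite !inE eqxx => /(_ isT) /orP[/orP[]|]/eqP ->; [by exists j1|by exists k1|].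
  by exists j1; rewrite lfC.
have [j ji] := tile_card_gt1 i.
have : timelike (\sum_i m i *: n i) by apply: (tile_timelike_sum ji) => // k; exact: ltW.
rewrite -e => /(timelike_sum_pair tile_null l0)[i1 [j1 [ij1 /lS + /lS]]].
by rewrite !inE => /eqP e1 /eqP e2; move: ij1; rewrite e1 e2 eqxx.
Qed.

Definition tile_packing : set (set (H3 R)) := [set hball (n i) | i in [set: I]].

Lemma tile_ball_center i p : horoball_at p (hball (n i)) <-> v i = p.
Proof.
by have [s s0 ->] := tf_rays fr i; rewrite horoball_hball.
Qed.

Lemma tile_packing_packing : packing tile_packing.
Proof.
split=> [_ [i _ <-]|_ _ [i _ <-] [j _ <-] ne].
  by exists (v i); apply/tile_ball_center.
have [e|ij] := eqVneq i j; first by case: ne; rewrite e.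
have [s s0 es] := tf_rays fr i; have [t t0 et] := tf_rays fr j.
by apply: (hball_disjoint _ s0 t0 es et (tf_ge1 fr ij)) => /(tf_inj fr) /eqP; rewrite (negPf ij).
Qed.

(** In a larger packing the balls at adjacent vertices have factors [a] and [b] at most 1, and
    disjointness needs [a * b >= 1]. *)
Lemma tile_packing_maximal : maximal_packing_at (ideal_vertex P) tile_packing.
Proof.
split.
- exact: tile_packing_packing.
- by move=> p [_ [i _ <-] /tile_ball_center vi]; apply/tile_vertexP; exists i.
move=> K' K'p K'c dom.
have hK i : K' (hball (n i)).
  have big k : exists2 u : R, 0 < u <= 1 & K' (hball (u *: n k)).
    have [|B KB sB] := dom (hball (n k)); first by exists k.
    have [p /horoball_atP[t t0 eB]] := proj1 K'p _ KB; subst B.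
    have [s s0 es] := tf_rays fr k; rewrite es in sB.
    have [evp ts] := hball_sub s0 t0 sB; exists (t / s).
      by rewrite divr_gt0 //= ler_pdivrMr // mul1r.
    by rewrite es scalerA divfK ?gt_eqF // evp.
  have [j ij] := tile_adjacent i; have nij := tile_neq ij.
  have [a /andP[a0 a1] Ka] := big i; have [b /andP[b0 b1] Kb] := big j.
  suff -> : hball (n i) = hball (a *: n i) by [].
  suff -> : a = 1 by rewrite scale1r.
  have vij : v i <> v j by move=> /(tf_inj fr) /eqP; rewrite (negPf nij).
  have : 1 <= lf (a *: n i) (b *: n j).
    move: Ka Kb; have [s s0 ->] := tf_rays fr i; have [t t0 ->] := tf_rays fr j.
    by rewrite !scalerA; apply: packing_ge1 => //; exact: mulr_gt0.
  rewrite !lfE ij mulr1 => ?; nra.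
apply/seteqP; split=> [B KB|_ [i _ <-] //].
have [p hp] := proj1 K'p _ KB.
have /tile_vertexP[i vi] : ideal_vertex P p by apply: K'c; exists B.
exists i => //; apply: (packing_center K'p (hK i) KB _ hp); exact/tile_ball_center.
Qed.

(** The image family has the same vertex products on the same vertex set, so a symmetry permutes the
    [n i] themselves and not only their rays. *)
Lemma canonical_image (g : H3 R -> H3 R) L phi i j : linearizes g L -> boundary_action L phi ->
  (forall k, exists k', phi (v k) = v k') -> phi (v i) = v j -> L (n i) = n j.
Proof.
move=> gL Lphi hphi eij; apply: esym.
have phI := boundary_action_inj gL Lphi.
apply: (@canonical_unique I I (fun i => phi (v i)) v (fun i => L (n i)) n).
- by move=> a b /phI /(tf_inj fr).
- exact: tf_inj fr.
- exact: (image_rays gL Lphi (tf_rays fr)).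
- exact: tf_rays fr.
- by [].
- exact: tf_card fr.
- by move=> k; rewrite -(tf_prod fr k); apply: eq_bigr => l _; rewrite (lin_lf gL).
- exact: tf_prod fr.
- by move=> k; have [k' e] := hphi k; exists k'.
by [].
Qed.

Lemma symmetry_ball g i q : symmetries P g -> maps_ideal g (v i) q ->
  forall u : R, exists j, v j = q /\ g @` hball (u *: n i) = hball (u *: n j).
Proof.
move=> gs gi u.
have [L [phi [gL Lphi hphi]]] := symmetry_vertices (tf_inj fr) (tf_hull fr) tile_nonempty gs.
have [[gB _] _] := gs; have [j ej] := hphi i.
exists j; split; first by rewrite -ej; apply/(maps_ideal_phi gB gL Lphi).
by rewrite (image_hball gB gL) (linZ gL) (canonical_image gL Lphi hphi ej).
Qed.

Lemma tile_packing_symmetric : symmetric_maximal_packing P tile_packing.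
Proof.
split; first exact: tile_packing_maximal.
move=> g _ gs [i _ <-].
have [L [phi [gL Lphi hphi]]] := symmetry_vertices (tf_inj fr) (tf_hull fr) tile_nonempty gs.
have [[gB _] _] := gs.
have gi : maps_ideal g (v i) (phi (v i)) by apply/(maps_ideal_phi gB gL Lphi).
have [j [_]] := symmetry_ball gs gi 1; rewrite !scale1r => ->.
by exists j.
Qed.

(** By transitivity and invariance a ball of [K] has a companion at an adjacent vertex with the same
    factor [u], and disjointness forces [u >= 1]. Thus [K] is dominated by the packing of the frame,
    and its maximality applies. *)
Lemma symmetric_maximal_unique K : vertex_transitive P v ->
  symmetric_maximal_packing P K -> K = tile_packing.
Proof.
move=> tr [[Kp Kc Kmax] Kinv]; apply/esym/Kmax.
- exact: tile_packing_packing.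
- by case: tile_packing_maximal.
move=> B KB; have [p hp] := proj1 Kp _ KB.
have /tile_vertexP[i vi] : ideal_vertex P p by apply: Kc; exists B.
exists (hball (n i)); first by exists i.
have /horoball_atP[t t0 eB] := hp.
have [s s0 es] := tf_rays fr i.
have {}eB : B = hball ((t / s) *: n i).
  by rewrite eB es scalerA divfK ?gt_eqF // vi.
have u0 : 0 < t / s by rewrite divr_gt0.
move: (t / s) u0 eB => u u0 eB.
have [j ij] := tile_adjacent i; have nij := tile_neq ij.
have vij : v i <> v j by move=> /(tf_inj fr) /eqP; rewrite (negPf nij).
have [g gs gij] := tr i j.
have [j' [/(tf_inj fr) -> eg]] := symmetry_ball gs gij u.
have Kj : K (hball (u *: n j)) by rewrite -eg -eB; exact: Kinv.
have : 1 <= lf (u *: n i) (u *: n j).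
  rewrite eB in KB; move: KB Kj; have [s1 s10 ->] := tf_rays fr i; have [t1 t10 ->] := tf_rays fr j.
  by rewrite !scalerA; apply: packing_ge1 => //; exact: mulr_gt0.
rewrite !lfE ij mulr1 => uu; have u1 : 1 <= u by nra.
move=> x; rewrite eB /hball /= lfZr; apply: le_trans.
rewrite ler_peMl //; apply: ltW; apply: rays_timelike (tf_rays fr) _ _ _.
exact: X_timelike.
Qed.

Lemma HP_tile : vertex_transitive P v -> HP P = tile_packing.
Proof.
move=> tr; apply/seteqP; split=> B; first by move=> [K /(symmetric_maximal_unique tr) ->].
by move=> hB; exists tile_packing => //; exact: tile_packing_symmetric.
Qed.

End TilePacking.

End Packings.

(** * Edges and triangles of a tile *)

Section TileFaces.
Context (R : realType).
Implicit Types (u w : vec R) (x y z : H3 R) (p q r : ideal R) (A F B : set (H3 R)).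

Definition ideal_triangle p q r : set (H3 R) :=
  convex_hull (geodesic p q `|` geodesic q r `|` geodesic p r).

Lemma ideal_triangleP p q r x : p <> q -> q <> r -> p <> r ->
  ideal_triangle p q r x <-> exists a b d : R,
    [/\ 0 <= a, 0 <= b, 0 <= d & X x = a *: nv p + b *: nv q + d *: nv r].
Proof.
move=> pq qr pr; pose v (i : 'I_3) := nth p [:: p; q; r] i.
have vI : injective v.
  move=> [[|[|[|//]]] hi] [[|[|[|//]]] hj] /= e; apply: val_inj => //=; exfalso;
    by move: pq qr pr; rewrite /v /= in e; rewrite ?e.
have -> : ideal_triangle p q r = ideal_hull (range v).
  rewrite /ideal_triangle /ideal_hull; congr convex_hull; apply/seteqP; split=> y.
    have vr (i : 'I_3) : range v (v i) by exists i.
    have vp : range v p := vr (@Ordinal 3 0 isT).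
    have vq : range v q := vr (@Ordinal 3 1 isT).
    have vr' : range v r := vr (@Ordinal 3 2 isT).
    by case=> [[h|h]|h]; [exists p, q|exists q, r|exists p, r].
  move=> [_ [_ [[[[|[|[|//]]] hi] _ <-] [[[|[|[|//]]] hj] _ <-]]]]; rewrite /v /=;
    first [by rewrite geodesic_self|by move=> ?; left; left|by move=> ?; left; right
      |by move=> ?; right|by rewrite geodesicC => ?; left; left
      |by rewrite geodesicC => ?; left; right|by rewrite geodesicC => ?; right].
rewrite (ideal_hullP x vI); split=> [[l l0]|[a [b [d [a0 b0 d0 e]]]]].
  rewrite !big_ord_recl big_ord0 addr0 addrA => e.
  exists (l ord0), (l (lift ord0 ord0)), (l (lift ord0 (lift ord0 ord0))).
  split; [exact: l0|exact: l0|exact: l0|exact: e].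
exists (fun i : 'I_3 => nth 0 [:: a; b; d] (nat_of_ord i)); first by move=> [[|[|[|//]]] hi].
by rewrite e !big_ord_recl big_ord0 addr0 addrA.
Qed.

Section Frame.
Context (I : finType) (P : set (H3 R)) (v : I -> ideal R) (n : I -> vec R) (c : vec R).
Hypotheses (fr : tile_frame P v n c).
Let Pn := tile_spanned fr.
Let nr := tf_rays fr.

Lemma tile_point_sum x (l : I -> R) : X x = \sum_i l i *: n i -> timelike (\sum_i l i *: n i).
Proof. by move=> <-; exact: X_timelike. Qed.

Lemma tile_face_dichotomy F : face P F -> F = P \/
  exists i j k, [/\ lf (n i) (n j) = 1, lf (n j) (n k) = 1, lf (n i) (n k) = 1 &
    forall x (l : I -> R), F x -> (forall t, 0 <= l t) -> X x = \sum_t l t *: n t ->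
      forall t, 0 < l t -> [\/ t = i, t = j | t = k]].
Proof.
move=> fF; have [_ FD _] := proj1 (faceP P F) fF.
have [[i [j [k [ij jk ik S]]]]|[l [m [l0 lS m0 e]]]] := tf_tri fr (face_set n F).
  right; exists i, j, k; split=> // x l Fx l0 ex t lt.
  have : t \in face_set n F.
    by apply/face_setP; exists l => //; split=> //; rewrite -ex; apply/hat_X.
  move/fintype.subsetP: S => /[apply]; rewrite !inE.
  by move=> /orP[/orP[]|] /eqP ->; [constructor 1|constructor 2|constructor 3].
left; have [i _] := tile_inh fr; have [j ji] := tile_card_gt1 fr i.
have tm : timelike (\sum_i m i *: n i).
  by apply: (tile_timelike_sum fr ji) => // t; exact: ltW.
have tl : timelike (\sum_i l i *: n i) by rewrite e.
have [i1 [_ [_ li1 _]]] := timelike_sum_pair (tile_null fr) l0 tl.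
have [|L [L0 LS hL]] := face_set_witness FD (n := n).
  by apply/set0Pn; exists i1; exact: lS.
apply: (face_full nr Pn fF m0); rewrite -e.
by apply: (face_support nr Pn fF L0 l0 _ hL tl) => t /lS /LS.
Qed.

Lemma tile_pair_face F x (l : I -> R) i j : face P F -> F <> P -> F x ->
  (forall t, 0 <= l t) -> X x = \sum_t l t *: n t -> i != j -> 0 < l i -> 0 < l j ->
  lf (n i) (n j) = 1.
Proof.
move=> fF FP Fx l0 ex ij li lj.
have [//|[a [b [d [ab bd ad h]]]]] := tile_face_dichotomy fF.
have [||] := h x l Fx l0 ex i li => ei; have [||] := h x l Fx l0 ex j lj => ej;
  by subst i j; rewrite ?eqxx // in ij; rewrite // lfC.
Qed.

Lemma tile_face_geodesic F x (l : I -> R) i j : face P F -> F x ->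
  (forall t, 0 <= l t) -> X x = \sum_t l t *: n t -> i != j -> 0 < l i -> 0 < l j ->
  geodesic (v i) (v j) `<=` F.
Proof.
move=> fF Fx l0 ex ij li lj y.
have vij : v i <> v j by move=> /(tf_inj fr) /eqP; rewrite (negPf ij).
move=> /(geodesicP _ vij)[a [b [a0 b0 ey]]].
have [s s0 es] := nr i; have [t t0 et] := nr j.
pose m k := if k == i then a / s else if k == j then b / t else 0.
have ji : j != i by rewrite eq_sym.
have em : X y = \sum_k m k *: n k.
  rewrite (bigD1 i) //= (bigD1 j) //= /m eqxx (negPf ji) eqxx big1 ?addr0.
    by rewrite es et !scalerA !divfK ?gt_eqF.
  by move=> k /andP[ki kj]; rewrite (negPf ki) (negPf kj) scale0r.
apply/hat_X; rewrite em; apply: (face_support nr Pn fF l0).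
- by move=> k; rewrite /m; case: eqP => _; [|case: eqP => _ //]; rewrite ltW // divr_gt0.
- by move=> k; rewrite /m; case: eqP => [->//|_]; case: eqP => [->//|_]; rewrite ltxx.
- by rewrite -ex; apply/hat_X.
by rewrite -em; exact: X_timelike.
Qed.

Lemma functional_zero (f : vec R) (l : I -> R) : (forall i, 0 <= lf f (n i)) ->
  (forall i, 0 <= l i) -> lf f (\sum_i l i *: n i) = 0 ->
  forall i, 0 < lf f (n i) -> l i = 0.
Proof.
move=> f0 l0 e i fi; apply/eqP; rewrite eq_le l0 andbT leNgt; apply/negP => li.
move: e; rewrite lf_sumr (bigD1 i) //= lfZr => e.
have h1 := mulr_gt0 li fi.
have h2 : 0 <= \sum_(j | j != i) lf f (l j *: n j).
  by apply: sumr_ge0 => j _; rewrite lfZr mulr_ge0.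
by have := ltr_pwDl h1 h2; rewrite e ltxx.
Qed.

Lemma tile_edge_face i j : lf (n i) (n j) = 1 -> face P (geodesic (v i) (v j)).
Proof.
move=> ij1; have ij := tile_neq fr ij1; have ji : j != i by rewrite eq_sym.
have vij : v i <> v j by move=> /(tf_inj fr) /eqP; rewrite (negPf ij).
(* A supporting functional of the edge: its value is 0 + 1 - 1 at both ends and at least 1 + 1 - 1
   at every other vertex. *)
pose f := n i + n j - c.
have fi : lf f (n i) = 0 by rewrite /f !lfE (tile_null fr) lfC ij1 (tf_center fr); lra.
have fj : lf f (n j) = 0 by rewrite /f !lfE (tile_null fr) ij1 (tf_center fr); lra.
have fk k : k != i -> k != j -> 0 < lf f (n k).
  move=> ki kj; rewrite /f !lfE (tf_center fr).
  have ik : i != k by rewrite eq_sym.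
  have jk : j != k by rewrite eq_sym.
  have := tf_ge1 fr ik; have := tf_ge1 fr jk; lra.
have f0 k : 0 <= lf f (n k).
  have [->|ki] := eqVneq k i; first by rewrite fi.
  have [->|kj] := eqVneq k j; first by rewrite fj.
  by rewrite ltW // fk.
suff -> : geodesic (v i) (v j) = [set x | P x /\ lf f (X x) = 0] by exact: functional_face Pn _ f0.
have [s s0 es] := nr i; have [t t0 et] := nr j.
apply/seteqP; split=> x.
  move=> /(geodesicP _ vij)[a [b [a0 b0 e]]].
  have e' : X x = (a / s) *: n i + (b / t) *: n j by rewrite e es et !scalerA !divfK ?gt_eqF.
  split; last by rewrite e' !lfDr !lfZr fi fj !mulr0 addr0.
  by apply/Pn; rewrite e'; apply: coneD; apply: coneZ; rewrite ?divr_ge0 ?ltW //; exact: cone_gen.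
move=> [/Pn[l l0 e] fx]; rewrite e in fx.
have lk k : k != i -> k != j -> l k = 0.
  by move=> ki kj; exact: functional_zero f0 l0 fx _ (fk _ ki kj).
have e2 : X x = l i *: n i + l j *: n j.
  rewrite e (bigD1 i) //= (bigD1 j) //= big1 ?addr0 // => k /andP[ki kj].
  by rewrite lk ?scale0r.
have tx := tile_point_sum e.
have [i1 [j1 [ij1' li1 lj1]]] := timelike_sum_pair (tile_null fr) l0 tx.
have two k : 0 < l k -> k = i \/ k = j.
  move=> lk0; have [->|ki] := eqVneq k i; first by left.
  by have [->|kj] := eqVneq k j; [right|move: lk0; rewrite lk // ltxx].
have [li lj] : 0 < l i /\ 0 < l j.
  by case: (two _ li1) => e1; case: (two _ lj1) => e3; subst i1 j1; rewrite ?eqxx // in ij1'.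
apply/(geodesicP _ vij); exists (l i * s), (l j * t).
by rewrite !mulr_gt0 // e2 es et !scalerA.
Qed.

Lemma tile_third (i j : I) : exists k, k != i /\ k != j.
Proof.
have : (0 < #|~: [set i; j]%SET|)%N.
  rewrite -(ltn_add2l #|[set i; j]%SET|) addn0 cardsC cards2.
  by case: (tf_card fr) => ->; case: (i != j).
by case/card_gt0P => k; rewrite !inE negb_or => /andP[? ?]; exists k.
Qed.

(** A geodesic that is a face contains the geodesic joining two vertices carried by one of its
    points, hence equals it. It is not the whole tile, which has a third vertex. *)
Lemma tile_edgeP e : edge P e <-> exists i j, lf (n i) (n j) = 1 /\ e = geodesic (v i) (v j).
Proof.
split=> [[fe [p [q [pq ee]]]]|[i [j [ij1 ->]]]]; last first.
  split; first exact: tile_edge_face.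
  exists (v i), (v j); split=> // /(tf_inj fr) /eqP.
  by rewrite (negPf (tile_neq fr ij1)).
subst e; have [x gx] := geodesic_nonempty pq.
have Px : P x by case: fe => + _ _; apply.
have [l l0 ex] := proj1 (Pn x) Px.
have [i [j [ij li lj]]] := timelike_sum_pair (tile_null fr) l0 (tile_point_sum ex).
have sub a b : geodesic (v a) (v b) `<=` geodesic p q -> a != b -> v a = p \/ v a = q.
  move=> h ab; have vab : v a <> v b by move=> /(tf_inj fr) /eqP; rewrite (negPf ab).
  have sp : spanned (geodesic p q) (fun d => nv (pairv p q d)).
    by move=> y; rewrite (geodesic_hull pq) (ideal_hullP y (pairv_inj pq)).
  by have [[] <-] := extreme_ray (rays_nv (pairv p q)) sp vab h; [left|right].
have ji : j != i by rewrite eq_sym.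
have gij := tile_face_geodesic fe gx l0 ex ij li lj.
have gji := tile_face_geodesic fe gx l0 ex ji lj li.
have ge : geodesic p q = geodesic (v i) (v j).
  have vij : v i <> v j by move=> /(tf_inj fr) /eqP; rewrite (negPf ij).
  have [e1|e1] := sub _ _ gij ij; have [e2|e2] := sub _ _ gji ji; move: vij; rewrite ?e1 ?e2 //.
  by rewrite geodesicC.
exists i, j; split=> //; apply: (tile_pair_face fe _ gx l0 ex ij li lj) => eP.
have [k [ki kj]] := tile_third i j.
have gik a b : a != b -> geodesic (v a) (v b) `<=` geodesic p q.
  by rewrite eP {1}(tf_hull fr) => ab; exact: (geodesic_sub_hull (tf_inj fr) ab).
have := sub _ _ (gik _ _ ki) ki; have := sub _ _ gij ij; have := sub _ _ gji ji.
have vij : v i <> v j by move=> /(tf_inj fr) /eqP; rewrite (negPf ij).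
have vki : v k <> v i by move=> /(tf_inj fr) /eqP; rewrite (negPf ki).
have vkj : v k <> v j by move=> /(tf_inj fr) /eqP; rewrite (negPf kj).
move=> [] e1 [] e2 [] e3; move: vij vki vkj; by rewrite ?e1 ?e2 ?e3.
Qed.

Section Triangle.
Context (i j k : I).
Hypotheses (ij1 : lf (n i) (n j) = 1) (jk1 : lf (n j) (n k) = 1) (ik1 : lf (n i) (n k) = 1).

(** A supporting functional of the triangle: 0 + 1 + 1 - 2 at its vertices, at least 3 - 2 at the
    others. *)
Let f := n i + n j + n k - 2 *: c.
Let ij := tile_neq fr ij1.
Let jk := tile_neq fr jk1.
Let ik := tile_neq fr ik1.

Let vd a b : a != b -> v a <> v b.
Proof. by move=> ab /(tf_inj fr) /eqP; rewrite (negPf ab). Qed.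

Let fi : lf f (n i) = 0.
Proof. by rewrite /f !lfE (tile_null fr) (lfC (n j)) (lfC (n k)) ij1 ik1 (tf_center fr); lra. Qed.

Let fj : lf f (n j) = 0.
Proof. by rewrite /f !lfE (tile_null fr) (lfC (n k)) ij1 jk1 (tf_center fr); lra. Qed.

Let fk : lf f (n k) = 0.
Proof. by rewrite /f !lfE (tile_null fr) ik1 jk1 (tf_center fr); lra. Qed.

Let ft t : t != i -> t != j -> t != k -> 0 < lf f (n t).
Proof.
move=> ti tj tk; rewrite /f !lfE (tf_center fr).
have it : i != t by rewrite eq_sym.
have jt : j != t by rewrite eq_sym.
have kt : k != t by rewrite eq_sym.
have := tf_ge1 fr it; have := tf_ge1 fr jt; have := tf_ge1 fr kt; lra.
Qed.

Let f0 t : 0 <= lf f (n t).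
Proof.
have [->|ti] := eqVneq t i; first by rewrite fi.
have [->|tj] := eqVneq t j; first by rewrite fj.
have [->|tk] := eqVneq t k; first by rewrite fk.
by rewrite ltW // ft.
Qed.

Lemma tile_triangleE : ideal_triangle (v i) (v j) (v k) = [set x | P x /\ lf f (X x) = 0].
Proof.
have [s s0 es] := nr i; have [t t0 et] := nr j; have [r r0 er] := nr k.
apply/seteqP; split=> x.
  move=> /(ideal_triangleP x (vd ij) (vd jk) (vd ik))[a [b [d [a0 b0 d0 e]]]].
  have e' : X x = (a / s) *: n i + (b / t) *: n j + (d / r) *: n k.
    by rewrite e es et er !scalerA !divfK ?gt_eqF.
  split; last by rewrite e' !lfDr !lfZr fi fj fk !mulr0 !addr0.
  apply/Pn; rewrite e'; apply: coneD; [apply: coneD|]; apply: coneZ;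
    by [apply: divr_ge0 => //; exact: ltW|exact: cone_gen].
move=> [/Pn[l l0 e] fx]; rewrite e in fx.
have lt' a : a != i -> a != j -> a != k -> l a = 0.
  by move=> ai aj ak; exact: functional_zero f0 l0 fx _ (ft ai aj ak).
apply/(ideal_triangleP x (vd ij) (vd jk) (vd ik)).
exists (l i * s), (l j * t), (l k * r); split; try by apply: mulr_ge0 => //; exact: ltW.
have ji : j != i by rewrite eq_sym ij.
have ki : k != i by rewrite eq_sym ik.
have kj : k != j by rewrite eq_sym jk.
rewrite e (bigD1 i) //= (bigD1 j) //= (bigD1 k) /= ?ki // big1 ?addr0.
  by rewrite -!scalerA -es -et -er addrA.
by move=> a /andP[/andP[ai aj] ak]; rewrite lt' ?scale0r.
Qed.

Lemma tile_triangle_sub F : face P F ->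
  (forall x (l : I -> R), F x -> (forall t, 0 <= l t) -> X x = \sum_t l t *: n t ->
      forall t, 0 < l t -> [\/ t = i, t = j | t = k]) ->
  F `<=` ideal_triangle (v i) (v j) (v k).
Proof.
move=> fF h x Fx; rewrite tile_triangleE; have Px : P x by case: fF => + _ _; apply.
split=> //; have [l l0 ex] := proj1 (Pn x) Px.
rewrite ex lf_sumr; apply: big1 => t _; rewrite lfZr.
have [lt|lt] := ltrP 0 (l t).
  by case: (h x l Fx l0 ex t lt) => ->; rewrite ?fi ?fj ?fk mulr0.
by rewrite (_ : l t = 0) ?mul0r //; apply/eqP; rewrite eq_le lt l0.
Qed.

Lemma tile_triangle_facet : facet P (ideal_triangle (v i) (v j) (v k)).
Proof.
have fF : face P (ideal_triangle (v i) (v j) (v k)).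
  by rewrite tile_triangleE; exact: functional_face Pn _ f0.
split=> //.
  move=> e; have [t [ti tj tk]] : exists t, [/\ t != i, t != j & t != k].
    have : (0 < #|~: (k |: [set i; j])%SET|)%N.
      rewrite -(ltn_add2l #|(k |: [set i; j])%SET|) addn0 cardsC cardsU1 cards2.
      by case: (tf_card fr) => ->; case: (i != j); case: (_ \notin _).
    by case/card_gt0P => t; rewrite !inE !negb_or => /and3P[? ? ?]; exists t.
  have tn := tile_timelike fr ti (@ltr01 R) (@ltr01 R).
  have hP : hat P (1 *: n t + 1 *: n i).
    apply/(hat_spanned Pn); split=> //.
    by apply: coneD; apply: coneZ => //; exact: cone_gen.
  case: (hP) => _; rewrite -{1}e tile_triangleE => -[_].
  have [a a0 ea] := timelike_proj tn => h.
  have : lf f (1 *: n t + 1 *: n i) = 0 by rewrite ea lfZr h mulr0.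
  by rewrite !scale1r lfDr fi addr0; move: (ft ti tj tk) => /[swap] ->; rewrite ltxx.
move=> F' fF' F'P FF'.
have [//|[a [b [d [ab bd ad h]]]]] := tile_face_dichotomy fF'.
apply/seteqP; split=> //.
suff h' x (l : I -> R) : F' x -> (forall t, 0 <= l t) -> X x = \sum_t l t *: n t ->
    forall t, 0 < l t -> [\/ t = i, t = j | t = k] by exact: tile_triangle_sub.
have ts : timelike (n i + n j + n k).
  apply: timelikeDcausal; last exact: rays_causal nr k.
  by have := tile_timelike fr ij (@ltr01 R) (@ltr01 R); rewrite !scale1r.
pose y := hproj (n i + n j + n k).
have [e e0 ey] := timelike_proj ts.
have Fy : F' y.
  apply: FF'; rewrite tile_triangleE; have en : e != 0 by rewrite gt_eqF.
  have eX : X y = e^-1 *: (n i + n j + n k) by rewrite ey scalerA mulVf // scale1r.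
  split; last by rewrite eX lfZr !lfDr fi fj fk !addr0 mulr0.
  by apply/Pn; rewrite eX; apply: coneZ; [rewrite invr_ge0 ltW|apply: coneD; [apply: coneD|]; exact: cone_gen].
pose m t := if [|| t == i, t == j | t == k] then e^-1 else 0.
have ji : j != i by rewrite eq_sym ij.
have ki : k != i by rewrite eq_sym ik.
have kj : k != j by rewrite eq_sym jk.
have em : X y = \sum_t m t *: n t.
  have -> : X y = e^-1 *: (n i + n j + n k).
    by rewrite ey scalerA mulVf ?scale1r // gt_eqF.
  rewrite (bigD1 i) //= (bigD1 j) //= (bigD1 k) /= ?ki // big1 ?addr0.
    by rewrite /m !eqxx !orbT /= !scalerDr addrA.
  by move=> t /andP[/andP[/negPf ti /negPf tj] /negPf tk]; rewrite /m ti tj tk scale0r.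
have m0 t : 0 <= m t by rewrite /m; case: ifP => // _; rewrite invr_ge0 ltW.
have mp t : [|| t == i, t == j | t == k] -> 0 < m t by rewrite /m => ->; rewrite invr_gt0.
have hi := h y m Fy m0 em i (mp i _); have hj := h y m Fy m0 em j (mp j _).
have hk := h y m Fy m0 em k (mp k _).
rewrite !eqxx ?orbT in hi hj hk.
(* The barycentre of the triangle lies in [F'], so [i], [j], [k] are among [a], [b], [d]; by
   counting the two triples agree. *)
have full t : [\/ t = a, t = b | t = d] -> [\/ t = i, t = j | t = k].
  have sub : (i |: [set j; k] \subset a |: [set b; d])%SET.
    apply/fintype.subsetP => s; rewrite !inE => /or3P[]/eqP ->.
    - by case: (hi isT) => ->; rewrite eqxx ?orbT.
    - by case: (hj isT) => ->; rewrite eqxx ?orbT.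
    - by case: (hk isT) => ->; rewrite eqxx ?orbT.
  have cd : (#|a |: [set b; d]| <= #|i |: [set j; k]|)%N%SET.
    rewrite !cardsU1 !cards1 !inE (negPf ij) (negPf ik) (negPf jk) /=.
    by case: (_ || _) => /=; case: (b == d).
  have e3 : (i |: [set j; k] = a |: [set b; d])%SET by apply/eqP; rewrite eqEcard sub.
  move=> ht; have : (t \in a |: [set b; d])%SET.
    by rewrite !inE; case: ht => ->; rewrite eqxx ?orbT.
  by rewrite -e3 !inE => /or3P[]/eqP ->; [constructor 1|constructor 2|constructor 3].
by move=> Fx l0 ex t lt; apply: full; exact: h Fx l0 ex t lt.
Qed.

End Triangle.

Lemma tile_facetP F : facet P F <-> exists i j k,
  [/\ lf (n i) (n j) = 1, lf (n j) (n k) = 1, lf (n i) (n k) = 1 &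
    F = ideal_triangle (v i) (v j) (v k)].
Proof.
split=> [[fF FP Fmax]|[i [j [k [ij jk ik ->]]]]]; last exact: tile_triangle_facet.
have [//|[i [j [k [ij jk ik h]]]]] := tile_face_dichotomy fF.
exists i, j, k; split=> //; have [ft tP _] := tile_triangle_facet ij jk ik.
by apply/esym/Fmax => //; exact: tile_triangle_sub.
Qed.

End Frame.

End TileFaces.

(** * Consistency of the packings of the tiles *)

Section Consistency.
Context (R : realType).
Implicit Types (u : vec R) (x y z : H3 R) (p q r : ideal R) (A F B P Q : set (H3 R)).

Record framed (I : finType) P (v : I -> ideal R) n c : Prop := Framed {
  fr_tile : tile_frame P v n c;
  fr_tr : vertex_transitive P v }.

Definition has_frame P := exists (I : finType) (v : I -> ideal R) n c, framed P v n c.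

Lemma regular_has_frame P :
  regular_ideal_tetrahedron P \/ regular_ideal_octahedron P -> has_frame P.
Proof.
move=> [/regular_tetrahedron_frame[v [n [c [h1 h2]]]]|/regular_octahedron_frame[v [n [c [h1 h2 _]]]]].
  by exists 'I_4, v, n, c.
by exists ('I_3 * bool)%type, v, n, c.
Qed.

Lemma rays_ball_inj (I J : finType) (v : I -> ideal R) (w : J -> ideal R) n m i j :
  rays v n -> rays w m -> hball (n i) = hball (m j) -> v i = w j /\ n i = m j.
Proof.
move=> nr mr; have [s s0 ->] := nr i; have [t t0 ->] := mr j.
by move=> /(hball_inj s0 t0)[-> ->].
Qed.

Lemma HP_framed (I : finType) P (v : I -> ideal R) n c : framed P v n c ->
  HP P = [set hball (n i) | i in [set: I]].
Proof. by move=> [h1 h2]; rewrite (HP_tile h1 h2). Qed.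

Lemma framed_ball (I J : finType) P Q (v : I -> ideal R) (w : J -> ideal R) n m c d i :
  tile_frame P v n c -> framed Q w m d -> HP Q (hball (n i)) -> exists j, w j = v i /\ m j = n i.
Proof.
move=> h1 h2; rewrite (HP_framed h2) => -[j _ e]; exists j.
by have [-> ->] := rays_ball_inj (tf_rays (fr_tile h2)) (tf_rays h1) e.
Qed.

Section OneTile.
Context (I : finType) (P : set (H3 R)) (v : I -> ideal R) (n : I -> vec R) (c : vec R).
Hypotheses (fr : tile_frame P v n c).

(** The total weight is the pairing with the centre vector, whose square is at least
    [2 * lf c c]. *)
Lemma tile_sum_gt1 x (l : I -> R) : (forall i, 0 <= l i) -> X x = \sum_i l i *: n i ->
  1 < \sum_i l i.
Proof.
move=> l0 e.
have E : lf c (X x) = \sum_i l i.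
  by rewrite e lf_sumr; apply: eq_bigr => i _; rewrite lfZr (tf_center fr) mulr1.
have h := reverse_cs c (X_timelike x); rewrite lf_XX E in h.
have := tf_cc fr; have : 0 <= \sum_i l i by apply: sumr_ge0.
by nra.
Qed.

Lemma lf_combo_ge (l : I -> R) (w : vec R) : (forall i, 0 <= l i) ->
  (forall i, 0 < l i -> 1 <= lf (n i) w) -> \sum_i l i <= lf (\sum_i l i *: n i) w.
Proof.
move=> l0 h; rewrite lf_suml; apply: ler_sum => i _; rewrite lfZl.
have [li|li] := ltrP 0 (l i); first by rewrite ler_peMr ?h.
by rewrite (_ : l i = 0) ?mul0r //; apply/eqP; rewrite eq_le li l0.
Qed.

(** Without weight at [i], every term would pair with [n i] to at least its own weight, giving a
    total above 1. *)
Lemma tile_ball_support x (l : I -> R) i : (forall i, 0 <= l i) -> X x = \sum_i l i *: n i ->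
  hball (n i) x -> 0 < l i.
Proof.
move=> l0 e; rewrite /hball /= => hx; rewrite lt_neqAle l0 andbT; apply/negP => /eqP li.
have h1 := tile_sum_gt1 l0 e.
have h2 : \sum_i l i <= lf (X x) (n i).
  rewrite e; apply: lf_combo_ge => // j lj; apply: (tf_ge1 fr).
  by apply/eqP => ji; move: lj; rewrite ji -li ltxx.
by move: (lt_le_trans h1 (le_trans h2 hx)); rewrite ltxx.
Qed.

Lemma tile_ball_meets i : exists x, P x /\ hball (n i) x.
Proof.
have [j ji] := tile_card_gt1 fr i.
have vij : v i <> v j by move=> /(tf_inj fr) /eqP; rewrite eq_sym (negPf ji).
have [s s0 es] := tf_rays fr i; have g0 := lf_nv_gt0 vij.
have b0 : 0 < (s * lf (nv (v i)) (nv (v j)))^-1 by rewrite invr_gt0 mulr_gt0.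
have [x [ex xi _]] := geodesic_point vij b0; exists x; split.
  apply/(tile_spanned fr)/(cone_rescale (tf_rays fr)); rewrite ex.
  have gen a : cone (fun i => nv (v i)) (nv (v a)) by exact: (cone_gen (fun i => nv (v i))).
  apply: coneD; apply: coneZ => //; last exact: ltW.
  by rewrite invr_ge0; apply: mulr_ge0; exact: ltW.
rewrite /hball /= es lfZr xi.
have -> : s * ((s * lf (nv (v i)) (nv (v j)))^-1 * lf (nv (v i)) (nv (v j))) = 1.
  by field; rewrite !gt_eqF.
exact: lexx.
Qed.

End OneTile.

Lemma seg_norm u w (r : R) : 0 <= r <= 1 -> 2 <= lf u u -> 2 <= lf w w -> 2 <= lf u w ->
  2 <= lf (seg u w r) (seg u w r).
Proof.
move=> /andP[r0 r1] uu ww uw; rewrite /seg !lfE (lfC w u).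
have h1 : 0 <= (1 - r) ^+ 2 * (lf u u - 2) by rewrite mulr_ge0 ?sqr_ge0 ?subr_ge0.
have h2 : 0 <= r ^+ 2 * (lf w w - 2) by rewrite mulr_ge0 ?sqr_ge0 ?subr_ge0.
have h3 : 0 <= r * (1 - r) * (lf u w - 2) by rewrite !mulr_ge0 ?subr_ge0.
lra.
Qed.

(** The chord between two points of the hyperboloid has norm at least 2; the pairing with [k], at
    most 1 along it by linearity, is divided by a number at least 1 when the chord is normalised. *)
Lemma hball_seg (k : vec R) x y (r : R) : hball k x -> hball k y -> causal k -> 0 <= r <= 1 ->
  hball k (hproj (seg (X x) (X y) r)).
Proof.
rewrite /hball /= => hx hy kc r01.
have ts := seg_timelike (X_timelike x) (X_timelike y) r01.
have s2 : 2 <= lf (seg (X x) (X y) r) (seg (X x) (X y) r).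
  by apply: seg_norm => //; rewrite ?lf_XX ?lf_X_ge2.
rewrite X_proj // lfZl.
have s1 : 1 <= Num.sqrt (lf (seg (X x) (X y) r) (seg (X x) (X y) r) / 2).
  by rewrite -{1}(sqrtr1 R) ler_wsqrtr // ler_pdivlMr // mul1r.
have : lf (seg (X x) (X y) r) k <= 1.
  by move: r01 => /andP[r0 r1]; rewrite /seg !lfE; nra.
rewrite mulrC ler_pdivrMr ?mul1r ?(lt_le_trans _ s1) // => h; exact: le_trans s1.
Qed.

(** * Neighbouring tiles and paths through a tiling *)

Section InTiling.
Context (T : set (set (H3 R))).
Hypotheses (hT : tiling T) (hF : forall P, T P -> has_frame P).

(** Local finiteness leaves finitely many tiles to avoid, and those that miss [x] are closed. *)
Lemma near_tiles x : nbhs x [set y | forall Q, T Q -> Q y -> Q x].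
Proof.
case: hT => poly _ /(_ x)[U Ux fin] _ _.
pose D := [set Q | (T Q /\ Q `&` U !=set0) /\ ~ Q x].
have Dfin : finite_set D by apply: sub_finite_set fin => Q [].
have nD Q : D Q -> nbhs x (~` Q).
  move=> [[TQ _] nQ]; apply: open_nbhs_nbhs; split=> //; apply: closed_openC.
  exact: polyhedron_closed (poly _ TQ).
have h : nbhs x [set y | forall Q, D Q -> ~ Q y].
  have /finite_seqP[s eD] := Dfin; rewrite eD in nD *.
  elim: s {eD} nD => [|Q s ih] nD; first by apply: filterS filterT => y _ Q.
  have h1 : nbhs x (~` Q) by apply: nD; rewrite /= inE eqxx.
  have h2 := ih (fun Q' hQ' => nD Q' (mem_behead (s := Q :: s) hQ')).
  apply: (@filterS _ _ (nbhs_filter x) _ _ _ (filterI h1 h2)) => y [nQ hs] Q' /=.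
  by rewrite inE => /predU1P[->//|]; exact: hs.
apply: (@filterS _ _ (nbhs_filter x) _ _ _ (filterI Ux h)) => y [Uy Dy] Q TQ Qy.
apply: contrapT => nQ; apply: (Dy Q) => //; split=> //; split=> //.
by exists y.
Qed.

Lemma tile_at x : exists2 Q, T Q & Q x.
Proof.
case: hT => _ cov _ _ _; have [Q TQ Qx] : (\bigcup_(Q in T) Q) x by rewrite cov.
by exists Q.
Qed.

(** That all tiles at the current point satisfy [G] is a locally constant condition along the path,
    since the tiles at nearby points are among those at the point itself. *)
Lemma tiles_path (G : set (H3 R) -> Prop) u w P Q : timelike u -> timelike w ->
  (forall r : R, 0 <= r <= 1 -> forall Q1 Q2, T Q1 -> T Q2 ->
     Q1 (hproj (seg u w r)) -> Q2 (hproj (seg u w r)) -> G Q1 -> G Q2) ->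
  T P -> T Q -> P (hproj u) -> Q (hproj w) -> G P -> G Q.
Proof.
move=> tu tw h TP TQ Pu Qw GP.
have r01 : 0 <= (0 : R) <= 1 by apply/andP; split.
have r11 : 0 <= (1 : R) <= 1 by apply/andP; split.
pose C (r : R) := forall Q1, T Q1 -> Q1 (hproj (seg u w r)) -> G Q1.
suff C1 : C 1 by apply: (C1 Q TQ); rewrite seg1.
apply: (@segment_locally_constant R C).
  move=> r hr; have := near_seg tu tw hr (near_tiles _).
  apply: filterS => s hs s01; split=> [Gr Q1 TQ1 /(hs _ TQ1) | Gs Q1 TQ1 Q1r]; first exact: Gr.
  have [Q2 TQ2 Q2s] := tile_at (hproj (seg u w s)).
  by apply: (h r hr Q2 Q1) => //; [exact: hs|exact: Gs].
by move=> Q1 TQ1 Q1u; apply: (h 0 r01 P Q1) => //; rewrite seg0.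
Qed.

Section TwoTiles.
Context (I J : finType) (P Q : set (H3 R)) (v : I -> ideal R) (w : J -> ideal R)
  (n : I -> vec R) (m : J -> vec R) (c d : vec R).
Hypotheses (TP : T P) (TQ : T Q) (fP : framed P v n c) (fQ : framed Q w m d).
Hypothesis PQ : P <> Q.
Let frP := fr_tile fP.
Let frQ := fr_tile fQ.
Let F := P `&` Q.

Let faceP' : face P F. Proof. by case: hT => _ _ _ _ h; case: (h _ _ TP TQ). Qed.
Let faceQ' : face Q F. Proof. by case: hT => _ _ _ _ h; case: (h _ _ TP TQ). Qed.

Let FP : F <> P.
Proof.
move=> e; apply: PQ; apply/esym/(tile_sub_eq hT) => //.
by rewrite -e => x [].
Qed.

Let FQ : F <> Q.
Proof.
move=> e; apply: PQ; apply: (tile_sub_eq hT) => //.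
by rewrite -e => x [].
Qed.

(** [P] and [Q] meet in a proper face of both. Two vertices of positive weight at a common point
    span a geodesic in that face; its ends are then vertices of [Q] too, adjacent there for the same
    reason. *)
Lemma shared_edge x (l : I -> R) i j : P x -> Q x -> (forall i, 0 <= l i) ->
  X x = \sum_i l i *: n i -> i != j -> 0 < l i -> 0 < l j ->
  lf (n i) (n j) = 1 /\ exists i' j', [/\ w i' = v i, w j' = v j & lf (m i') (m j') = 1].
Proof.
move=> Px Qx l0 e ij li lj; have ji : j != i by rewrite eq_sym.
have Fx : F x by split.
have vij : v i <> v j by move=> /(tf_inj frP) /eqP; rewrite (negPf ij).
have gF := tile_face_geodesic frP faceP' Fx l0 e ij li lj.
have h1 := tile_pair_face frP faceP' FP Fx l0 e ij li lj.
split; first exact: h1.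
have gQ : geodesic (v i) (v j) `<=` Q by move=> y /gF[].
have [i' ei] := extreme_ray (tf_rays frQ) (tile_spanned frQ) vij gQ.
have [j' ej] : exists j', w j' = v j.
  apply: (extreme_ray (tf_rays frQ) (tile_spanned frQ) (q := v i)) => [h|]; first exact: vij.
  by rewrite geodesicC.
exists i', j'; split=> //.
have i'j' : i' != j' by apply/eqP => e'; apply: vij; rewrite -ei -ej e'.
have [y gy] := geodesic_nonempty vij.
have := gy; rewrite -ei -ej => gy'; have vij' : w i' <> w j' by rewrite ei ej.
have [a [b [a0 b0 ey]]] := proj1 (geodesicP y vij') gy'.
have [s s0 es] := tf_rays frQ i'; have [t t0 et] := tf_rays frQ j'.
pose k h := if h == i' then a / s else if h == j' then b / t else 0.
have j'i' : j' != i' by rewrite eq_sym.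
have k0 h : 0 <= k h.
  by rewrite /k; case: eqP => _; [|case: eqP => _ //]; rewrite ltW // divr_gt0.
apply: (tile_pair_face frQ faceQ' FQ (gF _ gy) k0 _ i'j').
- rewrite ey (bigD1 i') //= (bigD1 j') //= /k eqxx (negPf j'i') eqxx big1 ?addr0.
    by rewrite es et !scalerA !divfK ?gt_eqF.
  by move=> h /andP[hi hj]; rewrite (negPf hi) (negPf hj) scale0r.
- by rewrite /k eqxx divr_gt0.
by rewrite /k (negPf j'i') eqxx divr_gt0.
Qed.

(** The factors [s], [t], [r] relating the two frames satisfy [s * t = t * r = s * r = 1], hence are
    1; a single edge would leave [s] free. *)
Lemma shared_triangle x (l : I -> R) i j k : P x -> Q x -> (forall i, 0 <= l i) ->
  X x = \sum_i l i *: n i -> i != j -> j != k -> i != k -> 0 < l i -> 0 < l j -> 0 < l k ->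
  exists i', m i' = n i.
Proof.
move=> Px Qx l0 e ij jk ik li lj lk.
have [ij1 [i1 [j1 [ei1 ej1 h1]]]] := shared_edge Px Qx l0 e ij li lj.
have [jk1 [j2 [k1 [ej2 ek1 h2]]]] := shared_edge Px Qx l0 e jk lj lk.
have [ik1 [i2 [k2 [ei2 ek2 h3]]]] := shared_edge Px Qx l0 e ik li lk.
have e1 : i2 = i1 by apply: (tf_inj frQ); rewrite ei1 ei2.
have e2 : j2 = j1 by apply: (tf_inj frQ); rewrite ej1 ej2.
have e3 : k2 = k1 by apply: (tf_inj frQ); rewrite ek1 ek2.
subst i2 j2 k2; exists i1.
have ratio a b : w b = v a -> exists2 s, 0 < s & m b = s *: n a.
  move=> eab; have [s s0 es] := tf_rays frQ b; have [t t0 et] := tf_rays frP a.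
  by exists (s / t); rewrite ?divr_gt0 // es et eab scalerA divfK // gt_eqF.
have [s s0 es] := ratio _ _ ei1; have [t t0 et] := ratio _ _ ej1; have [r r0 er] := ratio _ _ ek1.
rewrite es et !lfE ij1 mulr1 in h1; rewrite et er !lfE jk1 mulr1 in h2.
rewrite es er !lfE ik1 mulr1 in h3.
have tr : t = r by apply: (mulfI (lt0r_neq0 s0)); rewrite h1 h3.
have s1 : s = 1.
  have st : s = t by apply: (mulIf (lt0r_neq0 r0)); rewrite h3 h2.
  by apply/eqP; rewrite -(@pexpr_eq1 _ s 2) // ?ltW // expr2 {2}st h1.
by rewrite es s1 scale1r.
Qed.

End TwoTiles.

(* If the tiles share only an edge, walk round it along a small segment that
   avoids the plane spanned by the edge: consecutive tiles on the way share a
   triangle. *)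
Lemma horoball_local (I : finType) P Q (v : I -> ideal R) n c x i : T P -> T Q ->
  framed P v n c -> P x -> Q x -> hball (n i) x -> HP Q (hball (n i)).
Proof.
move=> TP TQ fP Px Qx hx; have frP := fr_tile fP.
have HPP : HP P (hball (n i)) by rewrite (HP_framed fP); exists i.
have [<-//|PQ] := pselect (P = Q).
have [J [w [m [d fQ]]]] := hF TQ; have frQ := fr_tile fQ.
have HQ i' : m i' = n i -> HP Q (hball (n i)) by rewrite (HP_framed fQ) => <-; exists i'.
have [l l0 ex] := proj1 (tile_spanned frP x) Px.
have li := tile_ball_support frP l0 ex hx.
have [j ij lj] : exists2 j, i != j & 0 < l j.
  have [i1 [j1 [ij1 li1 lj1]]] := timelike_sum_pair (tile_null frP) l0 (tile_point_sum ex).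
  by have [ii|ii] := eqVneq i i1; [exists j1; rewrite ?ii|exists i1].
have [[k [ik jk lk]]|two] := pselect (exists k, [/\ i != k, j != k & 0 < l k]).
  have [i' ei] := shared_triangle TP TQ fP fQ PQ Px Qx l0 ex ij jk ik li lj lk.
  exact: HQ ei.
have ex2 : X x = l i *: n i + l j *: n j.
  have ji : j != i by rewrite eq_sym.
  rewrite ex (bigD1 i) //= (bigD1 j) //= big1 ?addr0 // => k /andP[ki kj].
  rewrite (_ : l k = 0) ?scale0r //; apply/eqP; rewrite eq_le l0 andbT leNgt; apply/negP => lk.
  by apply: two; exists k; split=> //; rewrite eq_sym.
have [ij1 [i' [j' [ei ej ij1']]]] := shared_edge TP TQ fP fQ PQ Px Qx l0 ex ij li lj.
pose span u := exists a b : R, u = a *: n i + b *: n j.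
have spanZ (a : R) u : span u -> span (a *: u).
  by move=> [b [e ->]]; exists (a * b), (a * e); rewrite scalerDr !scalerA.
have spanD u1 u2 : span u1 -> span u2 -> span (u1 + u2).
  by move=> [a [b ->]] [a' [b' ->]]; exists (a + a'), (b + b'); rewrite !scalerDl addrACA.
have spanx : span (X x) by exists (l i), (l j).
have spanK (a : R) u : a != 0 -> span (a *: u) -> span u.
  by move=> a0 /(spanZ a^-1); rewrite scalerA mulVf ?scale1r.
(* A vertex of [P] off the plane spanned by the edge gives the start of the path. *)
have [k [k0 [_ _ _ _ wP]]] := tf_wedge frP ij1.
have nk : ~ span (n k).
  move=> [a [b e]]; have [h _] : (-1 : R) = 0 /\ (0 : R) = 0.
    by apply: (wP a b); rewrite e scale0r addr0 scaleN1r subrr.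
  by move/eqP: h; rewrite oppr_eq0 oner_eq0.
have [k1 [k2 [_ _ _ _ wQ]]] := tf_wedge frQ ij1'.
have spanQ u : span u -> exists a b : R, u = a *: m i' + b *: m j'.
  move=> [a [b ->]].
  have [s s0 ->] := tf_rays frP i; have [t t0 ->] := tf_rays frP j.
  have [s' s0' es] := tf_rays frQ i'; have [t' t0' et] := tf_rays frQ j'.
  exists (a * s / s'), (b * t / t').
  by rewrite es et ei ej !scalerA !divfK ?gt_eqF.
(* The end of the path is chosen in [Q] so that the segment from [n k] to [m k'] misses the plane.
   One of the two vertices supplied by [Q] works: otherwise eliminating [n k] would give a relation
   between them modulo the plane. *)
have [k' hk'] : exists k', forall a : R, ~ span (m k' + a *: n k).
  apply: contrapT => hn.
  have [a1 /contrapT h1] : exists a, ~ ~ span (m k1 + a *: n k).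
    by apply/existsNP => h; apply: hn; exists k1.
  have [a2 /contrapT h2] : exists a, ~ ~ span (m k2 + a *: n k).
    by apply/existsNP => h; apply: hn; exists k2.
  have /spanQ[a [b e]] : span (a2 *: m k1 + (- a1) *: m k2).
    have := spanD _ _ (spanZ a2 _ h1) (spanZ (- a1) _ h2).
    rewrite !scalerDr !scalerA mulNr (mulrC a1) addrACA.
    by rewrite [X in _ + X](_ : _ = 0) ?addr0 // -scalerDl subrr scale0r.
  have [a20 a10] : - a2 = 0 /\ a1 = 0.
    by apply: (wQ a b); rewrite -e !scaleNr addrAC subrK subrr.
  move: h1; rewrite a10 scale0r addr0 => /spanQ[a' [b' e']].
  have [h _] : (-1 : R) = 0 /\ (0 : R) = 0.
    by apply: (wQ a' b'); rewrite -e' scale0r addr0 scaleN1r subrr.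
  by move/eqP: h; rewrite oppr_eq0 oner_eq0.
have nx := near_tiles x; set U := [set y | _] in nx.
have /interior_hat/nbhs_ballP[e /= e0 he] : U^° x by exact: nx.
pose M := `|n k| + `|m k'| + 1.
have M0 : 0 < M by rewrite ltr_wpDl // addr_ge0.
(* Small enough that the whole segment from [u0] to [u1] stays where every tile contains [x]. *)
pose f := e / 2 / M.
have f0 : 0 < f by rewrite !divr_gt0.
pose u0 := X x + f *: n k; pose u1 := X x + f *: m k'.
have segE (r : R) : seg u0 u1 r = X x + f *: ((1 - r) *: n k + r *: m k').
  rewrite /seg /u0 /u1 !scalerDr addrACA -scalerDl subrK scale1r.
  by rewrite !scalerA !(mulrC f).
have tu0 : timelike u0.
  apply: timelikeDcausal; first exact: X_timelike.
  by apply: causalZ; [exact: ltW|exact: rays_causal (tf_rays frP) k].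
have tu1 : timelike u1.
  apply: timelikeDcausal; first exact: X_timelike.
  by apply: causalZ; [exact: ltW|exact: rays_causal (tf_rays frQ) k'].
have segU (r : R) : 0 <= r <= 1 -> U (hproj (seg u0 u1 r)).
  move=> /andP[r0 r1]; have [] // : hat U (seg u0 u1 r).
  apply: he; rewrite -ball_normE /ball_ /= segE opprD addrA subrr sub0r normrN normrZ gtr0_norm //.
  have : `|(1 - r) *: n k + r *: m k'| <= M.
    apply: le_trans (ler_normD _ _) _; rewrite !normrZ !ger0_norm ?subr_ge0 //.
    have h1 := normr_ge0 (n k); have h2 := normr_ge0 (m k'); rewrite /M; nra.
  rewrite -(ler_pM2l f0) => h; apply: le_lt_trans h _.
  by rewrite /f divfK ?gt_eqF //; lra.
apply: (tiles_path (G := fun Q1 => HP Q1 (hball (n i))) tu0 tu1 _ TP TQ) => //; last 2 first.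
- suff [] : hat P u0 by [].
  apply/(hat_spanned (tile_spanned frP)); split=> //; apply: coneD; first exact/(tile_spanned frP).
  by apply: coneZ; [exact: ltW|exact: cone_gen].
- suff [] : hat Q u1 by [].
  apply/(hat_spanned (tile_spanned frQ)); split=> //; apply: coneD; first exact/(tile_spanned frQ).
  by apply: coneZ; [exact: ltW|exact: cone_gen].
move=> r r01 Q1 Q2 TQ1 TQ2 Q1r Q2r G1.
have [<-//|Q12] := pselect (Q1 = Q2).
have Q1x := segU r r01 Q1 TQ1 Q1r; have Q2x := segU r r01 Q2 TQ2 Q2r.
have [I1 [v1 [n1 [c1 f1]]]] := hF TQ1; have fr1 := fr_tile f1.
have [I2 [v2 [n2 [c2 f2]]]] := hF TQ2.
have [i1 [_ ei1]] := framed_ball frP f1 G1.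
have [l1 l10 ex1] := proj1 (tile_spanned fr1 x) Q1x.
have hx1 : hball (n1 i1) x by rewrite ei1.
have li1 := tile_ball_support fr1 l10 ex1 hx1.
have [j1 ij11 lj1] : exists2 j1, i1 != j1 & 0 < l1 j1.
  have [a [b [ab la lb]]] := timelike_sum_pair (tile_null fr1) l10 (tile_point_sum ex1).
  by have [ii|ii] := eqVneq i1 a; [exists b; rewrite ?ii|exists a].
have tur := seg_timelike tu0 tu1 r01.
have [h1 h10 ur1] : cone n1 (seg u0 u1 r).
  by have [] := proj1 (hat_spanned (tile_spanned fr1) (seg u0 u1 r)) (conj tur Q1r).
(* Adding [X x] gives a common point of [Q1] and [Q2] whose support contains those of [x] and of the
   path point. *)
have tz : timelike (X x + seg u0 u1 r) by apply: timelikeD => //; exact: X_timelike.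
have inz Q3 : T Q3 -> Q3 x -> Q3 (hproj (seg u0 u1 r)) -> Q3 (hproj (X x + seg u0 u1 r)).
  move=> TQ3 Q3x Q3r; have [_] // : hat Q3 (X x + seg u0 u1 r).
  have poly3 : hconvex Q3 by case: hT => h _ _ _ _; exact: polyhedron_convex (h _ TQ3).
  by apply: (proj1 (hconvexP Q3) poly3) => //; apply/hat_X.
have [b b0 ez] := timelike_proj tz.
pose l2 t := b^-1 * (l1 t + h1 t).
have ezs : X (hproj (X x + seg u0 u1 r)) = \sum_t l2 t *: n1 t.
  apply: (scalerI (lt0r_neq0 b0)); rewrite -ez ex1 ur1 scaler_sumr -big_split /=.
  apply: eq_bigr => t _; rewrite scalerA /l2 mulrA mulfV ?gt_eqF // mul1r.
  by rewrite scalerDl.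
have l20 t : 0 <= l2 t by rewrite mulr_ge0 ?addr_ge0 // invr_ge0 ltW.
have l2p t : 0 < l1 t -> 0 < l2 t by move=> lt; rewrite mulr_gt0 ?invr_gt0 // ltr_wpDr.
have l2h t : 0 < h1 t -> 0 < l2 t by move=> lt; rewrite mulr_gt0 ?invr_gt0 // ltr_wpDl.
have [[k3 [ik3 jk3 lk3]]|two1] := pselect (exists t, [/\ i1 != t, j1 != t & 0 < l2 t]).
  have [i2 ei2] := shared_triangle TQ1 TQ2 f1 f2 Q12 (inz _ TQ1 Q1x Q1r) (inz _ TQ2 Q2x Q2r)
    l20 ezs ij11 jk3 ik3 (l2p _ li1) (l2p _ lj1) lk3.
  by rewrite (HP_framed f2) -ei1 -ei2; exists i2.
(* With support only on [i1] and [j1], whose span is the plane of the edge, the path point would lie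
   in that plane. *)
exfalso.
have red (h : I1 -> R) : (forall t, 0 <= h t) -> (forall t, 0 < h t -> 0 < l2 t) ->
    \sum_t h t *: n1 t = h i1 *: n i + h j1 *: n1 j1.
  move=> h0 hp; have ji11 : j1 != i1 by rewrite eq_sym.
  rewrite (bigD1 i1) //= (bigD1 j1) //= big1 ?addr0 ?ei1 // => t /andP[ti tj].
  rewrite (_ : h t = 0) ?scale0r //; apply/eqP; rewrite eq_le h0 andbT leNgt; apply/negP => ht.
  by apply: two1; exists t; split; rewrite 1?eq_sym ?hp.
have sj : span (n1 j1).
  have e1 := red l1 l10 l2p; rewrite -ex1 ex2 in e1.
  apply: (spanK (l1 j1)); first by rewrite gt_eqF.
  exists (l i - l1 i1), (l j); by rewrite scalerBl addrAC e1 addrAC subrr add0r.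
have sr : span (seg u0 u1 r).
  rewrite ur1 (red h1 h10 l2h); apply: spanD; last exact: spanZ.
  by exists (h1 i1), 0; rewrite scale0r addr0.
have sd : span ((1 - r) *: n k + r *: m k').
  apply: (spanK f); first by rewrite gt_eqF.
  have -> : f *: ((1 - r) *: n k + r *: m k') = seg u0 u1 r + (-1) *: X x.
    by rewrite segE scaleN1r addrAC subrr add0r.
  by apply: spanD => //; exact: spanZ.
have [r0|r0] := eqVneq r 0.
  by apply: nk; move: sd; rewrite r0 subr0 scale1r scale0r addr0.
apply: (hk' ((1 - r) / r)); apply: (spanK r) => //.
by rewrite scalerDr scalerA mulrC divfK // addrC.
Qed.

(** A horoball is convex and meets its own tile, so a segment inside it leads to any of its points,
    and every change of tile on the way is local. *)
Lemma horoball_global (I : finType) P Q (v : I -> ideal R) n c x i : T P -> T Q ->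
  framed P v n c -> Q x -> hball (n i) x -> HP Q (hball (n i)).
Proof.
move=> TP TQ fP Qx hx; have frP := fr_tile fP.
have [y [Py hy]] := tile_ball_meets frP i.
have HPP : HP P (hball (n i)) by rewrite (HP_framed fP); exists i.
apply: (tiles_path (G := fun Q1 => HP Q1 (hball (n i))) (X_timelike y) (X_timelike x) _ TP TQ);
  rewrite ?proj_X //.
move=> r r01 Q1 Q2 TQ1 TQ2 Q1r Q2r G1.
have [I1 [v1 [n1 [c1 f1]]]] := hF TQ1.
have [i1 [_ ei1]] := framed_ball frP f1 G1.
have := horoball_local (i := i1) TQ1 TQ2 f1 Q1r Q2r; rewrite ei1; apply.
by apply: hball_seg => //; exact: rays_causal (tf_rays frP) i.
Qed.

End InTiling.

End Consistency.

(** * The packing of a tiling *)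

Section TilingPacking.
Context (R : realType).
Implicit Types (u : vec R) (x y z : H3 R) (p q r : ideal R) (A F B P Q : set (H3 R)).

(** Recognises the balls of [HP P] from any family with the right vertex products, whatever frame
    [P] carries; it serves for images under isometries and for standard position. *)
Lemma HP_canonical (J : finType) P (w : J -> ideal R) m j : has_frame P -> injective w ->
  P = ideal_hull (range w) -> rays w m -> (#|J| = 4 \/ #|J| = 6)%N ->
  (forall i, \prod_(k | k != i) lf (m i) (m k) = vertex_product R #|J|) ->
  HP P (hball (m j)).
Proof.
move=> [I [v [n [c fP]]]] wI PW mr J46 pm; have frP := fr_tile fP.
have e : ideal_hull (range v) = ideal_hull (range w) by rewrite -PW (tf_hull frP).
have n0 : ideal_hull (range v) !=set0 by rewrite -(tf_hull frP); exact: tile_nonempty frP.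
have n1 : ideal_hull (range w) !=set0 by rewrite -e.
have vw i : exists j, w j = v i by exact: hull_vertex (tf_inj frP) wI n0 e.
have wv k : exists i, v i = w k by exact: hull_vertex wI (tf_inj frP) n1 (esym e).
have le (A B : finType) (a : A -> ideal R) (b : B -> ideal R) :
    injective a -> (forall i, exists j, b j = a i) -> (#|A| <= #|B|)%N.
  move=> aI /choice[f hf]; apply: (@leq_card _ _ f) => i k ik.
  by apply: aI; rewrite -!hf ik.
have IJ : #|I| = #|J|.
  by apply/eqP; rewrite eqn_leq (le _ _ _ _ (tf_inj frP) vw) (le _ _ _ _ wI wv).
have [i ei] := wv j; rewrite (HP_framed fP); exists i => //.
congr hball; apply: esym.
exact: (canonical_unique (tf_inj frP) wI (tf_rays frP) mr IJ (tf_card frP) (tf_prod frP) pm vw (esym ei)).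
Qed.

Lemma HP_image (g : H3 R -> H3 R) P B : is_isometry g -> has_frame P -> has_frame (g @` P) ->
  HP P B -> HP (g @` P) (g @` B).
Proof.
move=> gi [I [v [n [c fP]]]] fgP; rewrite {1}(HP_framed fP) => -[i _ <-].
have frP := fr_tile fP; have [L gL] := isometry_linear gi; have [gB _] := gi.
have [phi Lphi] := boundary_action_exists gL; rewrite (image_hball gB gL).
apply: (@HP_canonical I _ (fun i => phi (v i)) (fun i => L (n i))) => //.
- by move=> a b /(boundary_action_inj gL Lphi) /(tf_inj frP).
- by rewrite {1}(tf_hull frP) (image_hull gB gL Lphi (tf_inj frP)).
- by have h := image_rays gL Lphi (tf_rays frP); exact: h.
- exact: tf_card frP.
by move=> k; rewrite -(tf_prod frP k); apply: eq_bigr => l _; rewrite (lin_lf gL).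
Qed.

(** Rules out [tangent B B], since [tangent] does not ask its arguments to differ. *)
Lemma hball_not_singleton p (s : R) x : 0 < s -> hball (s *: nv p) <> [set x].
Proof.
move=> s0 e; have [q pq] := ideal_other p; have g0 := lf_nv_gt0 pq.
have b0 : 0 < (2 * s * lf (nv p) (nv q))^-1 by rewrite invr_gt0 !mulr_gt0.
have [y [_ yp _]] := geodesic_point pq b0.
have : (hball (s *: nv p))^° y.
  apply: hball_interior; rewrite lfZr yp.
  have -> : s * ((2 * s * lf (nv p) (nv q))^-1 * lf (nv p) (nv q)) = 2^-1.
    by field; rewrite !gt_eqF.
  lra.
by rewrite e interior_singleton.
Qed.

Section Fixed.
Context (T : set (set (H3 R))).
Hypotheses (hT : tiling T) (hF : forall P, T P -> has_frame P).

Definition tiling_packing : set (set (H3 R)) := \bigcup_(P in T) HP P.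
Local Notation K := tiling_packing.

Lemma tiling_packing_meet B P x : K B -> T P -> P x -> B x -> HP P B.
Proof.
move=> [Q TQ]; have [I [v [n [c fQ]]]] := hF TQ.
rewrite {1}(HP_framed fQ) => -[i _ <-] TP Px Bx.
exact: (horoball_global hT hF TQ TP fQ Px Bx).
Qed.

Lemma tiling_packing_horoball B : K B -> exists p, horoball_at p B.
Proof.
move=> [Q TQ]; have [I [v [n [c fQ]]]] := hF TQ.
rewrite (HP_framed fQ) => -[i _ <-]; exists (v i).
exact/(tile_ball_center (fr_tile fQ)).
Qed.

Lemma HP_packing P : T P -> packing (HP P).
Proof.
move=> TP; have [I [v [n [c fP]]]] := hF TP; rewrite (HP_framed fP).
exact: tile_packing_packing (fr_tile fP).
Qed.

Lemma tiling_packing_packing : packing K.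
Proof.
split=> [B /tiling_packing_horoball //|B B' KB KB' ne].
rewrite -subset0 => x [Bx B'x]; have [Q TQ Qx] := tile_at hT x.
have HB := tiling_packing_meet KB TQ Qx (interior_subset Bx).
have HB' := tiling_packing_meet KB' TQ Qx (interior_subset B'x).
by have [_ disj] := HP_packing TQ; rewrite -(disj _ _ HB HB' ne).
Qed.

(** The balls at [p] coming from two tiles are nested. The smaller one meets its own tile, hence so
    does the larger, and then both belong to the packing of that tile. *)
Lemma tiling_packing_vertex B P p : K B -> horoball_at p B -> T P -> ideal_vertex P p -> HP P B.
Proof.
move=> KB hB TP Pp; have [Q TQ HB] := KB.
have [I [v [n [c fQ]]]] := hF TQ; have frQ := fr_tile fQ.
have [J [w [m [d fP]]]] := hF TP; have frP := fr_tile fP.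
have := HB; rewrite {1}(HP_framed fQ) => -[i _ eB].
have vi : v i = p by apply/(tile_ball_center frQ); rewrite eB.
have [k wk] := proj1 (tile_vertexP frP p) Pp.
have [s s0 es] := tf_rays frQ i; have [t t0 et] := tf_rays frP k.
rewrite vi in es; rewrite wk in et.
have mono (a b : R) : a <= b -> hball (b *: nv p) `<=` hball (a *: nv p).
  move=> ab x; rewrite /hball /= !lfZr; apply: le_trans.
  by rewrite ler_wpM2r // ltW // lf_timelike_nv //; exact: X_timelike.
have HPk : HP P (hball (m k)) by rewrite (HP_framed fP); exists k.
have [st|ts] := leP s t.
  have [x [Px hx]] := tile_ball_meets frP k.
  by apply: (tiling_packing_meet KB TP Px); rewrite -eB es; apply: (mono _ _ st); rewrite -et.
have [x [Qx hx]] := tile_ball_meets frQ i.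
have Kk : K (hball (m k)) by exists P.
have HQk : HP Q (hball (m k)).
  by apply: (tiling_packing_meet Kk TQ Qx); rewrite et; apply: (mono _ _ (ltW ts)); rewrite -es.
suff -> : B = hball (m k) by [].
apply: (packing_center (HP_packing TQ) HB HQk hB).
by apply/(tile_ball_center frP).
Qed.

Lemma tiling_packing_meetP p B P : K B -> horoball_at p B -> T P ->
  (B `&` P !=set0 <-> ideal_vertex P p).
Proof.
move=> KB hB TP; have [I [v [n [c fP]]]] := hF TP; have frP := fr_tile fP.
split=> [[x [Bx Px]]|Pp].
  have := tiling_packing_meet KB TP Px Bx; rewrite (HP_framed fP) => -[i _ eB].
  by apply/(tile_vertexP frP); exists i; apply/(tile_ball_center frP); rewrite eB.
have := tiling_packing_vertex KB hB TP Pp; rewrite (HP_framed fP) => -[i _ <-].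
by have [x [Px hx]] := tile_ball_meets frP i; exists x.
Qed.

Lemma tiling_packing_invariant (G : set (H3 R -> H3 R)) :
  (forall g, G g -> is_isometry g) -> invariant_under G T -> invariant_under G K.
Proof.
move=> Gi GT g B Gg [P TP HB]; have TgP := GT _ _ Gg TP.
by exists (g @` P) => //; apply: HP_image => //; [exact: Gi|exact: hF|exact: hF].
Qed.

Lemma tiling_packing_centers : centers K = tiling_vertices T.
Proof.
apply/seteqP; split=> p.
  move=> [B KB hB]; have [P TP] := KB; have [I [v [n [c fP]]]] := hF TP.
  have frP := fr_tile fP; rewrite (HP_framed fP) => -[i _ eB].
  exists P => //; apply/(tile_vertexP frP); exists i.
  by apply/(tile_ball_center frP); rewrite eB.
move=> [P TP]; have [I [v [n [c fP]]]] := hF TP; have frP := fr_tile fP.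
move=> /(tile_vertexP frP)[i <-]; exists (hball (n i)); last exact/(tile_ball_center frP).
by exists P; rewrite // (HP_framed fP); exists i.
Qed.

Lemma tiling_packing_adapted (G : set (H3 R -> H3 R)) :
  (forall g, G g -> is_isometry g) -> invariant_under G T -> adapted_packing G T K.
Proof.
move=> Gi GT; split.
- exact: tiling_packing_packing.
- exact: tiling_packing_invariant.
- exact: tiling_packing_centers.
by move=> P p B TP Pp KB hB; exact: tiling_packing_vertex KB hB TP Pp.
Qed.

Lemma adapted_packing_unique (G : set (H3 R -> H3 R)) K' : adapted_packing G T K' -> K' = K.
Proof.
move=> [[hK' _] _ cK' hP]; apply/seteqP; split=> B.
  move=> KB; have [p hB] := hK' _ KB.
  have [P TP Pp] : tiling_vertices T p by rewrite -cK'; exists B.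
  by exists P => //; exact: hP TP Pp KB hB.
move=> KB; have [p hB] := tiling_packing_horoball KB.
have [P TP Pp] : tiling_vertices T p by rewrite -tiling_packing_centers; exists B.
have [B' K'B' hB'] : centers K' p by rewrite cK'; exists P.
have HB := tiling_packing_vertex KB hB TP Pp.
by rewrite (packing_center (HP_packing TP) HB (hP _ _ _ TP Pp K'B' hB') hB hB').
Qed.

Lemma tile_tangent (I : finType) P (v : I -> ideal R) n c i j : tile_frame P v n c ->
  lf (n i) (n j) = 1 -> tangent (hball (n i)) (hball (n j)).
Proof.
move=> fr ij1; have ij := tile_neq fr ij1.
have vij : v i <> v j by move=> /(tf_inj fr) /eqP; rewrite (negPf ij).
have [s s0 es] := tf_rays fr i; have [t t0 et] := tf_rays fr j.
by exists (hproj (n i + n j)); exact: (hball_tangent vij s0 t0 es et).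
Qed.

(** Any tile through the point of tangency has both balls in its own packing. *)
Lemma tangent_tile B B' p p' : K B -> K B' -> horoball_at p B -> horoball_at p' B' ->
  tangent B B' -> exists2 P, T P & exists (I : finType) (v : I -> ideal R) n c,
  framed P v n c /\ exists i j, [/\ v i = p, v j = p', B = hball (n i), B' = hball (n j)
    & lf (n i) (n j) = 1].
Proof.
move=> KB KB' hB hB' [x tx]; have [Bx B'x] : (B `&` B') x by rewrite tx.
have [P TP Px] := tile_at hT x; exists P => //.
have [I [v [n [c fP]]]] := hF TP; have frP := fr_tile fP.
exists I, v, n, c; split=> //.
have := tiling_packing_meet KB TP Px Bx; rewrite (HP_framed fP) => -[i _ eB].
have := tiling_packing_meet KB' TP Px B'x; rewrite (HP_framed fP) => -[j _ eB'].
subst B B'; exists i, j; split=> //.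
- exact/(tile_ball_center frP).
- exact/(tile_ball_center frP).
have [s s0 es] := tf_rays frP i; have [t t0 et] := tf_rays frP j.
have ij : i != j.
  apply/eqP => e; move: tx; rewrite e setIid et; exact: hball_not_singleton.
have vij : v i <> v j by move=> /(tf_inj frP) /eqP; rewrite (negPf ij).
by have [] := hball_meet vij s0 t0 es et (tf_ge1 frP ij) Bx B'x.
Qed.

Lemma tiling_edges_tangency : tiling_edges T = tangency_geodesics K.
Proof.
apply/seteqP; split=> e.
  move=> [P TP]; have [I [v [n [c fP]]]] := hF TP; have frP := fr_tile fP.
  move=> /(tile_edgeP frP)[i [j [ij1 ->]]].
  have Kn k : K (hball (n k)) by exists P; rewrite // (HP_framed fP); exists k.
  exists (hball (n i)), (hball (n j)), (v i), (v j); split.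
    by split=> //; exact/(tile_ball_center frP).
  by split=> //; exact: tile_tangent frP ij1.
move=> [B [B' [p [p' [[KB KB' hB hB'] [tB ->]]]]]].
have [P TP [I [v [n [c [fP [i [j [vi vj _ _ ij1]]]]]]]]] := tangent_tile KB KB' hB hB' tB.
by exists P => //; apply/(tile_edgeP (fr_tile fP)); exists i, j; rewrite vi vj.
Qed.

Lemma tangent_lf p p' (s t : R) : 0 < s -> 0 < t -> K (hball (s *: nv p)) -> K (hball (t *: nv p')) ->
  tangent (hball (s *: nv p)) (hball (t *: nv p')) -> p <> p' /\ lf (s *: nv p) (t *: nv p') = 1.
Proof.
move=> s0 t0 Kp Kp' tB.
have hB : horoball_at p (hball (s *: nv p)) by apply/horoball_hball.
have hB' : horoball_at p' (hball (t *: nv p')) by apply/horoball_hball.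
have [P TP [I [v [n [c [fP [i [j [vi vj eB eB' ij1]]]]]]]]] := tangent_tile Kp Kp' hB hB' tB.
have frP := fr_tile fP; have [a a0 ea] := tf_rays frP i; have [b b0 eb] := tf_rays frP j.
rewrite ea in eB; have [_ sa] := hball_inj s0 a0 eB.
rewrite eb in eB'; have [_ tb] := hball_inj t0 b0 eB'.
split; last by rewrite sa tb -vi -vj -ea -eb.
by rewrite -vi -vj => /(tf_inj frP) /eqP; rewrite (negPf (tile_neq frP ij1)).
Qed.

Lemma packing_vector (I : finType) P (v : I -> ideal R) n c p (s : R) i : T P -> framed P v n c ->
  0 < s -> K (hball (s *: nv p)) -> n i = s *: nv p \/ 1 <= lf (n i) (s *: nv p).
Proof.
move=> TP fP s0 Kp; have frP := fr_tile fP; have [t t0 et] := tf_rays frP i.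
have Ki : K (hball (n i)) by exists P; rewrite // (HP_framed fP); exists i.
have [e|ne] := pselect (v i = p); [left|right].
  have e' : hball (n i) = hball (s *: nv p).
    apply: (packing_center tiling_packing_packing Ki Kp (p := p)).
      exact/(tile_ball_center frP).
    exact/horoball_hball.
  by rewrite et in e' *; have [-> ->] := hball_inj t0 s0 e'.
by rewrite et in Ki *; exact: (packing_ge1 tiling_packing_packing ne).
Qed.

(* If [x = a (N1 + N2 + N3)] lies in a tile with centre vector [c], then the
   functionals [c] and [(N1 + N2 + N3) / 2], both at least 1 on every horoball of
   the packing, force the weights of [x] to be carried by [N1], [N2] and [N3]. *)
Lemma tangent_triple_tile p1 p2 p3 (s1 s2 s3 : R) : 0 < s1 -> 0 < s2 -> 0 < s3 ->
  K (hball (s1 *: nv p1)) -> K (hball (s2 *: nv p2)) -> K (hball (s3 *: nv p3)) ->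
  lf (s1 *: nv p1) (s2 *: nv p2) = 1 -> lf (s2 *: nv p2) (s3 *: nv p3) = 1 ->
  lf (s1 *: nv p1) (s3 *: nv p3) = 1 ->
  exists2 P, T P & exists (I : finType) (v : I -> ideal R) n c, framed P v n c /\
   exists i j k, [/\ n i = s1 *: nv p1, n j = s2 *: nv p2 & n k = s3 *: nv p3].
Proof.
move=> s10 s20 s30 K1 K2 K3.
have null (s : R) p : lf (s *: nv p) (s *: nv p) = 0 by rewrite !lfE lf_nvv !mulr0.
have caus (s : R) p : 0 < s -> causal (s *: nv p).
  by move=> s0; apply: causalZ; [exact: ltW|exact: nv_causal].
have vec1 I P v n c i TP fP := @packing_vector I P v n c p1 s1 i TP fP s10 K1.
have vec2 I P v n c i TP fP := @packing_vector I P v n c p2 s2 i TP fP s20 K2.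
have vec3 I P v n c i TP fP := @packing_vector I P v n c p3 s3 i TP fP s30 K3.
move: (null s1 p1) (null s2 p2) (null s3 p3) (caus s1 p1 s10) (caus s2 p2 s20) (caus s3 p3 s30).
move: vec1 vec2 vec3; move: (s1 *: nv p1) (s2 *: nv p2) (s3 *: nv p3) => N1 N2 N3.
move=> vec1 vec2 vec3 n11 n22 n33 c1 c2 c3 e12 e23 e13.
have e21 := e12; rewrite lfC in e21; have e32 := e23; rewrite lfC in e32.
have e31 := e13; rewrite lfC in e31.
pose S := N1 + N2 + N3.
have tS : timelike S.
  apply: causal_timelike; first by apply: causalD => //; exact: causalD.
  by rewrite /S !lfE n11 n22 n33 e12 e21 e13 e31 e23 e32; lra.
have [P TP Px] := tile_at hT (hproj S); exists P => //.
have [I [v [n [c fP]]]] := hF TP; have frP := fr_tile fP.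
exists I, v, n, c; split=> //.
have [b b0 eS] := timelike_proj tS.
have [l0' l0p el'] := proj1 (tile_spanned frP _) Px.
pose l i := b * l0' i.
have l0 i : 0 <= l i by rewrite mulr_ge0 // ltW.
have el : S = \sum_i l i *: n i.
  by rewrite {1}eS el' scaler_sumr; apply: eq_bigr => i _; rewrite scalerA.
(* The Delaunay property: [c] is a nonnegative combination of vertex vectors, of total weight
   [lf c c >= 1], and each of these pairs with [N] to at least 1. *)
have cge N : (forall i, n i = N \/ 1 <= lf (n i) N) -> 1 <= lf c N.
  move=> hN; have [[i <-]|none] := pselect (exists i, n i = N); first by rewrite (tf_center frP).
  have {}hN i : 1 <= lf (n i) N by case: (hN i) => // e; case: none; exists i.
  have [k k0 ec] := tf_comb frP.
  have : \sum_(i : I) k <= lf c N.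
    by rewrite ec; apply: (lf_combo_ge (l := fun=> k)) => // j _; exact: hN.
  apply: le_trans; have := tf_cc frP; rewrite {1}ec lf_suml.
  by under eq_bigr do rewrite lfZl lfC (tf_center frP) mulr1.
have h3 : 3 <= \sum_i l i.
  have <- : lf c S = \sum_i l i.
    by rewrite el lf_sumr; apply: eq_bigr => i _; rewrite lfZr (tf_center frP) mulr1.
  have g1 : 1 <= lf c N1 by apply: cge => i; exact: vec1 TP fP.
  have g2 : 1 <= lf c N2 by apply: cge => i; exact: vec2 TP fP.
  have g3 : 1 <= lf c N3 by apply: cge => i; exact: vec3 TP fP.
  by rewrite /S !lfDr; lra.
have S6 : lf S S = 6 by rewrite /S !lfE n11 n22 n33 e12 e21 e13 e31 e23 e32; lra.
have ge2 i : 2 <= lf (n i) S /\ (n i <> N1 -> n i <> N2 -> n i <> N3 -> 3 <= lf (n i) S).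
  rewrite /S !lfDr.
  have [h1|h1] := vec1 _ _ _ _ _ i TP fP; first by rewrite h1 n11 e12 e13; split; [lra|move=> /(_ erefl)].
  have [h2|h2] := vec2 _ _ _ _ _ i TP fP; first by rewrite h2 n22 e21 e23; split; [lra|move=> _ /(_ erefl)].
  have [h4|h4] := vec3 _ _ _ _ _ i TP fP; first by rewrite h4 n33 e31 e32; split; [lra|move=> _ _ /(_ erefl)].
  by split; [|move=> _ _ _]; lra.
(* Every term contributes at least twice its weight to [lf S S = 6], and one outside the triple
   three times; with total weight at least 3 there is no room for the latter. *)
have supp i : 0 < l i -> [\/ n i = N1, n i = N2 | n i = N3].
  move=> li; apply: contrapT => h.
  have hi : 3 <= lf (n i) S.
    by apply: (proj2 (ge2 i)) => e; apply: h; [constructor 1|constructor 2|constructor 3].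
  have : 2 * (\sum_j l j) + l i <= lf S S.
    rewrite {1}el lf_suml (bigD1 i) //= mulrDr [X in _ <= X](bigD1 i) //= lfZl.
    have r1 : 2 * \sum_(j | j != i) l j <= \sum_(j | j != i) lf (l j *: n j) S.
      rewrite mulr_sumr; apply: ler_sum => j _; rewrite lfZl mulrC ler_wpM2l //.
      by case: (ge2 j).
    have r2 : l i * 3 <= l i * lf (n i) S by rewrite ler_wpM2l.
    lra.
  by rewrite S6; lra.
(* If [N] were not a vertex of the tile, [lf S N] would be at least the total weight, hence at least
   3, but it is 2. *)
have find N : lf N S = 2 -> (forall i, n i = N \/ 1 <= lf (n i) N) -> exists i, n i = N.
  move=> NS hN; apply: contrapT => none.
  have {}hN i : 1 <= lf (n i) N by case: (hN i) => // e; case: none; exists i.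
  have : \sum_i l i <= lf S N by rewrite el; apply: lf_combo_ge.
  by rewrite lfC NS; lra.
have [i ei] : exists i, n i = N1.
  by apply: find => [|i]; [rewrite /S !lfDr n11 e12 e13; lra|exact: vec1 TP fP].
have [j ej] : exists i, n i = N2.
  by apply: find => [|a]; [rewrite /S !lfDr n22 e21 e23; lra|exact: vec2 TP fP].
have [k ek] : exists i, n i = N3.
  by apply: find => [|a]; [rewrite /S !lfDr n33 e31 e32; lra|exact: vec3 TP fP].
by exists i, j, k.
Qed.

Lemma tiling_facets_tangency : tiling_facets T = tangency_triangles K.
Proof.
apply/seteqP; split=> F.
  move=> [P TP]; have [I [v [n [c fP]]]] := hF TP; have frP := fr_tile fP.
  move=> /(tile_facetP frP)[i [j [k [ij1 jk1 ik1 ->]]]].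
  have Kn a : K (hball (n a)) by exists P; rewrite // (HP_framed fP); exists a.
  exists (hball (n i)), (hball (n j)), (hball (n k)), (v i), (v j), (v k).
  split=> //; split; first by split; exact/(tile_ball_center frP).
  by split=> //; split; exact: tile_tangent frP _.
move=> [B1 [B2 [B3 [p1 [p2 [p3 [[K1 K2 K3] [[h1 h2 h3] [[t12 t23 t13] ->]]]]]]]]].
have [s1 s10 e1] := proj1 (horoball_atP _ _) h1; have [s2 s20 e2] := proj1 (horoball_atP _ _) h2.
have [s3 s30 e3] := proj1 (horoball_atP _ _) h3; subst B1 B2 B3.
have [_ l12] := tangent_lf s10 s20 K1 K2 t12; have [_ l23] := tangent_lf s20 s30 K2 K3 t23.
have [_ l13] := tangent_lf s10 s30 K1 K3 t13.
have [P TP [I [v [n [c [fP [i [j [k [ei ej ek]]]]]]]]]] :=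
  tangent_triple_tile s10 s20 s30 K1 K2 K3 l12 l23 l13.
have frP := fr_tile fP; exists P => //; apply/(tile_facetP frP); exists i, j, k.
rewrite ei ej ek; split=> //.
have vE a p (s : R) : 0 < s -> n a = s *: nv p -> v a = p.
  by move=> s0 ea; apply/(tile_ball_center frP); rewrite ea; apply/horoball_hball.
by rewrite (vE _ _ _ s10 ei) (vE _ _ _ s20 ej) (vE _ _ _ s30 ek).
Qed.

End Fixed.

(** * Tiles in standard position *)

Lemma hball_infty : hball (nv (None : ideal R)) = [set x | 1 <= ht x].
Proof.
apply/predeqP => -[[[a b] t] /= t0]; rewrite /hball /ht /=.
have -> : lf (X (@MkH3 R (a, b, t) t0)) (1, 0, 0, 0) = t^-1.
  by rewrite lf.unlock /X /=; field; exact: lt0r_neq0.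
by rewrite invf_le1.
Qed.

(** The opposite pairs are infinity with the centre of the unit square, and the ends of each
    diagonal of the square. *)
Definition octahedron_points (d : 'I_3 * bool) : ideal R := nth None
  (if d.2 then [:: None; Some (Complex 0 0); Some (Complex 1 0)]
   else [:: Some (Complex (1 / 2) (1 / 2)); Some (Complex 1 1); Some (Complex 0 1)]) d.1.

Lemma octahedron_points_inj : injective octahedron_points.
Proof.
move=> [[[|[|[|//]]] hi] [|]] [[[|[|[|//]]] hj] [|]]; rewrite /octahedron_points //= => e;
  try (by congr pair; apply: val_inj); exfalso; move: e => [] *; lra.
Qed.

Lemma standard_position_ball P : standard_position P -> HP P [set x : H3 R | 1 <= ht x].
Proof.
rewrite -hball_infty; move=> [[rP V]|[rP V]].
  have hF := regular_has_frame (or_introl rP).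
  have [v [n [c [frP _]]]] := regular_tetrahedron_frame rP.
  pose w (i : 'I_4) : ideal R := nth None [:: None; Some (Complex 0 0); Some (Complex 1 0);
    Some (Complex (1 / 2) (Num.sqrt 3 / 2))] i.
  have s3 : (Num.sqrt 3 / 2) ^+ 2 = 3 / 4 :> R by rewrite expr_div_n sqr_sqrtr //; lra.
  (* The finite vertices form an equilateral triangle of side 1, so the vectors [nv] are already
     normalised. *)
  have m1 i j : i != j -> lf (nv (w i)) (nv (w j)) = 1.
    move: s3; move: (Num.sqrt 3 / 2) @w => t w ht.
    by case: i => [[|[|[|[|//]]]] hi]; case: j => [[|[|[|[|//]]]] hj] //= _;
      rewrite lf.unlock /=; lra.
  have wI : injective w.
    move=> i j e; apply/eqP; apply: contraT => /m1; rewrite e lf_nvv => /eqP.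
    by rewrite eq_sym oner_eq0.
  have PW : P = ideal_hull (range w).
    rewrite {1}(tf_hull frP); congr ideal_hull; apply/predeqP => p.
    have -> : range v p <-> ideal_vertex P p.
      rewrite (tile_vertexP frP); split=> [[i _ <-]|[i <-]]; first by exists i.
      by exists i.
    rewrite V; split=> [/= [[[->|->]|->]|->]|].
    - by exists (@Ordinal 4 0 isT).
    - by exists (@Ordinal 4 1 isT).
    - by exists (@Ordinal 4 2 isT).
    - by exists (@Ordinal 4 3 isT).
    move=> [[[|[|[|[|//]]]] hi] _ <-] /=; rewrite /w /=;
      [by left; left; left|by left; left; right|by left; right|by right].
  have frW := tetrahedron_frame wI PW (rays_nv w) m1.
  exact: (HP_canonical (@Ordinal 4 0 isT) hF wI PW (rays_nv w) (tf_card frW) (tf_prod frW)).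
have hF := regular_has_frame (or_intror rP).
have [v [n [c [frP _ _]]]] := regular_octahedron_frame rP.
pose w := octahedron_points.
(* The centre of the square is at squared distance 1/2 from the corners; doubling its vector makes
   these pairings 1, and the vector of infinity keeps the scale 1. *)
pose m (d : 'I_3 * bool) : vec R := (if (d.1 == 0%N :> nat) && ~~ d.2 then 2 else 1) *: nv (w d).
have mr : rays w m.
  by move=> d; exists (if (d.1 == 0%N :> nat) && ~~ d.2 then 2 else 1) => //; case: ifP.
have m1 i a j b : i != j -> lf (m (i, a)) (m (j, b)) = 1.
  by case: i => [[|[|[|//]]] hi]; case: j => [[|[|[|//]]] hj] //= _; case: a; case: b;
    rewrite /m /w /octahedron_points /= !lfE lf.unlock /=; lra.
have wI : injective w by exact: octahedron_points_inj.
have PW : P = ideal_hull (range w).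
  rewrite {1}(tf_hull frP); congr ideal_hull; apply/predeqP => p.
  have -> : range v p <-> ideal_vertex P p.
    rewrite (tile_vertexP frP); split=> [[i _ <-]|[i <-]]; first by exists i.
    by exists i.
  rewrite V; split=> [/= [[[[[->|->]|->]|->]|->]|->]|].
  - by exists (@Ordinal 3 0 isT, true).
  - by exists (@Ordinal 3 1 isT, true).
  - by exists (@Ordinal 3 2 isT, true).
  - by exists (@Ordinal 3 1 isT, false).
  - by exists (@Ordinal 3 2 isT, false).
  - by exists (@Ordinal 3 0 isT, false).
  move=> [[[[|[|[|//]]] hi] [|]] _ <-] /=; rewrite /w /octahedron_points /=.
  - by left; left; left; left; left.
  - by right.
  - by left; left; left; left; right.
  - by left; left; right.
  - by left; left; left; right.
  - by left; right.
have frW := octahedron_frame wI PW mr m1.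
have := HP_canonical (@Ordinal 3 0 isT, true) hF wI PW mr (tf_card frW) (tf_prod frW).
by rewrite /m /= scale1r.
Qed.

End TilingPacking.

Theorem lemma3p6 (R : realType) (G : set (H3 R -> H3 R))
    (T : set (set (H3 R)))
    (hG : mixed_platonic G) (hT : platonic_tiling T) (hGT : invariant_under G T) :
  exists K : set (set (H3 R)),
    (adapted_packing G T K /\
     forall K', adapted_packing G T K' -> K' = K) /\
    [/\ forall p B P, K B -> horoball_at p B -> T P ->
          (B `&` P !=set0 <-> ideal_vertex P p),
        (exists2 P, T P & standard_position P) ->
          K [set x : H3 R | 1 <= ht x]
      & tiling_of_packing K T /\
        forall T', tiling_of_packing K T' -> T' = T].
Proof.
have [[Gi _ _ _] _ _ _] := hG; have [tT regT] := hT.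
have hF P : T P -> has_frame P by move=> /regT; exact: regular_has_frame.
exists (tiling_packing T); split; first split.
- exact: tiling_packing_adapted.
- by move=> K'; exact: adapted_packing_unique.
split.
- by move=> p B P; exact: tiling_packing_meetP.
- by move=> [P TP sP]; exists P => //; exact: standard_position_ball.
have eF := tiling_facets_tangency tT hF.
split; first by split=> //; exact: tiling_edges_tangency.
by move=> T' [tT' _ eF']; apply: tiling_facets_inj => //; rewrite eF' eF.
Qed.
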